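(* Let $\phi:A\to B$ be a surjective map of augmented rings with $B$ of depth one. If $\ell(\Phi_A)\le\ell(\mathcal{O}/\eta_B)<\infty$, then $\phi$ is an isomorphism and the rings $A$ and $B$ are complete intersections.
   Context: All rings are commutative, noetherian, local and complete. $\mathcal{O}$ is a discrete valuation ring. An augmented ring is a complete noetherian local ring $A$ with a surjective ring homomorphism $\pi_A:A\to\mathcal{O}$ such that $\Phi_A:=\ker(\pi_A)/(\ker(\pi_A))^2$ is of finite length. A map of augmented rings $\phi:A\to B$ is a local ring homomorphism with $\pi_B\circ\phi=\pi_A$ (same $\mathcal{O}$). One sets $\eta_A:=\pi_A(\mathrm{Ann}_A(\ker(\pi_A)))$, an ideal of $\mathcal{O}$, and likewise for $B$. $\ell$ denotes length as an $\mathcal{O}$-module. *)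

(* Defs.v *)
From HB Require Import structures.
From mathcomp Require Import all_boot all_order all_algebra.
From mathcomp Require Import boolp classical_sets functions.

Set Implicit Arguments.
Unset Strict Implicit.
Unset Printing Implicit Defensive.

Import GRing.Theory.
Local Open Scope ring_scope.
Local Open Scope classical_set_scope.
Local Open Scope quotient_scope.

(* Only [c 0], ..., [c n] matter. *)
Definition strict_chain (T : Type) (P : set (set T)) (n : nat)
    (c : nat -> set T) : Prop :=
  (forall i, (i <= n)%N -> P (c i)) /\
  (forall i, (i < n)%N -> c i `<` c i.+1).

(* The supremum of the lengths of strict chains in [P] is the natural number
   [n] (in particular it is finite, and [P] is not empty). *)
Definition chain_sup (T : Type) (P : set (set T)) (n : nat) : Prop :=
  (exists c, strict_chain P n c) /\
  (forall k c, strict_chain P k c -> (k <= n)%N).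

Definition is_submodule (R : pzRingType) (M : lmodType R) (N : set M) : Prop :=
  N 0 /\ forall a x y, N x -> N y -> N (a *: x + y).

Definition has_length (R : pzRingType) (M : lmodType R) (n : nat) : Prop :=
  chain_sup (@is_submodule R M) n.

Definition finite_length (R : pzRingType) (M : lmodType R) : Prop :=
  exists n, has_length M n.

Section Ideals.
Variable R : comNzRingType.

Definition is_ideal (I : set R) : Prop := @is_submodule R R^o I.

Definition ideal_gen (X : set R) : set R := smallest is_ideal X.

Definition ideal_mul (I J : set R) : set R :=
  ideal_gen [set z | exists x y, [/\ I x, J y & z = x * y]].

Definition ideal_exp (I : set R) (n : nat) : set R :=
  iter n (ideal_mul I) setT.

Definition prime_ideal (I : set R) : Prop :=
  [/\ is_ideal I, ~ I 1 & forall x y, I (x * y) -> I x \/ I y].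

Definition maximal_ideal (I : set R) : Prop :=
  [/\ is_ideal I, ~ I 1 &
      forall J, is_ideal J -> ~ J 1 -> I `<=` J -> J = I].

Definition annihilator (I : set R) : set R :=
  [set a | forall x, I x -> a * x = 0].

Definition noetherian : Prop :=
  forall I, is_ideal I -> exists s : seq R, I = ideal_gen [set` s].

Definition local_ring : Prop := exists! m, maximal_ideal m.

(* Meaningful for local rings only; [get] is an arbitrary choice otherwise. *)
Definition max_ideal : set R := get maximal_ideal.

(* The canonical map from [R] to the inverse limit of the [R / I ^ n] is
   injective and surjective. *)
Definition adic_complete (I : set R) : Prop :=
  (forall x, (forall n, ideal_exp I n x) -> x = 0) /\
  (forall u : nat -> R, (forall n, ideal_exp I n (u n.+1 - u n)) ->
     exists l, forall n, ideal_exp I n (l - u n)).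

Definition complete_noetherian_local : Prop :=
  [/\ noetherian, local_ring & adic_complete max_ideal].

Definition dvr : Prop :=
  [/\ GRing.integral_domain_axiom R,
      forall I, is_ideal I -> exists x, I = ideal_gen [set x],
      local_ring & max_ideal <> [set 0]].

Definition krull_dim (n : nat) : Prop := chain_sup prime_ideal n.

Definition regular_local_ring : Prop :=
  [/\ noetherian, local_ring &
      exists s : seq R,
        krull_dim (size s) /\ max_ideal = ideal_gen [set` s]].

(* [s`_i] is a nonzerodivisor on the quotient of [R] by the previous terms,
   and [R / (s)] is not zero. *)
Definition regular_sequence (s : seq R) : Prop :=
  (forall i, (i < size s)%N -> forall x,
     ideal_gen [set` take i s] (s`_i * x) -> ideal_gen [set` take i s] x) /\
  ~ ideal_gen [set` s] 1.

(* For local [R]: the maximal length of a regular sequence in the maximal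
   ideal. *)
Definition has_depth (n : nat) : Prop :=
  (exists s : seq R,
     [/\ size s = n, [set` s] `<=` max_ideal & regular_sequence s]) /\
  (forall s : seq R,
     [set` s] `<=` max_ideal -> regular_sequence s -> (size s <= n)%N).

End Ideals.

Arguments maximal_ideal {R} I.
Arguments max_ideal R : clear implicits.

Definition ring_ker (A B : pzRingType) (f : {rmorphism A -> B}) : set A :=
  [set a | f a = 0].

Definition local_hom (A B : comNzRingType) (f : {rmorphism A -> B}) : Prop :=
  f @` max_ideal A `<=` max_ideal B.

(* Meant for [R] complete: in general it is the completion of [R] that should
   be a regular local ring modulo a regular sequence. *)
Definition complete_intersection (R : comNzRingType) : Prop :=
  exists (S : comNzRingType) (f : {rmorphism S -> R}) (s : seq S),
    [/\ complete_noetherian_local S, regular_local_ring S,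
        set_surj setT setT f, regular_sequence s &
        ring_ker f = ideal_gen [set` s]].

Lemma ideal_gen_ideal (R : comNzRingType) (X : set R) : is_ideal (ideal_gen X).
Proof.
split=> [I [[I0 _] _] //|a x y hx hy I [hI hX]].
by apply: hI.2; [apply: hx | apply: hy].
Qed.

Lemma ideal_mul_in (R : comNzRingType) (I J : set R) x y :
  I x -> J y -> ideal_mul I J (x * y).
Proof. by move=> Ix Jy K [_]; apply; exists x, y. Qed.

Record submodule (R : pzRingType) (M : lmodType R) := Submodule {
  submod_set :> set M;
  submod_setP : is_submodule submod_set }.

Section SubmoduleType.
Variables (R : pzRingType) (M : lmodType R) (N : submodule M).

Definition submod_pred : {pred M} := fun x => `[< submod_set N x >].

Fact submod_pred_closed : submod_closed submod_pred.
Proof.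
have [S0 SD] := submod_setP N.
split=> [|a x y /asboolP hx /asboolP hy]; apply/asboolP => //.
exact: SD.
Qed.
HB.instance Definition _ := GRing.isSubmodClosed.Build R M submod_pred
  submod_pred_closed.

Record submod_type :=
  SubmodType { submod_val :> M; submod_valP : submod_val \in submod_pred }.
HB.instance Definition _ := [isSub for submod_val].
HB.instance Definition _ := [Choice of submod_type by <:].
HB.instance Definition _ := [SubChoice_isSubLmodule of submod_type by <:].

End SubmoduleType.

Section QuotientModule.
Variables (R : pzRingType) (M : lmodType R) (N : submodule M).

Definition quotient_module := Quotient.quot (submod_pred N).
HB.instance Definition _ := GRing.Zmodule.on quotient_module.

Definition quotient_scale (a : R) (x : quotient_module) : quotient_module :=
  \pi_quotient_module (a *: repr x).

Lemma quotient_moduleE (x y : M) :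
  \pi_quotient_module x = \pi_quotient_module y <-> submod_set N (x - y).
Proof.
split=> [/eqP|h]; first by rewrite -Quotient.idealrBE => /asboolP.
by apply/eqP; rewrite -Quotient.idealrBE; apply/asboolP.
Qed.

Lemma quotient_scaleE a (x : M) :
  quotient_scale a (\pi_quotient_module x) = \pi_quotient_module (a *: x).
Proof.
apply/quotient_moduleE; rewrite -scalerBr.
have [S0 SD] := submod_setP N; rewrite -[_ *: _]addr0; apply: SD => //.
by apply/quotient_moduleE; rewrite reprK.
Qed.

Lemma quotient_piP (v : quotient_module) : exists x, v = \pi_quotient_module x.
Proof. by exists (repr v); rewrite reprK. Qed.

Fact quotient_scaleA a b v :
  quotient_scale a (quotient_scale b v) = quotient_scale (a * b) v.
Proof. by have [x ->] := quotient_piP v; rewrite !quotient_scaleE scalerA. Qed.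

Fact quotient_scale1 : left_id 1 quotient_scale.
Proof.
by move=> v; have [x ->] := quotient_piP v; rewrite quotient_scaleE scale1r.
Qed.

Fact quotient_scaleDr : right_distributive quotient_scale +%R.
Proof.
move=> a u v; have [x ->] := quotient_piP u; have [y ->] := quotient_piP v.
by rewrite -raddfD !quotient_scaleE scalerDr raddfD.
Qed.

Fact quotient_scaleDl v : {morph quotient_scale^~ v : a b / a + b}.
Proof.
move=> a b; have [x ->] := quotient_piP v.
by rewrite !quotient_scaleE scalerDl raddfD.
Qed.

HB.instance Definition _ := GRing.Zmodule_isLmodule.Build R quotient_module
  quotient_scaleA quotient_scale1 quotient_scaleDr quotient_scaleDl.

Lemma scale_quotientE a (x : M) :
  a *: (\pi_quotient_module x : quotient_module) =
  \pi_quotient_module (a *: x).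
Proof. exact: quotient_scaleE. Qed.

End QuotientModule.

Record augmentation (A O : comNzRingType) := Augmentation {
  aug_map :> {rmorphism A -> O};
  aug_surj : set_surj setT setT aug_map }.

Section Augmentation.
Variables (A O : comNzRingType) (p : augmentation A O).

Fact ker_submodule : @is_submodule A A^o (ring_ker p).
Proof.
split=> [|a x y hx hy]; first exact: rmorph0.
change (p (a * (x : A) + y) = 0).
by rewrite rmorphD rmorphM hx hy mulr0 addr0.
Qed.

Definition aug_ker : submodule A^o := Submodule ker_submodule.

Fact ker_sq_submodule : @is_submodule A (submod_type aug_ker)
  [set x | ideal_exp aug_ker 2 (submod_val x)].
Proof.
have [S0 SD] : is_ideal (ideal_exp aug_ker 2) by exact: ideal_gen_ideal.
by split=> [//|a x y]; apply: SD.
Qed.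

(* The square of the kernel, as a submodule of the kernel. *)
Definition aug_ker_sq : submodule (submod_type aug_ker) :=
  Submodule ker_sq_submodule.

(* [ker p / (ker p) ^ 2], whose [O]-module structure is the one through which
   the [A]-module structure factors, see [cotangent_scaleE]. *)
Definition cotangent : Type := quotient_module aug_ker_sq.
HB.instance Definition _ := GRing.Zmodule.on cotangent.

Fact aug_section_subproof (o : O) : exists a, p a = o.
Proof. by have [a _ <-] := @aug_surj _ _ p o I; exists a. Qed.

Definition aug_section (o : O) : A := sval (cid (aug_section_subproof o)).

Definition cotangent_scale (o : O) (v : cotangent) : cotangent :=
  (aug_section o *: (v : quotient_module aug_ker_sq)).

Lemma cotangent_scaleE (a : A) (v : cotangent) :
  cotangent_scale (p a) v = a *: (v : quotient_module aug_ker_sq).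
Proof.
rewrite /cotangent_scale /aug_section; case: cid => b /= hb.
have [x ->] := quotient_piP v; rewrite !scale_quotientE.
apply/quotient_moduleE; rewrite -scalerBl /=.
have /asboolP hx := submod_valP x.
suff : ideal_exp aug_ker 2 ((b - a) * (submod_val x * 1)) by rewrite mulr1.
apply: ideal_mul_in; first by change (p (b - a) = 0); rewrite rmorphB hb subrr.
exact: ideal_mul_in.
Qed.

Fact cotangent_scaleA a b v :
  cotangent_scale a (cotangent_scale b v) = cotangent_scale (a * b) v.
Proof.
have [[x <-] [y <-]] := (aug_section_subproof a, aug_section_subproof b).
by rewrite -rmorphM !cotangent_scaleE scalerA.
Qed.

Fact cotangent_scale1 : left_id 1 cotangent_scale.
Proof. by move=> v; rewrite -(rmorph1 p) cotangent_scaleE scale1r. Qed.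

Fact cotangent_scaleDr : right_distributive cotangent_scale +%R.
Proof. by move=> a u v; rewrite /cotangent_scale scalerDr. Qed.

Fact cotangent_scaleDl v : {morph cotangent_scale^~ v : a b / a + b}.
Proof.
move=> a b.
have [[x <-] [y <-]] := (aug_section_subproof a, aug_section_subproof b).
by rewrite -rmorphD !cotangent_scaleE scalerDl.
Qed.

HB.instance Definition _ := GRing.Zmodule_isLmodule.Build O cotangent
  cotangent_scaleA cotangent_scale1 cotangent_scaleDr cotangent_scaleDl.

Fact eta_submodule : @is_submodule O O^o (p @` annihilator aug_ker).
Proof.
split; first by exists 0 => [x _|]; rewrite ?mul0r ?rmorph0.
move=> a _ _ [x hx <-] [y hy <-]; have [b <-] := aug_section_subproof a.
exists (b * x + y); last by rewrite rmorphD rmorphM.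
by move=> z hz; rewrite mulrDl -mulrA hx // hy // mulr0 addr0.
Qed.

Definition eta : submodule O^o := Submodule eta_submodule.

End Augmentation.

Record augmented_ring (O : comNzRingType) := AugmentedRing {
  aug_ring :> comNzRingType;
  aug_pi : augmentation aug_ring O;
  aug_cnl : complete_noetherian_local aug_ring;
  aug_finite : finite_length (cotangent aug_pi) }.

Definition Phi (O : comNzRingType) (A : augmented_ring O) : lmodType O :=
  cotangent (aug_pi A).

Definition Oeta (O : comNzRingType) (A : augmented_ring O) : lmodType O :=
  quotient_module (eta (aug_pi A)).

Definition augmented_map (O : comNzRingType) (A B : augmented_ring O)
    (phi : {rmorphism A -> B}) : Prop :=
  local_hom phi /\ forall a, aug_pi B (phi a) = aug_pi A a.

(* Main.v *)
Require Import Defs.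
From HB Require Import structures.
From mathcomp Require Import all_boot all_order all_algebra.
From mathcomp Require Import boolp classical_sets functions.
From mathcomp Require Import finmap monalg ring zify.
From mathcomp Require wochoice.

Set Implicit Arguments.
Unset Strict Implicit.
Unset Printing Implicit Defensive.

Import GRing.Theory.
Local Open Scope ring_scope.
Local Open Scope classical_set_scope.
Local Open Scope quotient_scope.

(** By Cohen's structure theorem there is a complete regular local ring [S]
    mapping onto [A], with parameters [w, x_1, ..., x_d] such that [w] lifts a
    uniformizer of [O] and [(x)] is the kernel of [S -> O]. Let [J_A <= J_B] be
    the kernels of the maps from [S] to [A] and [B]. Since [B] has positive depth,
    [w] can be chosen to be a nonzerodivisor on [B].

    A triangular basis of the relations of [Phi_A] lifts to elements
    [f_i = sum_j M_ij x_j] of [J_A] such that [det M] has valuation at most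
    [l(Phi_A)] in [O]. By Cramer's rule [det M] kills the kernel of [B -> O]. If
    [det M = c w] modulo [J_B], then so does [c], whose image in [eta_B] has
    valuation less than [l(Phi_A) <= l(O / eta_B)], which is absurd. Hence
    [det M] is not in [J_B + (w)].

    Modulo [(w, x)] the socle is one-dimensional, and after an [m]-adically small
    change that makes [f] regular modulo [w], [det M] generates the socle modulo
    [(w, f)]. An ideal containing [(w, f)] but not this socle is [(w, f)] itself,
    so [J_B + (w) = (f) + (w)], and Nakayama's lemma gives [J_A = J_B = (f)], with
    [f] a regular sequence.

    The ring [S] is the completion of a filtered polynomial ring over a ring [T]
    mapping to [A]. In residue characteristic zero, [T] is a coefficient field,
    obtained from Zorn's and Hensel's lemmas. In residue characteristic [p], [T]
    is the free commutative ring on the variables [X_a], [a] in [A], filtered so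
    that its completion is a Cohen ring: each [X_a] is identified with an element
    [g_a] of the subring generated by [p]-th powers, multiples of [p] and the
    variables of a [p]-basis. *)


(** * Ideals *)

(** The obstacle is that the lifted relations [f] are not known to be regular, even modulo [w]: this
    is part of the conclusion. By Krull's intersection theorem, [det M] even avoids
    [J_B + (w) + m^N] for some [N]. This ideal absorbs a change of [f] by elements of [m^N (x)],
    which moves [det M] only within [m^N]. The socle argument, run on the perturbed sequence, puts
    [m^N] inside [(w, f)], so that [f] itself turns out to be regular.

    Homological algebra is replaced by explicit computation: the Koszul complex by Cramer's rule,
    the invariance of the type by exchanging one parameter at a time, dimension theory by Krull's
    height theorem.

    Regularity of the cover is stated on a filtered ring, modulo each step of the filtration, and
    only then carried to the completion. In residue characteristic [p] the residue field may be
    imperfect, so Witt vectors would not do. The free ring has no torsion and has a Frobenius lift,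
    which together control divisibility by [p]; [p]-independence of the basis makes [p] alone
    generate the maximal ideal of the Cohen ring. *)

Section IdealTheory.
Variable R : comNzRingType.
Implicit Types (I J K E Q : set R) (s t : seq R) (x y z a c : R).

Lemma is_idealI I : I 0 -> (forall x y, I x -> I y -> I (x + y)) ->
  (forall a x, I x -> I (a * x)) -> is_ideal I.
Proof. by move=> h0 hD hM; split=> // a x y hx hy; apply: hD => //; apply: hM. Qed.

Lemma ideal0 I : is_ideal I -> I 0. Proof. by case. Qed.

Lemma ideal_Ml I a x : is_ideal I -> I x -> I (a * x).
Proof. by case=> h0 h hx; rewrite -[_ * _]addr0; apply: (h a x 0). Qed.

Lemma ideal_Mr I a x : is_ideal I -> I x -> I (x * a).
Proof. by move=> hI hx; rewrite mulrC; apply: ideal_Ml. Qed.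

Lemma idealD I x y : is_ideal I -> I x -> I y -> I (x + y).
Proof. by case=> h0 h hx hy; rewrite -[x]mul1r; apply: (h 1 x y). Qed.

Lemma idealN I x : is_ideal I -> I x -> I (- x).
Proof. by move=> hI hx; rewrite -mulN1r; apply: ideal_Ml. Qed.

Lemma idealB I x y : is_ideal I -> I x -> I y -> I (x - y).
Proof. by move=> hI hx hy; apply: idealD => //; apply: idealN. Qed.

Lemma ideal_sum I (T : Type) (r : seq T) (P : pred T) (F : T -> R) :
  is_ideal I -> (forall i, P i -> I (F i)) -> I (\sum_(i <- r | P i) F i).
Proof.
move=> hI hF; apply: (big_ind I) => //; first exact: ideal0.
by move=> x y; apply: idealD.
Qed.

Lemma idealBr I x y : is_ideal I -> I (x - y) -> I x -> I y.
Proof. by move=> hI h hx; rewrite -[y](subKr x); apply: idealB. Qed.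

Lemma idealBl I x y : is_ideal I -> I (x - y) -> I y -> I x.
Proof. by move=> hI h hx; rewrite -[x](subrK y); apply: idealD. Qed.

Lemma idealT : is_ideal (@setT R). Proof. by []. Qed.

Lemma ideal_zero : is_ideal [set (0 : R)].
Proof. by apply: is_idealI => //= [x y -> ->|a x ->]; rewrite ?addr0 ?mulr0. Qed.

(** Quotient rings are mostly avoided by arguing relative to an ideal [I] that stands for zero:
    [adj I a] is then the principal ideal of [a], and [gens] adds generators one at a time, the
    order in which regular sequences are read. *)
Definition adj I a : set R := [set z | exists c, I (z - c * a)].

Lemma adj_ideal I a : is_ideal I -> is_ideal (adj I a).
Proof.
move=> hI; apply: is_idealI.
- by exists 0; rewrite mul0r subr0; apply: ideal0.
- move=> x y [c hc] [d hd]; exists (c + d).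
  by rewrite mulrDl opprD addrACA; apply: idealD.
- move=> b x [c hc]; exists (b * c).
  by rewrite -mulrA -mulrBr; apply: ideal_Ml.
Qed.

Lemma sub_adj I a : I `<=` adj I a.
Proof. by move=> x hx; exists 0; rewrite mul0r subr0. Qed.

Lemma adj_in I a : is_ideal I -> adj I a a.
Proof. by move=> hI; exists 1; rewrite mul1r subrr; apply: ideal0. Qed.

Lemma adj_inM I a c : is_ideal I -> adj I a (c * a).
Proof. by move=> hI; exists c; rewrite subrr; apply: ideal0. Qed.

Lemma adj_sub I J a : is_ideal J -> I `<=` J -> J a -> adj I a `<=` J.
Proof.
move=> hJ hIJ ha x [c /hIJ hc].
by rewrite -[x](subrK (c * a)); apply: idealD => //; apply: ideal_Ml.
Qed.

Lemma adjS I J a : I `<=` J -> adj I a `<=` adj J a.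
Proof. by move=> h x [c /h hc]; exists c. Qed.

Definition gens I s : set R := foldl adj I s.

Lemma gens_ideal I s : is_ideal I -> is_ideal (gens I s).
Proof. by elim: s I => //= a s IH I hI; apply: IH; apply: adj_ideal. Qed.

Lemma sub_gens I s : I `<=` gens I s.
Proof.
by elim: s I => [|a s IH] I //=; apply: subset_trans (IH (adj I a)); exact: sub_adj.
Qed.

Lemma gens_in I s x : is_ideal I -> x \in s -> gens I s x.
Proof.
elim: s I => //= a s IH I hI; rewrite inE => /orP[/eqP->|hx].
  by apply: sub_gens; apply: adj_in.
by apply: IH => //; apply: adj_ideal.
Qed.

Lemma gens_sub I J s : is_ideal J -> I `<=` J -> (forall x, x \in s -> J x) ->
  gens I s `<=` J.
Proof.
move=> hJ; elim: s I => //= a s IH I hIJ hs; apply: IH.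
  by apply: adj_sub => //; apply: hs; rewrite mem_head.
by move=> x hx; apply: hs; rewrite inE hx orbT.
Qed.

Lemma gensS I J s : I `<=` J -> gens I s `<=` gens J s.
Proof. by elim: s I J => //= a s IH I J h; apply: IH; apply: adjS. Qed.

Lemma gens_rcons I s a : gens I (rcons s a) = adj (gens I s) a.
Proof. exact: foldl_rcons. Qed.

Lemma gens_eqmem I s t : is_ideal I -> s =i t -> gens I s = gens I t.
Proof.
move=> hI hst; apply/seteqP; split; apply: gens_sub;
  do ?[exact: gens_ideal|exact: sub_gens] => x; rewrite ?hst => hx;
  by apply: gens_in => //; rewrite ?hst.
Qed.

Lemma gens_adj I s a : is_ideal I -> gens (adj I a) s = adj (gens I s) a.
Proof.
move=> hI; rewrite -[gens (adj _ _) _]/(gens I (a :: s)) -gens_rcons.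
by apply: gens_eqmem => // x; rewrite mem_rcons.
Qed.

Lemma adjC I a b : is_ideal I -> adj (adj I a) b = adj (adj I b) a.
Proof. by move=> hI; apply: (@gens_adj I [:: b] a). Qed.

Lemma gensP I s z : is_ideal I ->
  gens I s z <-> exists c : nat -> R, I (z - \sum_(i < size s) c i * s`_i).
Proof.
move=> hI; split; last first.
  case=> c hc; rewrite -[z](subrK (\sum_(i < size s) c i * s`_i)).
  apply: idealD; [exact: gens_ideal|exact: sub_gens|].
  apply: ideal_sum => [|i _]; first exact: gens_ideal.
  by apply: ideal_Ml; [exact: gens_ideal|apply: gens_in => //; exact: mem_nth].
elim: s I hI z => [|a s IH] I hI z /=.
  by move=> hz; exists (fun _ => 0); rewrite big_ord0 subr0.
move=> /(IH _ (adj_ideal a hI)) [c [d hd]].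
exists (fun i => if i is i'.+1 then c i' else d).
rewrite big_ord_recl /=; move: hd.
by rewrite -addrA -opprD [d * a + _]addrC.
Qed.

Lemma ideal_genE s : ideal_gen [set` s] = gens [set 0] s.
Proof.
apply/seteqP; split.
  apply: smallest_sub; first exact: gens_ideal ideal_zero.
  by move=> x /= hx; apply: gens_in => //; exact: ideal_zero.
apply: gens_sub; first exact: ideal_gen_ideal.
  by move=> x ->; apply: ideal0; apply: ideal_gen_ideal.
by move=> x hx; apply: (@sub_smallest _ _ _ [set` s]) => // .
Qed.

Lemma noetherianP I : noetherian R -> is_ideal I -> exists s, I = gens [set 0] s.
Proof. by move=> hR /hR [s ->]; exists s; rewrite ideal_genE. Qed.

Definition addI I J : set R := [set z | exists2 x, I x & J (z - x)].

Lemma addI_ideal I J : is_ideal I -> is_ideal J -> is_ideal (addI I J).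
Proof.
move=> hI hJ; apply: is_idealI.
- by exists 0; rewrite ?subr0; apply: ideal0.
- move=> x y [x1 h1 h2] [y1 h3 h4]; exists (x1 + y1); first exact: idealD.
  by rewrite opprD addrACA; apply: idealD.
- move=> b x [x1 h1 h2]; exists (b * x1); first exact: ideal_Ml.
  by rewrite -mulrBr; apply: ideal_Ml.
Qed.

Lemma addI_subl I J : is_ideal J -> I `<=` addI I J.
Proof. by move=> hJ x hx; exists x => //; rewrite subrr; apply: ideal0. Qed.

Lemma addI_subr I J : is_ideal I -> J `<=` addI I J.
Proof. by move=> hI x hx; exists 0; rewrite ?subr0 //; apply: ideal0. Qed.

Lemma addI_sub I J K : is_ideal K -> I `<=` K -> J `<=` K -> addI I J `<=` K.
Proof.
by move=> hK h1 h2 x [y /h1 hy /h2 hz]; rewrite -[x](subrK y); apply: idealD.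
Qed.

Lemma addIS I J I' J' : I `<=` I' -> J `<=` J' -> addI I J `<=` addI I' J'.
Proof. by move=> h1 h2 x [y /h1 hy /h2 hz]; exists y. Qed.

Lemma ideal_mul_ideal I J : is_ideal (ideal_mul I J).
Proof. exact: ideal_gen_ideal. Qed.

Lemma ideal_mul_sub I J K : is_ideal K ->
  (forall x y, I x -> J y -> K (x * y)) -> ideal_mul I J `<=` K.
Proof.
move=> hK h; apply: smallest_sub => // z /= [x [y [hx hy ->]]]; exact: h.
Qed.

Lemma ideal_mulS I J I' J' : I `<=` I' -> J `<=` J' ->
  ideal_mul I J `<=` ideal_mul I' J'.
Proof.
move=> h1 h2; apply: ideal_mul_sub; first exact: ideal_mul_ideal.
by move=> x y /h1 hx /h2 hy; apply: ideal_mul_in.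
Qed.

Lemma ideal_mul_subr I J : is_ideal J -> ideal_mul I J `<=` J.
Proof. by move=> hJ; apply: ideal_mul_sub => // x y _; apply: ideal_Ml. Qed.

Lemma ideal_mul_subl I J : is_ideal I -> ideal_mul I J `<=` I.
Proof. by move=> hJ; apply: ideal_mul_sub => // x y hx _; apply: ideal_Mr. Qed.

Lemma ideal_expS I n : ideal_exp I n.+1 = ideal_mul I (ideal_exp I n).
Proof. by []. Qed.

Lemma ideal_exp_ideal I n : is_ideal (ideal_exp I n).
Proof. by case: n => [|n]; [exact: idealT|exact: ideal_mul_ideal]. Qed.

Lemma ideal_expM I n x y : I x -> ideal_exp I n y -> ideal_exp I n.+1 (x * y).
Proof. by move=> hx hy; apply: ideal_mul_in. Qed.

Lemma ideal_exp1 I : is_ideal I -> ideal_exp I 1 = I.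
Proof.
move=> hI; apply/seteqP; split; first exact: ideal_mul_subl.
by move=> x hx; rewrite -[x]mulr1; apply: ideal_mul_in.
Qed.

Lemma ideal_exp_mulD I i j x y :
  ideal_exp I i x -> ideal_exp I j y -> ideal_exp I (i + j) (x * y).
Proof.
move=> hx hy; elim: i x hx => [|i IH] x hx.
  by apply: ideal_Ml => //; exact: ideal_exp_ideal.
suff : ideal_mul I (ideal_exp I i) `<=`
  [set x | ideal_exp I (i.+1 + j) (x * y)] by apply.
have hE := @ideal_exp_ideal I (i.+1 + j).
apply: ideal_mul_sub => [|u v hu hv]; last first.
  by rewrite /= -mulrA; apply: ideal_expM => //; apply: IH.
apply: is_idealI => [|u v hu hv|a u hu]; rewrite /mkset.
- by rewrite mul0r; exact: ideal0 hE.
- by rewrite mulrDl; exact: idealD hE hu hv.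
- by rewrite -mulrA; exact: ideal_Ml hE hu.
Qed.

Lemma ideal_exp_le I i j : (i <= j)%N -> ideal_exp I j `<=` ideal_exp I i.
Proof.
move/subnK <-; elim: (j - i)%N => // k IH.
apply: subset_trans IH; rewrite addSn ideal_expS.
by apply: ideal_mul_subr; apply: ideal_exp_ideal.
Qed.

Lemma ideal_expX I n x : I x -> ideal_exp I n (x ^+ n).
Proof. by move=> hx; elim: n => // n IH; rewrite exprS; apply: ideal_expM. Qed.

(** In a product of [n + k] elements of [I + (a)], each term of the expansion has at least [n]
    factors in [I] or at least [k] factors [a]. *)
Lemma ideal_exp_adj I a n k : is_ideal I ->
  ideal_exp (adj I a) (n + k) `<=` adj (ideal_exp I n) (a ^+ k).
Proof.
move=> hI; move e: (n + k)%N => m; elim: m n k e => [|m IH] n k e.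
  case: n e => // e; apply: subset_trans (sub_adj _) => //.
case: n k e => [|n] [|k] // e.
- by move=> z _; exists 0.
- by move=> z _; exists z; rewrite mulr1 subrr; apply: ideal0; apply: ideal_exp_ideal.
have hA := adj_ideal (a ^+ k.+1) (@ideal_exp_ideal I n.+1).
apply: ideal_mul_sub => // x y [c hc] hy.
rewrite -[x](subrK (c * a)) mulrDl; apply: idealD => //.
  have [|d hd] := IH n k.+1 _ y hy; first by case: e => <-; rewrite addnS.
  exists ((x - c * a) * d); rewrite -mulrA -mulrBr; exact: ideal_expM.
have [|d hd] := IH n.+1 k _ y hy; first by case: e => <-; rewrite addnS.
exists (c * d); rewrite exprS.
have -> : c * a * y - c * d * (a * a ^+ k) = (c * a) * (y - d * a ^+ k) by ring.
exact: (ideal_Ml _ (@ideal_exp_ideal I n.+1)).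
Qed.

Section Prime.
Variable Q : set R.
Hypothesis Qp : prime_ideal Q.

Lemma prime_isideal : is_ideal Q. Proof. by case: Qp. Qed.

Lemma primeMn x y : ~ Q x -> ~ Q y -> ~ Q (x * y).
Proof. by move=> hx hy; case: Qp => _ _ h /h []. Qed.

Lemma prime1n : ~ Q 1. Proof. by case: Qp. Qed.

Lemma primeXn x k : ~ Q x -> ~ Q (x ^+ k).
Proof.
move=> hx; elim: k => [|k IH]; first exact: prime1n.
by rewrite exprS; apply: primeMn.
Qed.

Lemma primeX x k : Q (x ^+ k) -> Q x.
Proof. by move=> h; apply: contrapT => /(@primeXn _ k). Qed.

(** Localization at [Q] is never formed; a multiplier [c] outside [Q] takes its place. Nilpotency
    modulo [J] passes from the generators to the ideal by the counting in [ideal_exp_adj]. *)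
Lemma sat_exp J s : is_ideal J ->
  (forall e, e \in s -> exists k c, ~ Q c /\ J (c * e ^+ k)) ->
  exists N c, ~ Q c /\ forall z, ideal_exp (gens [set 0] s) N z -> J (c * z).
Proof.
move=> hJ; elim/last_ind: s => [|s a IH] hs.
  exists 1%N, 1; split; first exact: prime1n.
  by rewrite ideal_exp1 => [z ->|]; [rewrite mulr0; apply: ideal0|apply: ideal_zero].
case: IH => [e he|N [c [hc hN]]]; first by apply: hs; rewrite mem_rcons inE he orbT.
have [|k [d [hd hk]]] := hs a; first by rewrite mem_rcons mem_head.
exists (N + k)%N, (c * d); split; first exact: primeMn.
move=> z; rewrite gens_rcons => /ideal_exp_adj [|b hb]; first exact: gens_ideal ideal_zero.
have -> : c * d * z = d * (c * (z - b * a ^+ k)) + c * b * (d * a ^+ k) by ring.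
apply: idealD => //; apply: ideal_Ml => //; exact: hN.
Qed.

(** The ideal [D + Q s], with the coefficient of the head exposed so that a generator can be
    eliminated. *)
Fixpoint qspan D s : set R :=
  if s is a :: s' then [set z | exists2 c, Q c & qspan D s' (z - c * a)] else D.

Lemma qspan_ideal D s : is_ideal D -> is_ideal (qspan D s).
Proof.
have hQ := prime_isideal.
move=> hD; elim: s => //= a s IH; apply: is_idealI => /=.
- by exists 0; [exact: ideal0|rewrite mul0r subr0; apply: ideal0].
- move=> x y [c hc h1] [d hd h2]; exists (c + d); first exact: idealD.
  by rewrite mulrDl opprD addrACA; apply: idealD.
- move=> b x [c hc h]; exists (b * c); first exact: ideal_Ml.
  by rewrite -mulrA -mulrBr; apply: ideal_Ml.
Qed.

Lemma sub_qspan D s : D `<=` qspan D s.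
Proof.
elim: s => //= a s IH x /IH hx; exists 0; last by rewrite mul0r subr0.
exact: (ideal0 prime_isideal).
Qed.

Lemma qspan_in D s c x : is_ideal D -> Q c -> x \in s -> qspan D s (c * x).
Proof.
move=> hD hc; elim: s => //= a s IH; rewrite inE => /orP[/eqP->|hx].
  by exists c => //; rewrite subrr; apply: (ideal0 (qspan_ideal s hD)).
exists 0; last by rewrite mul0r subr0; apply: IH.
exact: (ideal0 prime_isideal).
Qed.

Lemma qspan_sat D s c z : is_ideal D -> (forall e, e \in s -> D (c * e)) ->
  qspan D s z -> D (c * z).
Proof.
move=> hD; elim: s z => [|a s IH] /= z hs; first by move=> hz; apply: ideal_Ml.
case=> d hd /IH h; rewrite -[z](subrK (d * a)) mulrDr.
apply: idealD => //; first by apply: h => e he; apply: hs; rewrite inE he orbT.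
by rewrite mulrCA; apply: ideal_Ml => //; apply: hs; rewrite mem_head.
Qed.

(** Gaussian elimination in the localization at [Q]: in the relation of the head, moving the head to
    the left leaves the coefficient [c0 - d0], still outside [Q], so that the head can be
    substituted into the other relations. *)
Lemma nakayama_seq D s : is_ideal D ->
  (forall e, e \in s -> exists c, ~ Q c /\ qspan D s (c * e)) ->
  exists c, ~ Q c /\ forall e, e \in s -> D (c * e).
Proof.
move=> hD; have hQ := prime_isideal.
elim: s => [|a s IH] h; first by exists 1; split=> //; exact: prime1n.
have [|c0 [hc0 /= [d0 hd0 h0]]] := h a; first exact: mem_head.
have hS := qspan_ideal s hD.
have hu : ~ Q (c0 - d0) by move=> hu; apply: hc0; rewrite -[c0](subrK d0); apply: idealD.
rewrite -mulrBl in h0.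
case: IH => [e he|c [hc hs]].
  have [|c1 [hc1 /= [d1 hd1 h1]]] := h e; first by rewrite inE he orbT.
  exists ((c0 - d0) * c1); split; first exact: primeMn.
  have -> : (c0 - d0) * c1 * e =
    (c0 - d0) * (c1 * e - d1 * a) + d1 * ((c0 - d0) * a) by ring.
  by apply: idealD => //; apply: ideal_Ml.
exists (c * (c0 - d0)); split; first exact: primeMn.
move=> e; rewrite inE => /orP[/eqP->|he].
  by rewrite -mulrA; apply: (qspan_sat hD hs).
by rewrite mulrAC; apply: ideal_Mr => //; apply: hs.
Qed.

(* Nakayama's lemma in the localization at [Q]. *)
Lemma nakayama_sat D E : noetherian R -> is_ideal D -> is_ideal E ->
  (forall e, E e -> exists c, ~ Q c /\ addI D (ideal_mul Q E) (c * e)) ->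
  exists c, ~ Q c /\ forall e, E e -> D (c * e).
Proof.
move=> hR hD hE h; have [s sE] := noetherianP hR hE.
have [|c [hc hs]] := @nakayama_seq D s hD.
  move=> e he; have [|c [hc [x hx hy]]] := h e.
    by rewrite sE; apply: gens_in => //; exact: ideal_zero.
  exists c; split=> //; have hS := qspan_ideal s hD.
  rewrite -[_ * _](subrK x); apply: idealD => //; last exact: sub_qspan.
  suff : ideal_mul Q E `<=` qspan D s by apply.
  apply: ideal_mul_sub => // u v hu; rewrite sE => hv.
  suff : gens [set 0] s `<=` [set v | qspan D s (u * v)] by apply.
  apply: gens_sub => [|v' ->|w hw] /=; rewrite ?mulr0; do ?exact: ideal0.
    apply: is_idealI => /=; first by rewrite mulr0; apply: ideal0.
      by move=> x1 y1 h1 h2; rewrite mulrDr; apply: idealD.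
    by move=> b x1 h1; rewrite mulrCA; apply: ideal_Ml.
  exact: qspan_in.
exists c; split=> // e; rewrite sE => he.
suff : gens [set 0] s `<=` [set v | D (c * v)] by apply.
apply: gens_sub => [|v' ->|w hw] /=; rewrite ?mulr0; do ?exact: ideal0; last exact: hs.
apply: is_idealI => /=; first by rewrite mulr0; apply: ideal0.
  by move=> x1 y1 h1 h2; rewrite mulrDr; apply: idealD.
by move=> b x1 h1; rewrite mulrCA; apply: ideal_Ml.
Qed.

End Prime.

End IdealTheory.

(** * Noetherian and local rings *)

Section Noetherian.
Variable R : comNzRingType.
Hypothesis Rn : noetherian R.
Implicit Types (I J K E Q W : set R) (s t us : seq R) (x y z a b c u v : R).

Lemma bigcup_chain_ideal (f : nat -> set R) :
  (forall n, is_ideal (f n)) -> (forall n, f n `<=` f n.+1) ->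
  is_ideal [set x | exists n, f n x].
Proof.
move=> fI fS; have fle i j : (i <= j)%N -> f i `<=` f j.
  by move/subnK <-; elim: (j - i)%N => // k IH x /IH /fS.
apply: is_idealI => [|x y [i hi] [j hj]|a x [i hi]].
- by exists 0%N; apply: ideal0.
- exists (maxn i j); apply: idealD => //.
    by apply: fle hi; apply: leq_maxl.
  by apply: fle hj; apply: leq_maxr.
- by exists i; apply: ideal_Ml.
Qed.

Lemma noeth_max (F : set (set R)) : (forall I, F I -> is_ideal I) ->
  (exists I, F I) -> exists2 W, F W & forall J, F J -> W `<=` J -> J `<=` W.
Proof.
move=> FI [I0 FI0]; apply: contrapT => hF.
have /choice [f hf] : forall W, exists J, F W -> [/\ F J, W `<=` J & ~ J `<=` W].
  move=> W; apply: contrapT => hW; apply: hF; exists W.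
    by apply: contrapT => h; apply: hW; exists W => /h.
  move=> J FJ WJ; apply: contrapT => nJW; apply: hW; exists J => _; split=> //.
pose g n := iter n f I0.
have gF n : F (g n) by elim: n => //= n /hf[].
have gS n : g n `<=` g n.+1 by have [] := hf _ (gF n).
have gI n := FI _ (gF n).
have [s sE] := noetherianP Rn (bigcup_chain_ideal gI gS).
have gle i j : (i <= j)%N -> g i `<=` g j.
  by move/subnK <-; elim: (j - i)%N => // k IH x /IH /gS.
have [n hn] : exists n, forall x, x \in s -> g n x.
  have : forall x, x \in s -> exists n, g n x.
    move=> x hx; have : gens [set 0] s x by apply: gens_in => //; exact: ideal_zero.
    by rewrite -sE.
  elim: (s) => [|a t IH] h; first by exists 0%N.
  have [n hn] : exists n, forall x, x \in t -> g n x.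
    by apply: IH => x hx; apply: h; rewrite inE hx orbT.
  have [k hk] := h a (mem_head _ _).
  exists (maxn n k) => x; rewrite inE => /orP[/eqP->|hx].
    by apply: gle hk; apply: leq_maxr.
  by apply: gle (hn _ hx); apply: leq_maxl.
have [_ _] := hf _ (gF n); apply => x hx.
have : gens [set 0] s `<=` g n by apply: gens_sub => // _ ->; apply: ideal0.
by apply; rewrite -sE; exists n.+1.
Qed.

Lemma noeth_stationary (f : nat -> set R) : (forall n, is_ideal (f n)) ->
  (forall n, f n `<=` f n.+1) -> exists n, forall k, f k `<=` f n.
Proof.
move=> fI fS; have fle i j : (i <= j)%N -> f i `<=` f j.
  by move/subnK <-; elim: (j - i)%N => // k IH x /IH /fS.
have [||W [n ->] hn] := @noeth_max [set I | exists n, I = f n].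
- by move=> _ [n ->].
- by exists (f 0%N), 0%N.
exists n => k; have [kn|nk] := leqP k n; first exact: fle.
by apply: hn; [exists k|apply: fle; apply: ltnW].
Qed.

Lemma prime_disjoint (M : set R) I : is_ideal I -> M 1 ->
  (forall x y, M x -> M y -> M (x * y)) -> (forall x, M x -> ~ I x) ->
  exists Q, [/\ prime_ideal Q, I `<=` Q & forall x, M x -> ~ Q x].
Proof.
move=> hI M1 MM MI.
have [||Q [hQ IQ MQ] hmax] := @noeth_max
  [set Q | [/\ is_ideal Q, I `<=` Q & forall x, M x -> ~ Q x]].
- by move=> J [].
- by exists I; split.
exists Q; split=> //; split=> [//||x y hxy]; first by apply: (MQ 1).
apply: contrapT => h.
have key z : ~ Q z -> exists2 w, M w & adj Q z w.
  move=> hz; apply: contrapT => hw; apply: hz.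
  apply: (hmax (adj Q z)); [split|exact: sub_adj|exact: adj_in].
  - exact: adj_ideal.
  - by apply: subset_trans IQ _; apply: sub_adj.
  - by move=> w hMw hw'; apply: hw; exists w.
have [|w1 hw1 [c1 hc1]] := key x; first by move=> hx; apply: h; left.
have [|w2 hw2 [c2 hc2]] := key y; first by move=> hx; apply: h; right.
apply: (MQ (w1 * w2)); first exact: MM.
have -> : w1 * w2 = (w1 - c1 * x) * w2 + c1 * x * (w2 - c2 * y) + c1 * c2 * (x * y).
  by ring.
apply: idealD => //; last exact: ideal_Ml.
by apply: idealD => //; [apply: ideal_Mr|apply: ideal_Ml].
Qed.

Definition nzd I a := forall x, I (a * x) -> I x.

Definition colon I u : set R := [set x | I (x * u)].

Lemma colon_ideal I u : is_ideal I -> is_ideal (colon I u).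
Proof.
move=> hI; apply: is_idealI => [|x y hx hy|a x hx]; rewrite /colon /mkset.
- by rewrite mul0r; apply: ideal0.
- by rewrite mulrDl; apply: idealD.
- by rewrite -mulrA; apply: ideal_Ml.
Qed.

(* The ideals [colon I u] for such [u] are the maximal associated primes of
   [R / I]. *)
Definition max_ass I u := ~ I u /\
  forall v, ~ I v -> colon I u `<=` colon I v -> colon I v `<=` colon I u.

Lemma max_ass_prime I u : is_ideal I -> max_ass I u -> prime_ideal (colon I u).
Proof.
move=> hI [hu hmax]; split=> [||x y hxy]; first exact: colon_ideal.
  by rewrite /colon /= mul1r.
have [hy|hy] := pselect (I (y * u)); [by right|left].
apply: (hmax (y * u)) => //.
- by move=> z hz; rewrite /colon /= mulrCA; apply: ideal_Ml.
- by rewrite /colon /= mulrA.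
Qed.

Lemma zero_div_max_ass I a x : is_ideal I -> I (a * x) -> ~ I x ->
  exists2 u, max_ass I u & colon I u a.
Proof.
move=> hI hax hx.
have [||W [u [hu ->] ha] hmax] := @noeth_max
  [set W | exists2 u, ~ I u /\ W = colon I u & W a].
- by move=> _ [u [_ ->] _]; apply: colon_ideal.
- by exists (colon I x); exists x.
exists u => //; split=> // v hv huv; apply: hmax => //.
by exists v => //; apply: huv.
Qed.

Lemma prime_colon_avoid Q I us : prime_ideal Q -> is_ideal I ->
  (forall u, u \in us -> ~ colon I u `<=` Q) ->
  exists2 x, ~ Q x & forall u, u \in us -> colon I u x.
Proof.
move=> hQ hI; elim: us => [|u us IH] h; first by exists 1 => //; exact: prime1n hQ.
have [x hx hxus] : exists2 x, ~ Q x & forall u, u \in us -> colon I u x.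
  by apply: IH => v hv; apply: h; rewrite inE hv orbT.
have [y hy hyQ] : exists2 y, colon I u y & ~ Q y.
  apply: contrapT => hn; apply: (h u); first exact: mem_head.
  by move=> y hy; apply: contrapT => hyQ; apply: hn; exists y.
exists (x * y); first exact: (primeMn hQ).
move=> v; rewrite inE => /orP[/eqP->|hv].
  by apply: ideal_Ml => //; apply: colon_ideal.
by apply: ideal_Mr; [apply: colon_ideal|apply: hxus].
Qed.

(** Choose a finite list [us] with [(I, us)] as large as possible; it then contains every [u]
    satisfying [max_ass]. If the prime of [u] contained none of the primes of [us], some element
    outside it would kill [us] modulo [I], hence kill [u]. *)
Lemma max_ass_finite I : is_ideal I -> exists2 us : seq R,
  (forall u, u \in us -> max_ass I u) &
  forall u, max_ass I u -> exists2 v, v \in us & colon I u = colon I v.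
Proof.
move=> hI.
have [||W [us hus ->] hmax] := @noeth_max
  [set W | exists2 us, (forall u, u \in us -> max_ass I u) & W = gens I us].
- by move=> _ [us _ ->]; apply: gens_ideal.
- by exists I; exists [::].
exists us => // u hu; apply: contrapT => hn.
have hQ := max_ass_prime hI hu.
have [v hv|x hx hxus] := @prime_colon_avoid _ I us hQ hI.
  move=> hvu; apply: hn; exists v => //; apply/seteqP; split => //.
  by apply: (hus _ hv).2 => //; apply: hu.1.
have hug : gens I us u.
  apply: (hmax (gens I (u :: us))).
  - exists (u :: us) => // v; rewrite inE => /orP[/eqP->//|]; exact: hus.
  - by apply: gensS; apply: sub_adj.
  - by apply: gens_in => //; rewrite mem_head.
apply: hx; rewrite /colon /=.
suff : gens I us `<=` [set u | I (x * u)] by apply.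
apply: gens_sub => [|w hw|w hw]; rewrite /mkset; last exact: hxus.
- apply: is_idealI => [|y z hy hz|a y hy]; rewrite /mkset.
  + by rewrite mulr0; apply: ideal0.
  + by rewrite mulrDr; apply: idealD.
  + by rewrite mulrCA; apply: ideal_Ml.
- exact: ideal_Ml.
Qed.

(** Prime avoidance in the coset [a + J]. When [a + b] lies in the prime of [u], this prime does not
    contain [J], since otherwise it would contain [w]; so [b] is corrected by an element of [J]
    times an element that lies in the primes already handled but not in this one. *)
Lemma coset_avoidance I J a w : is_ideal I -> is_ideal J -> adj J a w ->
  nzd I w -> exists2 b, J b & nzd I (a + b).
Proof.
move=> hI hJ haw hw; have [us hus husf] := max_ass_finite hI.
suff [b hb hbus] : exists2 b, J b & forall u, u \in us -> ~ colon I u (a + b).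
  exists b => // x hx; apply: contrapT => nx.
  have [u hu ha] := zero_div_max_ass hI hx nx.
  by have [v hv huv] := husf _ hu; apply: (hbus _ hv); rewrite -huv.
elim: us hus {husf} => [|u us IH] hus; first by exists 0 => //; apply: ideal0.
have [|b hb hbus] := IH; first by move=> v hv; apply: hus; rewrite inE hv orbT.
have hu := hus u (mem_head _ _); have hQ := max_ass_prime hI hu.
have hQI := prime_isideal hQ.
have [hab|hab] := pselect (colon I u (a + b)); last first.
  by exists b => // v; rewrite inE => /orP[/eqP->//|]; apply: hbus.
have [b' hb' nb'] : exists2 b', J b' & ~ colon I u b'.
  apply: contrapT => hn; apply: hu.1; apply: hw; suff : colon I u w by [].
  have JQ : J `<=` colon I u.
    by move=> y hy; apply: contrapT => hny; apply: hn; exists y.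
  case: haw => c hc.
  have -> : w = (w - c * a) - c * b + c * (a + b) by ring.
  apply: idealD => //; last exact: ideal_Ml.
  by apply: JQ; apply: idealB => //; apply: ideal_Ml.
have [v hv|x hx hxus] := @prime_colon_avoid _ I us hQ hI.
  move=> hvu; apply: (hbus v hv).
  have hvm : max_ass I v by apply: hus; rewrite inE hv orbT.
  by apply: (hvm.2 u) => //; apply: hu.1.
exists (b + b' * x); first by apply: idealD => //; apply: ideal_Mr.
move=> v; rewrite addrA inE => /orP[/eqP->|hv] h.
  have : colon I u (b' * x) by rewrite -[_ * _](addKr (a + b)) addrC; apply: idealB.
  exact: primeMn.
apply: (hbus v hv); rewrite -[a + b](addrK (b' * x)).
have hvI := colon_ideal v hI.
by apply: idealB => //; apply: ideal_Ml => //; apply: hxus.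
Qed.

End Noetherian.

Section Local.
Variable R : comNzRingType.
Hypothesis Rn : noetherian R.
Implicit Types (I J K E Q W : set R) (s t us : seq R) (x y z a b c u v : R).

Definition local_at (m : set R) :=
  [/\ is_ideal m, ~ m 1 & forall x, ~ m x -> exists y, x * y = 1].

Lemma maximal_sup I : is_ideal I -> ~ I 1 ->
  exists2 m, maximal_ideal m & I `<=` m.
Proof.
move=> hI hI1.
have [||W [hW W1 hIW] hmax] := noeth_max Rn
  (F := [set W | [/\ is_ideal W, ~ W 1 & I `<=` W]]).
- by move=> J [].
- by exists I; split.
exists W => //; split=> // J hJ J1 WJ; apply/seteqP; split=> //.
by apply: (hmax _ _ WJ); split=> //; apply: subset_trans WJ.
Qed.

Lemma max_idealP : local_ring R -> maximal_ideal (max_ideal R).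
Proof. by case=> m [hm _]; apply: getPex; exists m. Qed.

Lemma max_ideal_local : local_ring R -> local_at (max_ideal R).
Proof.
move=> hl; have [hm m1 _] := max_idealP hl; split=> // x hx.
apply: contrapT => hn; apply: hx.
have hI := adj_ideal x (@ideal_zero R).
have [|m hm' hxm] := maximal_sup hI.
  by case=> c /eqP; rewrite subr_eq0 => /eqP h; apply: hn; exists c; rewrite mulrC.
suff -> : max_ideal R = m by apply: hxm; apply: adj_in; exact: ideal_zero.
case: (hl) => m0 [_ hu]; rewrite -(hu _ hm').
by rewrite -(hu (max_ideal R)) //; apply: max_idealP.
Qed.

Lemma local_at_maximal (m : set R) : local_at m -> maximal_ideal m.
Proof.
case=> hm m1 mu; split=> // J hJ J1 mJ; apply/seteqP; split=> // x hx.
apply: contrapT => /mu [y hy]; apply: J1; rewrite -hy; exact: ideal_Mr.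
Qed.

Lemma local_at_local (m : set R) : local_at m -> local_ring R.
Proof.
move=> hm; exists m; split; first exact: local_at_maximal.
move=> m' [hm' m'1 hmax]; apply: esym; apply/seteqP; split.
  case: hm => hm m1 mu x hx; apply: contrapT => /mu [y hy].
  by apply: m'1; rewrite -hy; apply: ideal_Mr.
case: (hm) => hmi m1 mu.
rewrite -(hmax m) // => x hx; apply: contrapT => /mu [y hy].
by apply: m'1; rewrite -hy; apply: ideal_Mr.
Qed.

Lemma local_at_max (m : set R) : local_at m -> max_ideal R = m.
Proof.
move=> hm; have hl := local_at_local hm.
case: (hl) => m0 [_ hu]; rewrite -(hu m); last exact: local_at_maximal.
by rewrite -(hu (max_ideal R)) //; apply: max_idealP.
Qed.

Variable m : set R.
Hypothesis hm : local_at m.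

Lemma local_ideal : is_ideal m. Proof. by case: hm. Qed.

Lemma local_prime : prime_ideal m.
Proof.
case: hm => hI m1 mu; split=> // x y hxy.
have [?|/mu [z hz]] := pselect (m x); [by left|right].
by rewrite -[y]mul1r -hz mulrAC; apply: ideal_Mr.
Qed.

Lemma local_unit c : ~ m c -> exists d, c * d = 1.
Proof. by case: hm => _ _; apply. Qed.

Lemma local_unitI J c x : is_ideal J -> ~ m c -> J (c * x) -> J x.
Proof.
move=> hJ /local_unit [d hd] h.
by rewrite -[x]mul1r -hd mulrAC; apply: ideal_Mr.
Qed.

Lemma local_sub J : is_ideal J -> ~ J 1 -> J `<=` m.
Proof.
move=> hJ J1 x hx; apply: contrapT => /local_unit [d hd].
by apply: J1; rewrite -hd; apply: ideal_Mr.
Qed.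

Lemma local_1B x : m x -> ~ m (1 - x).
Proof.
move=> hx h; case: hm => hI + _; apply.
by rewrite -[1](subrK x); apply: idealD.
Qed.

Lemma nakayama_local I E : is_ideal I -> is_ideal E ->
  E `<=` addI I (ideal_mul m E) -> E `<=` I.
Proof.
move=> hI hE h x hx.
have [e he|c [hc hcE]] := nakayama_sat local_prime Rn hI hE.
  by exists 1; split; [exact: prime1n local_prime|rewrite mul1r; apply: h].
by apply: (local_unitI hI hc); apply: hcE.
Qed.

(** In place of the Artin-Rees lemma: with [E] the intersection and [E0 = I + m E], an ideal [W]
    maximal among those that contain [E0] and meet [E] inside [E0] contains a power of [m], hence
    [E]. So [E] lies in [E0], and Nakayama's lemma applies. *)
Lemma krull_intersection I x : is_ideal I ->
  (forall n, addI I (ideal_exp m n) x) -> I x.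
Proof.
move=> hI; pose E := [set x | forall n, addI I (ideal_exp m n) x].
have hadd n : is_ideal (addI I (ideal_exp m n)).
  by apply: addI_ideal => //; apply: ideal_exp_ideal.
have hE : is_ideal E.
  apply: is_idealI => [n|y z hy hz n|a y hy n].
  - exact: ideal0.
  - by apply: idealD.
  - exact: ideal_Ml.
suff : E `<=` I by apply.
apply: nakayama_local => //.
set E0 := addI _ _; have hE0 : is_ideal E0.
  by apply: addI_ideal => //; apply: ideal_mul_ideal.
have [||W [hW hE0W hWE] hmax] := noeth_max Rn
  (F := [set W | [/\ is_ideal W, E0 `<=` W & W `&` E `<=` E0]]).
- by move=> J [].
- by exists E0; split=> // y [].
(* The ideals [W : a^k] stabilize at some [n]; then [W + (a^n)] still meets [E] inside [E0], and
   maximality puts [a^n] in [W]. *)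
have hpow a : m a -> exists k, W (a ^+ k).
  move=> ha.
  have [||n hn] := noeth_stationary Rn (f := fun k => colon W (a ^+ k)).
  - by move=> n; apply: colon_ideal.
  - by move=> n y hy; rewrite /colon /= exprS mulrCA; apply: ideal_Ml.
  exists n; apply: (hmax (adj W (a ^+ n))); [split|exact: sub_adj|exact: adj_in].
  - exact: adj_ideal.
  - by apply: subset_trans hE0W _; apply: sub_adj.
  move=> e [[c hc] hEe]; apply: hWE; split=> //.
  have hae : W (a * e).
    apply: hE0W; apply: addI_subr => //; exact: ideal_mul_in.
  have hc1 : colon W (a ^+ n.+1) c.
    rewrite /colon /= exprS.
    have -> : c * (a * a ^+ n) = a * e - a * (e - c * a ^+ n) by ring.
    by apply: idealB => //; apply: ideal_Ml.
  have := hn _ _ hc1; rewrite /colon /= => h.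
  by rewrite -[e](subrK (c * a ^+ n)); apply: idealD.
have [s sE] := noetherianP Rn local_ideal.
have [e he|N [c [hc hN]]] := sat_exp local_prime (s := s) hW.
  have [|k hk] := hpow e.
    by rewrite sE; apply: gens_in => //; exact: ideal_zero.
  by exists k, 1; split; [exact: prime1n local_prime|rewrite mul1r].
move=> y hy; apply: hWE; split=> //.
have [i hi hz] := hy N; rewrite -[y](subrK i); apply: idealD => //.
  by apply: (local_unitI hW hc); apply: hN; rewrite -sE.
by apply: hE0W; apply: addI_subl => //; apply: ideal_mul_ideal.
Qed.

End Local.

(** * Krull's height theorem *)

Section KrullHeight.
Variable R : comNzRingType.
Hypothesis Rn : noetherian R.
Implicit Types (I J K E Q W D P : set R) (s t us : seq R) (x y z a b c u v : R).

Definition saturated Q I := forall c z, ~ Q c -> I (c * z) -> I z.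

Definition sat Q I : set R := [set z | exists2 c, ~ Q c & I (c * z)].

Lemma sat_ideal Q I : prime_ideal Q -> is_ideal I -> is_ideal (sat Q I).
Proof.
move=> hQ hI; apply: is_idealI.
- by exists 1; [exact: prime1n hQ|rewrite mulr0; apply: ideal0].
- move=> x y [c hc hx] [d hd hy]; exists (c * d); first exact: (primeMn hQ).
  have -> : c * d * (x + y) = d * (c * x) + c * (d * y) by ring.
  by apply: idealD => //; apply: ideal_Ml.
- by move=> a x [c hc hx]; exists c => //; rewrite mulrCA; apply: ideal_Ml.
Qed.

Lemma sat_saturated Q I : prime_ideal Q -> saturated Q (sat Q I).
Proof.
move=> hQ c z hc [d hd h]; exists (d * c); first exact: (primeMn hQ).
by rewrite -mulrA.
Qed.

Lemma sub_sat Q I : prime_ideal Q -> I `<=` sat Q I.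
Proof. by move=> hQ x hx; exists 1; rewrite ?mul1r //; apply: prime1n hQ. Qed.

Lemma satS Q I J : I `<=` J -> sat Q I `<=` sat Q J.
Proof. by move=> h x [c hc /h hx]; exists c. Qed.

Lemma descending_le (W : nat -> set R) i j : (forall n, W n.+1 `<=` W n) ->
  (i <= j)%N -> W j `<=` W i.
Proof. by move=> h /subnK <-; elim: (j - i)%N => // k IH x /h /IH. Qed.

Section Descending.
Variables (Q : set R) (W : nat -> set R).
Hypotheses (WI : forall n, is_ideal (W n)).
Hypotheses (Wsat : forall n, saturated Q (W n)) (WS : forall n, W n.+1 `<=` W n).

(** After localization at [Q], the ideal of [s] modulo any [W n] is a vector space of dimension at
    most [size s] over the residue field. For a new generator [b], either [b] depends on [s] modulo
    every [W i], and elements can be cleared of [b]; or, for some [i], the coefficient of [b] in any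
    element of [W i] lies in [Q]. *)
Lemma dcc_gens s : (forall n e q, e \in s -> Q q -> W n (q * e)) ->
  exists n, forall k z, gens [set 0] s z -> W n z -> W k z.
Proof.
elim/last_ind: s => [|s b IH] h.
  by exists 0%N => k z -> _; apply: ideal0.
have [|n1 hn1] := IH.
  by move=> n e q he; apply: h; rewrite mem_rcons inE he orbT.
have hG := gens_ideal s (@ideal_zero R).
have hb n q : Q q -> W n (q * b) by apply: h; rewrite mem_rcons mem_head.
have [hyp|hyp] := pselect (forall i, exists c g,
  [/\ ~ Q c, gens [set 0] s g & W i (c * b + g)]).
  exists n1 => k z; rewrite gens_rcons => -[c hc] hz.
  have [kn|nk] := leqP k n1; first exact: descending_le hz.
  have [c' [g [hc' hg hw]]] := hyp k.
  apply: (Wsat hc'); have -> : c' * z = c * (c' * b + g)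
    + (c' * (z - c * b) - c * g) by ring.
  apply: idealD => //; first exact: ideal_Ml.
  apply: hn1; first by apply: idealB => //; apply: ideal_Ml.
  have -> : c' * (z - c * b) - c * g = c' * z - c * (c' * b + g) by ring.
  apply: idealB => //; first exact: ideal_Ml.
  by apply: ideal_Ml => //; apply: descending_le hw => //; apply: ltnW.
have [i hi] : exists i, forall c g, gens [set 0] s g -> W i (c * b + g) -> Q c.
  apply: contrapT => hn; apply: hyp => i; apply: contrapT => hni; apply: hn.
  exists i => c g hg hw; apply: contrapT => hc; apply: hni; by exists c, g.
exists (maxn i n1) => k z; rewrite gens_rcons => -[c hc] hz.
have hQc : Q c.
  apply: (hi c (z - c * b)) => //; rewrite addrC subrK.
  by apply: descending_le hz => //; apply: leq_maxl.
rewrite -[z](subrK (c * b)); apply: idealD => //; last exact: hb.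
apply: hn1 => //; apply: idealB => //; last exact: hb.
by apply: descending_le hz => //; apply: leq_maxr.
Qed.

End Descending.

(* The localization at [Q] of the quotient by [Q ^ N] is artinian. *)
Lemma dcc_saturated Q (W : nat -> set R) N : prime_ideal Q ->
  (forall n, is_ideal (W n)) -> (forall n, saturated Q (W n)) ->
  (forall n, W n.+1 `<=` W n) -> (forall n, ideal_exp Q N `<=` W n) ->
  exists n, forall k, W n `<=` W k.
Proof.
move=> Qp; elim: N W => [|N IH] W WI Wsat WS hN.
  by exists 0%N => k x _; apply: hN.
have hE := @ideal_exp_ideal _ Q N.
pose E n := sat Q (addI (W n) (ideal_exp Q N)).
have [||||n1 hn1] := IH E.
- by move=> n; apply: sat_ideal => //; apply: addI_ideal.
- by move=> n; apply: sat_saturated.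
- by move=> n; apply: satS; apply: addIS.
- move=> n; apply: subset_trans (sub_sat Qp); exact: addI_subr.
have [s sE] := noetherianP Rn hE.
have [|n2 hn2] := dcc_gens WI Wsat WS (s := s).
  move=> n e q he hq; apply: hN; apply: ideal_expM => //.
  by rewrite sE; apply: gens_in => //; exact: ideal_zero.
exists (maxn n1 n2) => k z hz.
have [kn|nk] := leqP k (maxn n1 n2); first exact: descending_le hz.
have [c hc [w hw hq]] : E k z.
  apply: (hn1 k); apply: sub_sat => //; apply: addI_subl => //.
  by apply: descending_le hz => //; apply: leq_maxl.
apply: (Wsat k c) => //; rewrite -[_ * _](subrK w); apply: idealD => //.
apply: hn2; first by rewrite -sE.
have hkn : W k `<=` W n2.
  by apply: descending_le => //; apply: leq_trans (ltnW nk); apply: leq_maxr.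
apply: idealB => //; last exact: hkn.
by apply: ideal_Ml => //; apply: descending_le hz => //; apply: leq_maxr.
Qed.

(** Otherwise the products of powers of [b] with elements outside [Q] form a multiplicative set
    disjoint from [J]; a prime over [J] avoiding this set lies in [Q] and misses [b]. *)
Lemma minimal_sat_power Q J b : is_ideal J -> prime_ideal Q ->
  (forall P, prime_ideal P -> J `<=` P -> P `<=` Q -> P b) ->
  exists k c, ~ Q c /\ J (c * b ^+ k).
Proof.
move=> hJ hQ h; apply: contrapT => hn.
have [|||P [hP JP MP]] := prime_disjoint Rn
  (M := [set x | exists c k, ~ Q c /\ x = c * b ^+ k]) hJ.
- by exists 1, 0%N; rewrite mulr1; split=> //; exact: prime1n hQ.
- move=> _ _ [c [k [hc ->]]] [d [l [hd ->]]]; exists (c * d), (k + l)%N.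
  by split; [exact: (primeMn hQ)|rewrite exprD; ring].
- by move=> _ [c [k [hc ->]]] hJc; apply: hn; exists k, c.
apply: (MP b); first by exists 1, 1%N; rewrite mul1r; split=> //; exact: prime1n hQ.
apply: h => // x hx; apply: contrapT => nx; apply: (MP x) => //.
by exists x, 0%N; rewrite mulr1.
Qed.

(** Krull's principal ideal theorem modulo [Q0]. The symbolic powers [D n] of [Q1] become stationary
    modulo [y], where the localization at [Q] is artinian. As [y] is outside [Q1], the multiple of
    [y] involved has its coefficient in [D n], so Nakayama's lemma at [Q] gives [D n = D n.+1]
    locally; Nakayama's lemma at [Q1] then puts [Q1 ^ n] into [Q0] locally. *)
Theorem krull_principal Q0 Q1 Q y : prime_ideal Q0 -> prime_ideal Q1 ->
  prime_ideal Q -> Q0 `<=` Q1 -> Q1 `<=` Q -> Q y -> ~ Q1 y ->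
  (forall P, prime_ideal P -> Q0 `<=` P -> P y -> P `<=` Q -> Q `<=` P) ->
  Q1 `<=` Q0.
Proof.
move=> p0 p1 p h01 h1 hy ny hmin.
have i0 := prime_isideal p0; have i1 := prime_isideal p1; have i := prime_isideal p.
have hJ := adj_ideal y i0.
have [s sE] := noetherianP Rn i.
have [b hb|N [c [hc hN]]] := sat_exp p (s := s) hJ.
  apply: minimal_sat_power => // P hP hJP hPQ; apply: (hmin P) => //.
  - by apply: subset_trans hJP; apply: sub_adj.
  - by apply: hJP; apply: adj_in.
  - by rewrite sE; apply: gens_in => //; exact: ideal_zero.
rewrite -sE in hN.
pose D n := sat Q1 (addI Q0 (ideal_exp Q1 n)).
have hD n : is_ideal (D n).
  by apply: sat_ideal => //; apply: addI_ideal => //; apply: ideal_exp_ideal.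
have Q0D n : Q0 `<=` D n.
  apply: subset_trans (sub_sat p1); apply: addI_subl; exact: ideal_exp_ideal.
have DS n : D n.+1 `<=` D n.
  by apply: satS; apply: addIS => //; apply: ideal_exp_le.
have hA n := adj_ideal y (hD n).
have [||||n hn] := dcc_saturated (W := fun n => sat Q (adj (D n) y)) (N := N) p.
- by move=> n; apply: sat_ideal.
- by move=> n; apply: sat_saturated.
- by move=> n; apply: satS; apply: adjS.
- move=> n z /hN hz; exists c => //; exact: adjS (Q0D n) _ hz.
have [a ha|c1 [hc1 h2]] := nakayama_sat p Rn (hD n.+1) (hD n).
  have [|d hd [r hr]] := hn n.+1 a.
    by apply: sub_sat => //; apply: sub_adj.
  exists d; split=> //; exists (d * a - r * y) => //.
  rewrite opprB addrC subrK mulrC; apply: ideal_mul_in => //.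
  apply: (sat_saturated p1 ny); rewrite mulrC -/(D n _).
  have -> : r * y = d * a - (d * a - r * y) by ring.
  by apply: idealB => //; [apply: ideal_Ml|apply: DS].
have [z hz|c2 [hc2 h3]] := nakayama_sat p1 Rn i0 (@ideal_exp_ideal _ Q1 n).
  have [d hd h] : D n.+1 z; last by exists d.
  apply: (sat_saturated p1 (c := c1)); first by move/h1.
  apply: h2; apply: sub_sat => //; apply: addI_subr => //.
move=> z hz; have : Q0 (c2 * z ^+ n) by apply: h3; apply: ideal_expX.
by case: (p0) => _ _ h /h [/h01 /hc2 []|]; apply: primeX.
Qed.

Lemma strict_chain_le (F : set (set R)) k (c : nat -> set R) i j : strict_chain F k c ->
  (i <= j)%N -> (j <= k)%N -> c i `<=` c j.
Proof.
move=> [_ hc] /subnK <-; elim: (j - i)%N => [|n IH] hk x hx //.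
by have [+ _] := hc (n + i)%N hk; apply; apply: IH => //; apply: ltnW.
Qed.

(** By the principal ideal theorem the last prime is not minimal over [y] and the prime two places
    below, so some prime containing [y] fits strictly between them; in this way [y] is pushed down
    the chain. *)
Lemma chain_move k (c : nat -> set R) y : strict_chain (@prime_ideal R) k.+1 c -> c k.+1 y ->
  exists c' : nat -> set R, [/\ strict_chain (@prime_ideal R) k.+1 c', c' 0%N = c 0%N,
    c' k.+1 = c k.+1 & c' 1%N y].
Proof.
elim: k c => [|k IH] c hc hy; first by exists c.
have [hp hs] := hc.
have [P [hP h1 h2 hPy]] : exists P, [/\ prime_ideal P, c k `<` P,
    P `<` c k.+2 & P y].
  have [hy1|ny1] := pselect (c k.+1 y).
    by exists (c k.+1); split=> //; [apply: hp|apply: hs|apply: hs].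
  apply: contrapT => hn.
  have [h1 h1'] := hs k (ltnW (ltnSn _)); apply: h1'.
  apply: (@krull_principal (c k) (c k.+1) (c k.+2) y) => //;
    do ?[apply: hp => //]; do ?[by have [] := hs _ (ltnSn _)].
  - by apply: ltnW.
  - move=> P hP h0 hPy hPQ; apply: contrapT => hQP; apply: hn.
    exists P; split=> //; split=> // hPc; apply: ny1; apply: h1; exact: hPc.
have [||c' [[hp' hs'] e0 e1 hy']] := IH (fun i => if (i <= k)%N then c i else P).
- split=> i hi.
    by case: leqP => // _; apply: hp; apply: leq_trans hi _.
  move: hi; rewrite ltnS leq_eqVlt => /orP[/eqP->|hi]; first by rewrite eqxx ltnn.
  by rewrite hi orbT; apply: hs; apply: leqW; apply: ltnW.
- by rewrite ltnn.
rewrite /= ltnn in e1; exists (fun i => if (i <= k.+1)%N then c' i else c i).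
split=> //=; last by rewrite ltnn.
split=> i hi.
  by case: leqP => h; [apply: hp'|apply: hp].
move: hi; rewrite ltnS leq_eqVlt => /orP[/eqP->|hi].
  by rewrite eqxx ltnn e1.
by rewrite hi orbT; apply: hs'.
Qed.

(** Once [y] lies in the second prime of the chain, dropping the bottom prime and absorbing [y] into
    [I] costs one prime and one generator. *)
Theorem krull_height k (c : nat -> set R) I s : is_ideal I -> strict_chain (@prime_ideal R) k c ->
  I `<=` c 0%N -> gens I s `<=` c k ->
  (forall P, prime_ideal P -> gens I s `<=` P -> P `<=` c k -> c k `<=` P) ->
  (k <= size s)%N.
Proof.
elim: s k c I => [|y s IH] [|k] c I hI hc hI0 hIk hmin //=.
  have h0k : c 0%N `<=` c k.+1 by apply: strict_chain_le hc _ _.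
  have h := hmin _ (hc.1 0%N isT) hI0 h0k.
  have [_ /(_ k (leqnn _)) [_]] := hc; case.
  by apply: subset_trans h _; apply: strict_chain_le hc _ _.
have yI : gens I (y :: s) y by apply: gens_in; rewrite ?mem_head.
have [c' [[hp hs] e0 e1 hy]] := chain_move hc (hIk _ yI).
apply: (IH k (fun i => c' i.+1) (adj I y)); rewrite ?e1 //.
- exact: adj_ideal.
- by split=> i hi; [apply: hp|apply: hs].
- apply: adj_sub => //; first exact: prime_isideal (hp _ _).
  apply: subset_trans hI0 _; rewrite -e0; exact: (hs 0%N _).1.
Qed.

(** A prime [Q] over [I + (z)] other than [m] is not minimal over [I], because [z] is a
    nonzerodivisor. A prime [Q0] below it gives a chain of length two ending in [m], which is
    minimal over [I + (x)]: this contradicts the height theorem for one generator. *)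
Lemma primary_exchange (m : set R) I x z N : local_at m -> is_ideal I ->
  ideal_exp m N `<=` adj I x -> m x -> m z -> I `<=` m -> nzd I z ->
  exists N', ideal_exp m N' `<=` adj I z.
Proof.
move=> hm hI hN hx hz Im hnz.
have mp := local_prime hm; have mI := local_ideal hm.
have hJ := adj_ideal z hI.
have [s sE] := noetherianP Rn mI.
have [b hb|N' [c [hc hN']]] := sat_exp mp (s := s) hJ; last first.
  exists N' => y hy; apply: (local_unitI hm hJ hc); apply: hN'; by rewrite -sE.
have {}hb : m b by rewrite sE; apply: gens_in => //; exact: ideal_zero.
apply: minimal_sat_power => // Q hQ hJQ hQm; apply: contrapT => nb.
have [Q0 [hQ0 IQ0 hd]] : exists Q0, [/\ prime_ideal Q0, I `<=` Q0 &
    forall x, (exists c k, ~ Q c /\ x = c * z ^+ k) -> ~ Q0 x].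
  apply: (prime_disjoint Rn) => //=.
  - by exists 1, 0%N; rewrite mulr1; split=> //; exact: prime1n hQ.
  - move=> _ _ [c [k [hc ->]]] [d [l [hd ->]]]; exists (c * d), (k + l)%N.
    by split; [exact: (primeMn hQ)|rewrite exprD; ring].
  - move=> _ [c [k [hc ->]]] h; apply: hc; apply: hJQ; apply: sub_adj.
    elim: k h => [|k IH]; first by rewrite mulr1.
    by rewrite exprS mulrCA => /hnz.
have h0 : Q0 `<=` Q.
  move=> u hu; apply: contrapT => nu; apply: (hd u) => //.
  by exists u, 0%N; rewrite mulr1.
have nz0 : ~ Q0 z.
  by apply: hd; exists 1, 1%N; rewrite mul1r; split=> //; exact: prime1n hQ.
suff : (2 <= size [:: x])%N by [].
apply: (@krull_height 2 (fun i => if i is i'.+1 then if i' is 0%N then Q else m else Q0) I) => //.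
- split=> [[|[|[|]]]|[|[|]]] //= _; split=> // h.
    by apply: nz0; apply: h; apply: hJQ; apply: adj_in.
  by apply: nb; apply: h.
- by apply: adj_sub.
- move=> P hP hIP _ u hu; apply: (primeX hP (k := N)); apply: hIP; apply: hN.
  exact: ideal_expX.
Qed.

End KrullHeight.

(** * Regular sequences *)

Section RegularSequence.
Variable R : comNzRingType.
Hypothesis Rn : noetherian R.
Variable m : set R.
Hypothesis hm : local_at m.
Implicit Types (I J K E Q W D P : set R) (s t us xs gs fs : seq R)
  (x y z a b c u v : R).

(** Weak regularity modulo [I]: that the last quotient is nonzero is not demanded, and is added for
    sequences in [m] by [regular_sequenceP]. *)
Fixpoint reg I s : Prop :=
  if s is a :: s' then nzd I a /\ reg (adj I a) s' else True.

Lemma reg_cat I s t : reg I (s ++ t) <-> reg I s /\ reg (gens I s) t.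
Proof.
elim: s I => [|a s IH] I /=; first by split=> [|[]].
by split=> [[h /IH[]]|[[h hs] ht]] //; split=> //; apply/IH.
Qed.

Lemma reg_rcons I s a : reg I (rcons s a) <-> reg I s /\ nzd (gens I s) a.
Proof.
by rewrite -cats1; split=> [/reg_cat[? []]|[? ?]] //; apply/reg_cat; split.
Qed.

Let mI := local_ideal hm.

(** The annihilator of [b] modulo [I] lies in [I] plus [a] times itself, so Nakayama's lemma puts it
    in [I]. This is where permuting a regular sequence uses a noetherian local ring. *)
Lemma nzd_swap I a b : is_ideal I -> m a -> nzd I a -> nzd (adj I a) b -> nzd I b.
Proof.
move=> hI ha hna hnb; have hE := colon_ideal b hI.
suff h : colon I b `<=` I by move=> x; rewrite mulrC; apply: h.
apply: (nakayama_local Rn hm) => // x hx.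
have [|c hc] := hnb x; first by rewrite mulrC; apply: sub_adj.
exists (x - c * a) => //; rewrite opprB addrC subrK mulrC; apply: ideal_mul_in => //.
rewrite /colon /=; apply: hna.
have -> : a * (c * b) = x * b - (x - c * a) * b by ring.
by apply: idealB => //; apply: ideal_Mr.
Qed.

Lemma reg_swap I a b s : is_ideal I -> m a -> reg I (a :: b :: s) ->
  reg I (b :: a :: s).
Proof.
move=> hI ha [hna [hnb hs]]; split; first exact: nzd_swap hnb.
split; last by rewrite adjC.
move=> x [c hc].
have [|d hd] := hnb c.
  exists x; have -> : b * c - x * a = - (a * x - c * b) by ring.
  exact: idealN.
exists d; apply: hna.
have -> : a * (x - d * b) = (a * x - c * b) + (c - d * a) * b by ring.
by apply: idealD => //; apply: ideal_Mr.
Qed.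

Lemma reg_consr I s a : is_ideal I -> [set` s] `<=` m -> m a ->
  reg I (rcons s a) -> reg I (a :: s).
Proof.
move=> hI hs ha; elim: s I hI hs => [|b s IH] I hI hs // [hb h].
have hms : [set` s] `<=` m by move=> x hx; apply: hs; rewrite /= inE (hx : x \in s) orbT.
have hmb : m b by apply: hs; rewrite /= mem_head.
have := IH _ (adj_ideal b hI) hms h.
by move=> h'; apply: reg_swap.
Qed.

Lemma reg_rconsr I s a : is_ideal I -> [set` s] `<=` m -> m a ->
  reg I (a :: s) -> reg I (rcons s a).
Proof.
move=> hI hs ha; elim: s I hI hs => [|b s IH] I hI hs // h.
have hms : [set` s] `<=` m by move=> x hx; apply: hs; rewrite /= inE (hx : x \in s) orbT.
have [hb h'] := reg_swap hI ha h.
by split=> //; apply: IH => //; apply: adj_ideal.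
Qed.

Lemma nzdX I a k : nzd I a -> nzd I (a ^+ k).
Proof.
move=> h; elim: k => [|k IH] x; first by rewrite mul1r.
by rewrite exprS -mulrA => /h /IH.
Qed.

Lemma nzd_congr I a b : is_ideal I -> I (a - b) -> nzd I a -> nzd I b.
Proof.
move=> hI hab ha x hx; apply: ha; rewrite -[a](subrK b) mulrDl.
by apply: idealD => //; apply: ideal_Mr.
Qed.

Lemma adj_congr I a b : is_ideal I -> I (a - b) -> adj I a = adj I b.
Proof.
move=> hI hab; apply/seteqP; split; apply: adj_sub; do ?[exact: adj_ideal|exact: sub_adj].
  by exists 1; rewrite mul1r.
by exists 1; rewrite mul1r -opprB; apply: idealN.
Qed.

Definition socle I : set R := [set u | forall c, m c -> I (c * u)].

(** A Gorenstein-type condition: the socle modulo [I], a vector space over the residue field, has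
    dimension at most one. *)
Definition socle_le1 I := forall u v, socle I u -> socle I v -> ~ I u ->
  exists c, I (v - c * u).

(* If [x] and [z] are regular modulo [I], then [u |-> v] with [x u = v z]
   modulo [I] identifies the socles modulo [(I, z)] and [(I, x)]: both are
   [Ext^1(R / m, R / I)]. *)
Lemma socle_exchange I x z : is_ideal I -> m x -> m z -> nzd I x -> nzd I z ->
  socle_le1 (adj I x) -> socle_le1 (adj I z).
Proof.
move=> hI hx hz hnx hnz hs u u' hu hu' nu.
have key w : socle (adj I z) w ->
    exists2 v, I (x * w - v * z) & socle (adj I x) v.
  move=> hw; have [v hv] := hw _ hx; exists v => // c hc.
  have [d hd] := hw _ hc; exists d; apply: hnz.
  have -> : z * (c * v - d * x) = x * (c * w - d * z) - c * (x * w - v * z) by ring.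
  by apply: idealB => //; apply: ideal_Ml.
have [v hv hvs] := key _ hu; have [v' hv' hvs'] := key _ hu'.
have [[r hr]|c [r hr]] := hs v v' hvs hvs'.
  apply: nu; exists r; apply: hnx.
  have -> : x * (u - r * z) = (x * u - v * z) + (v - r * x) * z by ring.
  by apply: idealD => //; apply: ideal_Mr.
exists c, r; apply: hnx.
have -> : x * (u' - c * u - r * z) = (x * u' - v' * z) - c * (x * u - v * z)
  + (v' - c * v - r * x) * z by ring.
apply: idealD => //; last exact: ideal_Mr.
by apply: idealB => //; apply: ideal_Ml.
Qed.

Lemma mem_rcons_sub s a : [set` rcons s a] `<=` m -> [set` s] `<=` m /\ m a.
Proof.
move=> h; split=> [x hx|]; apply: h; rewrite /= mem_rcons ?mem_head //.
by rewrite inE (hx : x \in s) orbT.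
Qed.

(* [gs] can be changed into [xs] one element at a time, replacing first the
   last element of [gs] by one that is also regular modulo all but the last
   element of [xs]. *)
Lemma reg_socle xs gs I : size xs = size gs -> is_ideal I -> I `<=` m ->
  [set` xs] `<=` m -> [set` gs] `<=` m -> reg I xs ->
  (forall x, x \in xs -> exists N, gens I gs (x ^+ N)) ->
  reg I gs /\ (socle_le1 (gens I xs) -> socle_le1 (gens I gs)).
Proof.
elim/last_ind: xs gs I => [|xs x IH] gs I.
  by case: gs.
case/lastP: gs => [|gs g]; first by rewrite size_rcons.
rewrite !size_rcons => -[hsz] hI Im /mem_rcons_sub [hxs hx] /mem_rcons_sub [hgs hg].
move=> /reg_rcons [hr hnx] hN.
have hX := gens_ideal xs hI; have hG := gens_ideal gs hI.
have [|N hxN] := hN x; first by rewrite mem_rcons mem_head.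
rewrite gens_rcons in hxN.
have [b hb hnz] := coset_avoidance Rn hX hG hxN (nzdX (k := N) hnx).
set z := g + b in hnz.
have hz : m z.
  by apply: idealD => //; apply: (gens_sub mI Im hgs).
have hzg : gens I gs (z - g) by rewrite /z addrC addKr.
have eG : gens (adj I z) gs = gens I (rcons gs g).
  by rewrite gens_adj // gens_rcons; apply: adj_congr.
have eX : gens (adj I z) xs = adj (gens I xs) z by rewrite gens_adj.
have [hnz0 hrz] : reg I (z :: xs).
  by apply: reg_consr => //; apply/reg_rcons.
have [|x' hx'|hrg hsg] := IH gs (adj I z) hsz (adj_ideal z hI) _ hxs hgs hrz.
- exact: adj_sub.
- by rewrite eG; apply: hN; rewrite mem_rcons inE hx' orbT.
split.
  have /reg_rcons [hrg' hnz'] : reg I (rcons gs z) by apply: reg_rconsr => //; split.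
  by apply/reg_rcons; split=> //; apply: nzd_congr hnz'.
rewrite -eG !gens_rcons => hs; apply: hsg; rewrite eX.
exact: (socle_exchange hX hx hz).
Qed.

(** A power of the last [x] lies in [J] and is a nonzerodivisor modulo the other elements of [xs],
    so by avoidance the coset [f + J] contains such a nonzerodivisor [z]. It replaces [x], and
    [primary_exchange] keeps the ideal [m]-primary. *)
Lemma primary_perturbation xs fs I J N : size xs = size fs -> is_ideal I ->
  I `<=` m -> is_ideal J -> J `<=` m -> [set` xs] `<=` m -> [set` fs] `<=` m ->
  reg I xs -> (forall x, x \in xs -> exists k, J (x ^+ k)) ->
  ideal_exp m N `<=` gens I xs ->
  exists gs, [/\ size gs = size fs, forall i, J (gs`_i - fs`_i) &
    exists k, ideal_exp m k `<=` gens I gs].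
Proof.
move=> + + + hJ Jm.
elim/last_ind: xs fs I N => [|xs x IH] fs I N.
  case: fs => // _ hI Im _ _ _ _ hN; exists [::]; split=> //; last by exists N.
  by move=> i; rewrite subrr; apply: ideal0.
case: fs => [|f fs]; first by rewrite size_rcons.
rewrite size_rcons => -[hsz] hI Im /mem_rcons_sub [hxs hx] hfs.
move=> /reg_rcons [hr hnx] hk hN.
have hX := gens_ideal xs hI.
have hf : m f by apply: hfs; rewrite /= mem_head.
have hfs' : [set` fs] `<=` m.
  by move=> u hu; apply: hfs; rewrite /= inE (hu : u \in fs) orbT.
have [|k hxk] := hk x; first by rewrite mem_rcons mem_head.
have [|b hb hnz] := @coset_avoidance _ Rn _ J f (x ^+ k) hX hJ _ (nzdX (k := k) hnx).
  exact: sub_adj.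
set z := f + b in hnz.
have hz : m z by apply: idealD => //; apply: Jm.
have eX : gens (adj I z) xs = adj (gens I xs) z by rewrite gens_adj.
have [hnz0 hrz] : reg I (z :: xs).
  by apply: reg_consr => //; apply/reg_rcons.
rewrite gens_rcons in hN.
have [|N' hN'] := primary_exchange Rn hm hX hN hx hz _ hnz.
  exact: gens_sub.
rewrite -eX in hN'.
have [|x' hx'|gs [hgs1 hgs2 hgs3]] :=
  IH fs (adj I z) N' hsz (adj_ideal z hI) _ hxs hfs' hrz _ hN'.
- exact: adj_sub.
- by apply: hk; rewrite mem_rcons inE hx' orbT.
exists (z :: gs); split=> //=; first by rewrite hgs1.
by case=> [|i] //=; rewrite /z addrC addKr.
Qed.

(** The exponent is the [a]-adic order of [x] modulo [I], finite by Krull's intersection theorem. *)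
Lemma krull_factor I a x : is_ideal I -> m a -> ~ I x ->
  exists k c, I (x - c * a ^+ k) /\ ~ adj I a c.
Proof.
move=> hI ha nx.
have hex : exists n, ~~ `[< adj I (a ^+ n) x >].
  apply: contrapT => hn; apply: nx; apply: (krull_intersection Rn hm) => // n.
  have [c hc] : adj I (a ^+ n) x.
    by apply: contrapT => h; apply: hn; exists n; apply/asboolPn.
  exists (x - c * a ^+ n) => //; rewrite opprB addrC subrK.
  by apply: ideal_Ml; [apply: ideal_exp_ideal|apply: ideal_expX].
case: (ex_minnP hex) => -[|k] /asboolPn hk hmin.
  by case: hk; exists x; rewrite mulr1 subrr; apply: ideal0.
have [c hc] : adj I (a ^+ k) x.
  by apply: contrapT => /asboolPn /hmin; rewrite ltnn.
exists k, c; split=> // -[d hd]; apply: hk; exists d.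
rewrite exprS; have -> : x - d * (a * a ^+ k) =
  (x - c * a ^+ k) + (c - d * a) * a ^+ k by ring.
by apply: idealD => //; apply: ideal_Mr.
Qed.

(** Two elements outside [I] have leading terms [c a^k] and [d a^l] with [c], [d] outside the prime
    [adj I a]. Were their product in [I], cancelling the powers of [a] would put [c d] in [I]. *)
Lemma prime_of_adj I a : is_ideal I -> m a -> nzd I a ->
  prime_ideal (adj I a) -> prime_ideal I.
Proof.
move=> hI ha hna hp.
split=> // [h1|x y hxy]; first by case: hp => _ + _; apply; apply: sub_adj.
apply: contrapT => h.
have [|k [c [hc nc]]] := @krull_factor I a x hI ha.
  by move=> ?; apply: h; left.
have [|l [d [hd nd]]] := @krull_factor I a y hI ha.
  by move=> ?; apply: h; right.
apply: (primeMn hp nc nd); apply: sub_adj.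
apply: (nzdX (k := k) hna); apply: (nzdX (k := l) hna).
have -> : a ^+ l * (a ^+ k * (c * d)) = x * y - (x - c * a ^+ k) * y
  - c * a ^+ k * (y - d * a ^+ l) by ring.
apply: idealB => //; last exact: ideal_Ml.
by apply: idealB => //; apply: ideal_Mr.
Qed.

Lemma reg_prime I s i : is_ideal I -> [set` s] `<=` m -> reg I s ->
  prime_ideal (gens I s) -> prime_ideal (gens I (take i s)).
Proof.
move=> hI; elim/last_ind: s i => [|s a IH] i //.
move=> /mem_rcons_sub [hs ha] /reg_rcons [hr hn].
rewrite gens_rcons => hp; have hp' := prime_of_adj (gens_ideal s hI) ha hn hp.
have [hi|hi] := leqP i (size s).
  by rewrite -cats1 takel_cat //; apply: IH.
by rewrite take_oversize ?size_rcons // gens_rcons.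
Qed.

Lemma reg_nth I s i : is_ideal I -> reg I s -> (i < size s)%N ->
  nzd (gens I (take i s)) s`_i.
Proof.
move=> hI; elim: s i I hI => [|a s IH] [|i] I hI //= [h hs] // hi.
by apply: IH => //; apply: adj_ideal.
Qed.

Lemma regular_sequenceP s : reg [set 0] s -> [set` s] `<=` m ->
  regular_sequence s.
Proof.
move=> hr hs; split.
  by move=> i hi x; rewrite !ideal_genE; apply: reg_nth => //; exact: ideal_zero.
rewrite ideal_genE => h1; case: hm => _ + _; apply.
by apply: (gens_sub mI _ hs) h1 => _ ->; apply: ideal0.
Qed.

Lemma reg_krull_dim s : reg [set 0] s -> m = gens [set 0] s ->
  krull_dim R (size s).
Proof.
move=> hr ms; have h0 := @ideal_zero R.
have hs : [set` s] `<=` m by move=> x hx; rewrite ms; apply: gens_in.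
have hsub i : gens [set 0] (take i s) `<=` m.
  apply: gens_sub => // [_ ->|x hx]; first exact: ideal0.
  by apply: hs; apply: mem_take hx.
split.
  exists (fun i => gens [set 0] (take i s)); split=> i hi.
    by apply: reg_prime => //; rewrite -ms; apply: local_prime.
  rewrite (take_nth 0) // gens_rcons; split; first exact: sub_adj.
  move=> /(_ s`_i) h.
  have hsi : gens [set 0] (take i s) s`_i.
    by apply: h; apply: adj_in; apply: gens_ideal.
  have := reg_nth h0 hr hi (x := 1); rewrite mulr1 => /(_ hsi) /hsub.
  by case: hm.
move=> k c hc; have [hp hsc] := hc.
have cm i : (i <= k)%N -> c i `<=` m.
  by move=> hi; have [hci c1 _] := hp i hi; apply: (local_sub hm).
case: k hc hp hsc cm => // k hc hp hsc cm.
(* The top prime of the chain is replaced by [m]: the chain stays strict, and now ends in a prime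
   minimal over the generators, as the height theorem requires. *)
apply: (@krull_height _ Rn k.+1 (fun i => if (i <= k)%N then c i else m) [set 0]) => //=.
- split=> i hi; first by case: leqP => h; [apply: hp|apply: local_prime].
  move: hi; rewrite ltnS leq_eqVlt => /orP[/eqP->|hi].
    rewrite eqxx ltnn /=; have [h1 h2] := hsc k (leqnn _).
    split; first by apply: cm.
    by move=> h; apply: h2; apply: subset_trans h; apply: cm.
  by rewrite hi orbT; apply: hsc; apply: ltnW.
- by move=> _ ->; apply: ideal0; apply: (prime_isideal (hp _ _)).
- by rewrite ltnn -ms.
- by rewrite ltnn -ms.
Qed.

End RegularSequence.

(** * The core of the criterion *)

Section Determinant.
Variable R : comNzRingType.
Implicit Types (I J K E : set R) (s t xs fs : seq R) (x y z a b c u v : R).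

Lemma prod_congr K (T : finType) (F G : T -> R) : is_ideal K ->
  (forall i, K (F i - G i)) -> K (\prod_i F i - \prod_i G i).
Proof.
move=> hK h; apply: (big_ind2 (fun a b => K (a - b))) => //.
  by rewrite subrr; apply: ideal0.
move=> a b c d h1 h2.
have -> : a * c - b * d = (a - b) * c + b * (c - d) by ring.
by apply: idealD => //; [apply: ideal_Mr|apply: ideal_Ml].
Qed.

Lemma det_congr K d (A B : 'M[R]_d) : is_ideal K ->
  (forall i j, K (A i j - B i j)) -> K (\det A - \det B).
Proof.
move=> hK h; rewrite /determinant -sumrB; apply: ideal_sum => // s _.
by rewrite -mulrBr; apply: ideal_Ml => //; apply: prod_congr.
Qed.

Lemma det_mul_gens xs fs (M : 'M[R]_(size xs)) (j : 'I_(size xs)) :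
  size fs = size xs ->
  (forall i : 'I_(size xs), fs`_i = \sum_(j < size xs) M i j * xs`_j) ->
  gens [set 0] fs (\det M * xs`_j).
Proof.
move=> hsz hM; have h0 := @ideal_zero R.
pose X : 'cV[R]_(size xs) := \col_j xs`_j.
have /matrixP/(_ j 0) : (\adj M *m (M *m X)) = \det M *: X.
  by rewrite mulmxA mul_adj_mx mul_scalar_mx.
rewrite !mxE => <-; apply: ideal_sum => [|i _]; first exact: gens_ideal.
apply: ideal_Ml; first exact: gens_ideal.
have -> : (M *m X) i 0 = fs`_i.
  by rewrite hM !mxE; apply: eq_bigr => k _; rewrite mxE.
by apply: gens_in => //; apply: mem_nth; rewrite hsz.
Qed.

Lemma ideal_mulC I J : ideal_mul I J = ideal_mul J I.
Proof.
by apply/seteqP; split; apply: ideal_mul_sub; do ?[exact: ideal_mul_ideal];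
  move=> x y hx hy; rewrite mulrC; apply: ideal_mul_in.
Qed.

Lemma ideal_mul_gensP K xs z : is_ideal K -> ideal_mul K (gens [set 0] xs) z ->
  exists2 c : nat -> R, forall i, K (c i) & z = \sum_(i < size xs) c i * xs`_i.
Proof.
move=> hK; pose F z := exists2 c : nat -> R, forall i, K (c i) &
  z = \sum_(i < size xs) c i * xs`_i.
suff : ideal_mul K (gens [set 0] xs) `<=` [set z | F z] by apply.
apply: ideal_mul_sub.
  apply: is_idealI.
  - exists (fun _ => 0) => [_|]; first exact: ideal0.
    by rewrite big1 // => i _; rewrite mul0r.
  - move=> _ _ [c hc ->] [e he ->]; exists (fun i => c i + e i).
      by move=> i; apply: idealD.
    by rewrite -big_split; apply: eq_bigr => i _; rewrite mulrDl.
  - move=> a _ [c hc ->]; exists (fun i => a * c i).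
      by move=> i; apply: ideal_Ml.
    by rewrite big_distrr; apply: eq_bigr => i _; rewrite /= mulrA.
move=> x y hx /(gensP _ _ (@ideal_zero R)) [c /eqP].
rewrite subr_eq0 => /eqP ->; exists (fun i => x * c i).
  by move=> i; apply: ideal_Mr.
by rewrite big_distrr; apply: eq_bigr => i _; rewrite /= mulrA.
Qed.

End Determinant.

Section Core.
Variable R : comNzRingType.
Hypothesis Rn : noetherian R.
Variable m : set R.
Hypothesis hm : local_at m.
Implicit Types (I J K E : set R) (s t xs fs gs : seq R) (x y z a b c u v w : R).

Let mI := local_ideal hm.

(** Multiply by elements of [m] as long as the result stays outside [K]; fewer than [k]
    multiplications are possible. *)
Lemma socle_exists K k u : is_ideal K -> (forall z, ideal_exp m k z -> K (z * u)) ->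
  ~ K u -> exists2 c, ~ K (c * u) & socle m K (c * u).
Proof.
move=> hK; elim: k u => [|k IH] u hk nu; first by case: nu; rewrite -[u]mul1r; apply: hk.
have [hu|hu] := pselect (socle m K u); first by exists 1; rewrite mul1r.
have [a ha nau] : exists2 a, m a & ~ K (a * u).
  apply: contrapT => hn; apply: hu => a ha; apply: contrapT => nau.
  by apply: hn; exists a.
have [z hz|c hc1 hc2] := IH (a * u) _ nau; last by exists (c * a); rewrite -mulrA.
by rewrite mulrA [z * a]mulrC; apply: hk; apply: ideal_expM.
Qed.

Lemma socle_le1_max : socle_le1 m m.
Proof.
move=> u v _ _ /(local_unit hm) [d hd]; exists (v * d).
by rewrite -mulrA [d * u]mulrC hd mulr1 subrr; apply: ideal0.
Qed.

(* A form of a theorem of Wiebe: if some product of [size xs] Koszul classes is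
   nonzero in the quotient by [(J, w)], then [J] is a complete intersection. *)
Theorem regular_of_det xs fs w J (M : 'M[R]_(size xs)) :
  m = gens [set 0] (w :: xs) -> reg [set 0] (w :: xs) -> is_ideal J -> J `<=` m ->
  nzd J w -> size fs = size xs -> [set` fs] `<=` J ->
  (forall i : 'I_(size xs), fs`_i = \sum_(j < size xs) M i j * xs`_j) ->
  ~ adj J w (\det M) ->
  J = gens [set 0] fs /\ reg [set 0] fs.
Proof.
move=> mE hreg hJ Jm hJw hsz hfs hM hdet.
have h0 := @ideal_zero R; pose I := adj [set 0] w.
have hI : is_ideal I by apply: adj_ideal.
have {}mE : m = gens I xs := mE.
have [hw0 hregx] : nzd [set 0] w /\ reg I xs := hreg.
have wm : m w by rewrite mE; apply: sub_gens; apply: adj_in.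
have Im : I `<=` m by apply: adj_sub => // _ ->; apply: ideal0.
have xsm : [set` xs] `<=` m by move=> x hx; rewrite mE; apply: gens_in.
have fsm : [set` fs] `<=` m by apply: subset_trans hfs Jm.
have hJw' := adj_ideal w hJ.
have [N hN] : exists N, ~ addI (adj J w) (ideal_exp m N) (\det M).
  apply: contrapT => hn; apply: hdet; apply: (krull_intersection Rn hm) => // n.
  by apply: contrapT => h; apply: hn; exists n.
set E := ideal_exp m N in hN; have hE : is_ideal E := @ideal_exp_ideal _ m N.
(* Perturbing by [m^N (xs)] serves twice: the entries of [M] change by elements of [E = m^N], and
   the sequence itself changes inside [m E], as Nakayama's lemma will require. *)
pose Jp := ideal_mul E (gens [set 0] xs).
have hJp : is_ideal Jp by apply: ideal_mul_ideal.
have JpE : Jp `<=` E by apply: ideal_mul_subl.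
have gxm : gens [set 0] xs `<=` m.
  by apply: gens_sub => // _ ->; apply: ideal0.
have Jpm : Jp `<=` m by apply: subset_trans gxm; apply: ideal_mul_subr; apply: gens_ideal.
have JpmE : Jp `<=` ideal_mul m E by rewrite ideal_mulC; apply: ideal_mulS.
have [x hx||gs [gs1 gs2 [k gs3]]] :=
  @primary_perturbation _ Rn _ hm xs fs I Jp 1 (esym hsz) hI Im hJp Jpm xsm fsm hregx.
- exists N.+1; rewrite exprSr; apply: ideal_mul_in.
    by apply: ideal_expX; apply: xsm.
  by apply: gens_in.
- by rewrite ideal_exp1 // mE.
have gsm : [set` gs] `<=` m.
  move=> x /(nthP 0) [i hi <-]; rewrite -[gs`_i](subrK fs`_i); apply: idealD => //.
    exact: Jpm.
  by apply: fsm; apply: mem_nth; rewrite -gs1.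
have hG := gens_ideal gs hI; have hF := gens_ideal fs hI.
have [|x hx|gsr gss] := @reg_socle _ Rn _ hm xs gs I _ hI Im xsm gsm hregx.
- by rewrite gs1.
- by exists k; apply: gs3; apply: ideal_expX; apply: xsm.
have {}gss : socle_le1 m (gens I gs) by apply: gss; rewrite -mE; apply: socle_le1_max.
have /choice [e he] : forall i : 'I_(size xs), exists c : nat -> R,
    (forall j, E (c j)) /\ gs`_i - fs`_i = \sum_(j < size xs) c j * xs`_j.
  by move=> i; have [c h1 h2] := ideal_mul_gensP hE (gs2 i); exists c.
pose G : 'M[R]_(size xs) := \matrix_(i, j) (M i j + e i j).
have hGx (i : 'I_(size xs)) : gs`_i = \sum_(j < size xs) G i j * xs`_j.
  rewrite -[gs`_i](subrK fs`_i) addrC (he i).2 hM -big_split.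
  by apply: eq_bigr => j _; rewrite mxE mulrDl.
have detE : E (\det G - \det M).
  by apply: det_congr => // i j; rewrite mxE addrC addKr; apply: (he i).1.
pose Jt := addI (adj J w) E.
have hJt : is_ideal Jt by apply: addI_ideal.
have EJt : E `<=` Jt by apply: addI_subr.
have JJt : J `<=` Jt by move=> u hu; apply: addI_subl => //; apply: sub_adj.
have IJt : I `<=` Jt.
  move=> u hu; apply: addI_subl => //; apply: adjS hu => _ ->; exact: ideal0.
have GJt : gens I gs `<=` Jt.
  apply: gens_sub => // x /(nthP 0) [i hi <-]; rewrite -[gs`_i](subrK fs`_i).
  apply: idealD => //; first by apply: EJt; apply: JpE.
  by apply: JJt; apply: hfs; apply: mem_nth; rewrite -gs1.
have nG : ~ Jt (\det G).
  by move=> h; apply: hN; apply: (idealBr hJt _ h); apply: EJt.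
have socG : socle m (gens I gs) (\det G).
  rewrite /socle {1}mE.
  suff : gens I xs `<=` [set c | gens I gs (c * \det G)] by apply.
  apply: gens_sub => [|c hc|c hc]; rewrite /mkset.
  - apply: is_idealI => [|a b ha hb|a b hb]; rewrite /mkset.
    + by rewrite mul0r; apply: ideal0.
    + by rewrite mulrDl; apply: idealD.
    + by rewrite -mulrA; apply: ideal_Ml.
  - by apply: ideal_Mr => //; apply: sub_gens.
  - have hi : (index c xs < size xs)%N by rewrite index_mem.
    have := @det_mul_gens _ xs gs G (Ordinal hi) _ hGx.
    rewrite nth_index // mulrC => h; apply: (gensS (I := [set 0])).
      by move=> _ ->; apply: ideal0.
    by apply: h; rewrite gs1.
(* If [Jt] were not inside [(I, gs)], it would contain a nonzero socle element modulo [(I, gs)]; as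
   the socle is at most one-dimensional, it would contain [det G] too. *)
have JtG : Jt `<=` gens I gs.
  move=> u hu; apply: contrapT => nu.
  have [z hz|c nc hc] := @socle_exists (gens I gs) k u hG _ nu.
    by apply: ideal_Mr => //; apply: gs3.
  have [d hd] := gss _ _ hc socG nc; apply: nG.
  rewrite -[\det G](subrK (d * (c * u))); apply: idealD => //; first exact: GJt.
  by do 2!apply: ideal_Ml => //.
have GF : gens I gs `<=` addI (gens I fs) (ideal_mul m E).
  have hA : is_ideal (addI (gens I fs) (ideal_mul m E)).
    by apply: addI_ideal => //; apply: ideal_mul_ideal.
  apply: gens_sub => // [|x /(nthP 0) [i hi <-]].
    move=> u hu; apply: addI_subl; [exact: ideal_mul_ideal|exact: sub_gens].
  exists fs`_i; last by apply: JpmE; apply: gs2.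
  by apply: gens_in => //; apply: mem_nth; rewrite -gs1.
(* [E] lies in [Jt], hence in [(I, gs)], hence in [(I, fs) + m E]: Nakayama's lemma undoes the
   perturbation. *)
have EF : E `<=` gens I fs.
  by apply: (nakayama_local Rn hm) => //; apply: subset_trans GF; apply: subset_trans JtG.
have JF : J `<=` gens I fs.
  apply: subset_trans JJt _; apply: subset_trans JtG _; apply: subset_trans GF _.
  apply: addI_sub => //; apply: subset_trans EF; exact: ideal_mul_subr.
have hF0 := gens_ideal fs h0.
have F0J : gens [set 0] fs `<=` J by apply: gens_sub => // _ ->; apply: ideal0.
split.
  (* An element of [J] is [c w] modulo [(fs)]; as [w] is a nonzerodivisor modulo [J], [c] is in [J],
     so [J] lies in [(fs) + m J]. *)
  apply/seteqP; split=> //; apply: (nakayama_local Rn hm) => // j hj.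
  have := JF _ hj; rewrite /I gens_adj // => -[c hc].
  exists (j - c * w) => //; rewrite opprB addrC subrK mulrC; apply: ideal_mul_in => //.
  apply: hJw; have -> : w * c = j - (j - c * w) by ring.
  by apply: idealB => //; apply: F0J.
have [x hx|hfr _] := @reg_socle _ Rn _ hm xs fs I (esym hsz) hI Im xsm fsm hregx.
  by exists N; apply: EF; apply: ideal_expX; apply: xsm.
have : reg [set 0] (rcons fs w) by apply: (reg_rconsr Rn hm h0 fsm wm); split.
by case/reg_rcons.
Qed.

End Core.

(** * Lengths over a discrete valuation ring *)

Section Dvr.
Variable O : comNzRingType.
Hypotheses (O_dvr : dvr O) (On : noetherian O) (Ol : local_ring O).
Implicit Types (a b c o u w : O).

Lemma dvr_mul_eq0 a b : a * b = 0 -> a = 0 \/ b = 0.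
Proof.
case: O_dvr => h _ _ _ /h /orP[/eqP->|/eqP->]; by [left|right].
Qed.

Lemma dvr_uniformizer : exists2 w, w <> 0 & max_ideal O = adj [set 0] w.
Proof.
case: O_dvr => _ hp _ hm0.
have [w hw] := hp _ (local_ideal (max_ideal_local On Ol)).
have e : max_ideal O = adj [set 0] w.
  rewrite hw -[adj _ _]/(gens [set 0] [:: w]) -ideal_genE; congr ideal_gen.
  by apply/seteqP; split=> x /=; rewrite inE => /eqP.
exists w => // w0; apply: hm0; rewrite e w0; apply/seteqP; split.
  by move=> x [c /=]; rewrite mulr0 subr0.
by move=> x ->; exists 0; rewrite mul0r subrr.
Qed.

Variable w : O.
Hypotheses (w_neq0 : w <> 0) (wE : max_ideal O = adj [set 0] w).

Lemma dvr_nonunit c : w * c <> 1.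
Proof.
move=> h; case: (max_ideal_local On Ol) => _ + _; apply.
by rewrite wE; exists c; rewrite mulrC h subrr.
Qed.

Lemma dvr_factor a : a <> 0 -> exists k u u', u * u' = 1 /\ a = u * w ^+ k.
Proof.
move=> ha; have hl := max_ideal_local On Ol.
have [||k [u [h nu]]] := @krull_factor _ On _ hl [set 0] w a (@ideal_zero O).
- by rewrite wE; apply: adj_in; exact: ideal_zero.
- by [].
have [|u' hu] := local_unit hl (c := u); first by rewrite wE.
by exists k, u, u'; split=> //; apply/eqP; rewrite -subr_eq0; apply/eqP.
Qed.

Lemma dvr_expr_neq0 k : w ^+ k <> 0.
Proof.
elim: k => [|k IH]; first by apply/eqP; rewrite oner_eq0.
by rewrite exprS => /dvr_mul_eq0 [].
Qed.

(** The inverse image in [O] of the [i]-th submodule contains some [w ^ e] with [e + i <= n], since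
    each strict inclusion brings in an element of smaller valuation. *)
Lemma quotient_chain_le (N : submodule O^o) n k (c : nat -> set (quotient_module N)) :
  submod_set N (w ^+ n) -> strict_chain (@is_submodule O (quotient_module N)) k c ->
  (k <= n)%N.
Proof.
move=> hN [hc hs]; pose D i : set O := [set o | c i (\pi_(quotient_module N) o)].
have DM i a o : (i <= k)%N -> D i o -> D i (a * o).
  move=> hi ho; have [h0 hD] := hc i hi.
  have := hD a _ _ ho h0; rewrite addr0 /D /= => h.
  by rewrite -[a * o]/(a *: (o : O^o)) -(scale_quotientE N).
suff : forall i, (i <= k)%N -> exists2 e, (e + i <= n)%N & D i (w ^+ e).
  by move=> /(_ k (leqnn k)) [e he _]; apply: leq_trans he; apply: leq_addl.
elim=> [|i IH] hi.
  exists n; rewrite ?addn0 //.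
  have [h0 _] := hc 0%N hi; rewrite /D /=.
  have -> // : \pi_(quotient_module N) (w ^+ n) = 0.
  have -> : 0 = \pi_(quotient_module N) (0 : O^o) by rewrite raddf0.
  by apply/quotient_moduleE; rewrite subr0.
have [e he hD] := IH (ltnW hi).
have [h1 h2] := hs i hi.
have [v hv nv] : exists2 v, c i.+1 v & ~ c i v.
  apply: contrapT => hn; apply: h2 => v hv; apply: contrapT => nv.
  by apply: hn; exists v.
have [o ov] := quotient_piP v; rewrite ov in hv nv.
have [|f [u [u' [hu ho]]]] := @dvr_factor o.
  move=> o0; apply: nv; have [h0 _] := hc i (ltnW hi).
  by rewrite o0 raddf0.
have fe : (f < e)%N.
  rewrite ltnNge; apply/negP => ef; apply: nv.
  have := DM i (u * w ^+ (f - e)) _ (ltnW hi) hD.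
  by rewrite -mulrA -exprD subnK // -ho.
exists f; first by rewrite addnS; apply: leq_trans he; rewrite ltn_add2r.
have := DM i.+1 u' o hi hv.
by rewrite ho mulrA [u' * u]mulrC hu mul1r.
Qed.

End Dvr.

(** * Triangular relations of the cotangent module *)

Section Lattice.
Variables (O : comNzRingType) (A S : comNzRingType).
Hypotheses (O_dvr : dvr O) (On : noetherian O) (Ol : local_ring O).
Variables (p : augmentation A O) (psi : {rmorphism S -> A}).
Hypothesis psi_surj : set_surj setT setT psi.
Variables (xs : seq S) (w : S).
Hypothesis kerE : forall s, p (psi s) = 0 <-> gens [set 0] xs s.
Hypothesis wE : max_ideal O = adj [set 0] (p (psi w)).

(** Coefficient vectors are functions on [nat] of which only the entries below [size xs] count; by
    [kerE] their combinations are exactly the kernel of [S -> O]. *)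
Let comb (s : nat -> S) := \sum_(k < size xs) s k * xs`_k.

Let combD s t : comb (fun k => s k + t k) = comb s + comb t.
Proof. by rewrite /comb -big_split; apply: eq_bigr => i _; rewrite mulrDl. Qed.

Let combM a s : comb (fun k => a * s k) = a * comb s.
Proof. by rewrite /comb big_distrr; apply: eq_bigr => i _; rewrite /= mulrA. Qed.

Let combN s : comb (fun k => - s k) = - comb s.
Proof. by rewrite /comb -sumrN; apply: eq_bigr => i _; rewrite mulNr. Qed.

Let comb_ker s : ring_ker p (psi (comb s)).
Proof.
apply/kerE; apply: ideal_sum => [|i _]; first exact: gens_ideal (@ideal_zero S).
apply: ideal_Ml; first exact: gens_ideal (@ideal_zero S).
by apply: gens_in; [exact: ideal_zero|exact: mem_nth].
Qed.

Let ker_comb a : ring_ker p a -> exists s, a = psi (comb s).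
Proof.
move=> ha; have [y _ hy] := psi_surj (I : [set: A] a).
have /kerE /(gensP _ _ (@ideal_zero S)) [c /eqP] : p (psi y) = 0 by rewrite hy.
by rewrite subr_eq0 => /eqP hc; exists c; rewrite -hy hc.
Qed.

Let ker_sq_comb a : ideal_exp (ring_ker p) 2 a ->
  exists2 s, (forall k, p (psi (s k)) = 0) & a = psi (comb s).
Proof.
have hK : is_ideal (ring_ker p) := ker_submodule p.
rewrite ideal_expS ideal_exp1 //.
pose F a := exists2 s, (forall k, p (psi (s k)) = 0) & a = psi (comb s).
suff h : ideal_mul (ring_ker p) (ring_ker p) `<=` [set a | F a] by apply: h.
apply: ideal_mul_sub.
  apply: is_idealI.
  - exists (fun _ => 0) => [_|]; first by rewrite !rmorph0.
    by rewrite /comb big1 ?rmorph0 // => i _; rewrite mul0r.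
  - move=> _ _ [s hs ->] [t ht ->]; exists (fun k => s k + t k).
      by move=> k; rewrite !rmorphD hs ht addr0.
    by rewrite combD rmorphD.
  - move=> b _ [s hs ->]; have [y _ <-] := psi_surj (I : [set: A] b).
    exists (fun k => y * s k); last by rewrite combM rmorphM.
    by move=> k; rewrite !rmorphM hs mulr0.
move=> x y hx /ker_comb [s ->]; have [z _ hz] := psi_surj (I : [set: A] x).
exists (fun k => z * s k); last by rewrite combM rmorphM hz.
by move=> k; rewrite !rmorphM hz hx mul0r.
Qed.

Let cls s : cotangent p :=
  \pi_(quotient_module (aug_ker_sq p))
    (SubmodType (N := aug_ker p) (asboolT (comb_ker s : submod_set (aug_ker p) _))).

Let clsE s t : cls s = cls t <-> ideal_exp (ring_ker p) 2 (psi (comb s) - psi (comb t)).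
Proof. exact: quotient_moduleE. Qed.

Let clsD s t : cls (fun k => s k + t k) = cls s + cls t.
Proof.
transitivity (\pi_(quotient_module (aug_ker_sq p))
    (SubmodType (N := aug_ker p) (asboolT (comb_ker s : submod_set (aug_ker p) _))
   + SubmodType (N := aug_ker p) (asboolT (comb_ker t : submod_set (aug_ker p) _)))).
  apply/quotient_moduleE => /=.
  rewrite combD rmorphD subrr; exact: ideal0 (@ideal_exp_ideal _ _ 2).
by rewrite raddfD.
Qed.

Let clsM a s : p (psi a) *: cls s = cls (fun k => a * s k).
Proof.
rewrite -[_ *: _]/(cotangent_scale (p (psi a)) (cls s)) cotangent_scaleE.
rewrite scale_quotientE; apply/quotient_moduleE => /=.
rewrite combM rmorphM subrr; exact: ideal0 (@ideal_exp_ideal _ _ 2).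
Qed.

Let Ncls (V : set (nat -> S)) : set (cotangent p) := [set v | exists2 s, V s & v = cls s].

Let Ncls_submodule (V : set (nat -> S)) :
  (forall s t, V s -> V t -> V (fun k => s k + t k)) ->
  (forall a s, V s -> V (fun k => a * s k)) -> V (fun _ => 0) ->
  is_submodule (Ncls V).
Proof.
move=> VD VM V0; split.
  exists (fun _ => 0) => //.
  have := clsM 0 (fun _ => 0); rewrite !rmorph0 scale0r => ->.
  by congr cls; apply/funext => k; rewrite mul0r.
move=> o _ _ [s hs ->] [t ht ->].
have [a _ <-] := @aug_surj _ _ p o I.
have [y _ <-] := psi_surj (I : [set: A] a).
exists (fun k => y * s k + t k); last by rewrite clsM clsD.
by apply: (VD (fun k => y * s k)) => //; apply: VM.
Qed.

Let chain_le (l : nat) (N : set (cotangent p)) := exists2 c,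
  strict_chain (@is_submodule O (cotangent p)) l c & c l `<=` N.

Let chain_leS l N N' : is_submodule N' -> chain_le l N -> N `<=` N' ->
  ~ N' `<=` N -> chain_le l.+1 N'.
Proof.
move=> hN' [c [hc hs] hcN] h1 h2.
exists (fun i => if (i <= l)%N then c i else N'); last by rewrite ltnn.
split=> i hi; first by case: leqP => h //; apply: hc.
move: hi; rewrite ltnS leq_eqVlt => /orP[/eqP->|hi].
  rewrite eqxx ltnn /=; split; first by apply: subset_trans h1.
  by move=> h; apply: h2; apply: subset_trans hcN.
by rewrite hi orbT; apply: hs.
Qed.

(** Vectors whose image in [O] is supported on the first [i] coordinates. The sets [V i e] refine
    the step from [U i] to [U i.+1] by the valuation of coordinate [i]; the classes of all these
    vectors form the chain that is compared with the length. *)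
Let U i : set (nat -> S) :=
  [set s | forall j, (i <= j)%N -> p (psi (s j)) = 0].

Let V i e : set (nat -> S) :=
  [set s | (forall j, (i < j)%N -> p (psi (s j)) = 0) /\
           exists o, p (psi (s i)) = o * p (psi w) ^+ e].

Let U_submodule i : is_submodule (Ncls (U i)).
Proof.
apply: Ncls_submodule => [s t hs ht j hj|a s hs j hj|j hj].
- by rewrite !rmorphD hs // ht // addr0.
- by rewrite !rmorphM hs // mulr0.
- by rewrite !rmorph0.
Qed.

Let V_submodule i e : is_submodule (Ncls (V i e)).
Proof.
apply: Ncls_submodule => [s t [hs [o ho]] [ht [o' ho']]|a s [hs [o ho]]|]; split.
- by move=> j hj; rewrite !rmorphD hs // ht // addr0.
- by exists (o + o'); rewrite !rmorphD ho ho' mulrDl.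
- by move=> j hj; rewrite !rmorphM hs // mulr0.
- by exists (p (psi a) * o); rewrite !rmorphM ho mulrA.
- by move=> j hj; rewrite !rmorph0.
- by exists 0; rewrite !rmorph0 mul0r.
Qed.

Let U_V i e : Ncls (U i) `<=` Ncls (V i e).
Proof.
move=> _ [s hs ->]; exists s => //; split=> [j hj|]; first by apply: hs; apply: ltnW.
by exists 0; rewrite mul0r hs.
Qed.

Let V_U i : Ncls (V i 0) `<=` Ncls (U i.+1).
Proof. by move=> _ [s [hs _] ->]; exists s. Qed.

Let V_S i e : Ncls (V i e.+1) `<=` Ncls (V i e).
Proof.
move=> _ [s [hs [o ho]] ->]; exists s => //; split=> //.
by exists (o * p (psi w)); rewrite ho -mulrA -exprS.
Qed.

(** A row of a Hermite normal form of the relation lattice over [O]: zero beyond the diagonal, with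
    a diagonal entry of valuation [n]. *)
Definition triangular_relation j (v : nat -> S) n :=
  [/\ psi (comb v) = 0, forall k, (j < k)%N -> (k < size xs)%N -> p (psi (v k)) = 0 &
      exists u u', u * u' = 1 /\ p (psi (v j)) = u * p (psi w) ^+ n].

(** If the class of [w^e x_i] came from a vector whose entry [i] is divisible by [w^(e+1)] in [O],
    the difference, corrected by a vector [t] accounting for the square of the kernel, would be a
    relation with diagonal entry [(1 - o w) w^e], a unit times [w^e]. *)
Let V_strict i e : (i < size xs)%N -> (forall v, ~ triangular_relation i v e) ->
  ~ Ncls (V i e) `<=` Ncls (V i e.+1).
Proof.
move=> hi hn h.
have [|s [hs [o ho]] hcls] := h (cls (fun k => if k == i then w ^+ e else 0)).
  eexists; last by reflexivity.
  split=> [j hj|]; first by rewrite gtn_eqF // !rmorph0.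
  by exists 1; rewrite eqxx mul1r !rmorphXn.
move/clsE/ker_sq_comb: hcls => [t ht /eqP].
rewrite -rmorphB -subr_eq0 -rmorphB -!combN -!combD => /eqP h0.
set v := fun k : nat => _ in h0.
have [u' hu'] : exists u', (1 - o * p (psi w)) * u' = 1.
  apply: (local_unit (max_ideal_local On Ol)).
  apply: (local_1B (max_ideal_local On Ol)).
  by rewrite wE; apply: adj_inM; exact: ideal_zero.
apply: (hn v); split=> //.
  move=> k hk _; rewrite /v gtn_eqF // !(rmorphD, rmorphN) /=.
  by rewrite hs // ht !rmorph0 !subr0.
exists (1 - o * p (psi w)), u'; split=> //.
rewrite /v eqxx !(rmorphD, rmorphN, rmorphXn) /= ho ht exprS; ring.
Qed.

(** Below the least valuation [e] of a diagonal entry in position [i], the inclusions between the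
    classes of the [V i f] are strict, so position [i] contributes [e] steps to a chain of
    submodules; the whole chain has length at most [l]. *)
Lemma triangular_relations l : has_length (cotangent p) l ->
  exists v : nat -> nat -> S, exists n : nat -> nat,
    (forall j, (j < size xs)%N -> triangular_relation j (v j) (n j)) /\
    (\sum_(j < size xs) n j <= l)%N.
Proof.
move=> [_ hl].
suff : forall i, (i <= size xs)%N ->
  exists v : nat -> nat -> S, exists n : nat -> nat,
    (forall j, (j < i)%N -> triangular_relation j (v j) (n j)) /\
    chain_le (\sum_(j < i) n j) (Ncls (U i)).
  move=> /(_ _ (leqnn _)) [v [n [h [c hc _]]]]; exists v, n; split=> //.
  exact: hl hc.
elim=> [|i IH] hi.
  exists (fun _ _ => 0), (fun _ => 0%N); split=> //.
  rewrite big_ord0; exists (fun _ => Ncls (U 0)) => //; split=> //.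
have [v [n [hv hc]]] := IH (ltnW hi).
have step e : (forall e' v, (e' < e)%N -> ~ triangular_relation i v e') ->
    chain_le (\sum_(j < i) n j + e) (Ncls (V i 0)).
  move=> he; suff : forall f, (f <= e)%N ->
      chain_le (\sum_(j < i) n j + f) (Ncls (V i (e - f))).
    by move=> /(_ e (leqnn e)); rewrite subnn.
  elim=> [|f IHf] hf.
    rewrite addn0; case: hc => c hc hcU; exists c => //.
    by apply: subset_trans hcU _; apply: U_V.
  rewrite addnS; apply: chain_leS (IHf (ltnW hf)) _ _.
  - exact: V_submodule.
  - by rewrite -(subnSK hf); apply: V_S.
  - rewrite -(subnSK hf); apply: V_strict => // v'; apply: he.
    by rewrite ltn_subrL; case: (e) hf.
have [e [v' he'] hmin] : exists2 e, (exists v, triangular_relation i v e) &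
    forall e' v, (e' < e)%N -> ~ triangular_relation i v e'.
  have hex : exists e, `[< exists v, triangular_relation i v e >].
    apply: contrapT => hn.
    (* Without any relation in position [i], the chain could be continued beyond length [l]. *)
    have [|c hc' _] := step l.+1.
      move=> e' v'' _ h; apply: hn; exists e'; apply/asboolP; by exists v''.
    have := hl _ _ hc'; by rewrite addnS ltnNge leq_addl.
  case: (ex_minnP hex) => e /asboolP he hm; exists e => // e' v' h h'.
  by have := hm e' (asboolT (ex_intro _ v' h')); rewrite leqNgt h.
exists (fun j => if j == i then v' else v j), (fun j => if j == i then e else n j).
split.
  move=> j; rewrite ltnS leq_eqVlt => /orP[/eqP->|hj]; first by rewrite eqxx.
  by rewrite ltn_eqF //; apply: hv.
have -> : (\sum_(j < i.+1) (if (j : nat) == i then e else n j) = \sum_(j < i) n j + e)%N.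
  rewrite big_ord_recr /= eqxx; congr (_ + _)%N; apply: eq_bigr => j _.
  by rewrite ltn_eqF.
have [c hc1 hc2] := step e hmin; exists c => //.
by apply: subset_trans hc2 _; apply: V_U.
Qed.

Lemma relation_matrix l : has_length (cotangent p) l ->
  exists fs, exists M : 'M[S]_(size xs), [/\ size fs = size xs,
    forall f, f \in fs -> psi f = 0,
    forall i : 'I_(size xs), fs`_i = \sum_(j < size xs) M i j * xs`_j &
    exists n u u', [/\ (n <= l)%N, u * u' = 1 &
      p (psi (\det M)) = u * p (psi w) ^+ n]].
Proof.
move=> /triangular_relations [v [n [hv hn]]].
exists (mkseq (fun i => comb (v i)) (size xs)), (\matrix_(i, j) v i j).
split.
- by rewrite size_mkseq.
- by move=> f /mapP [i]; rewrite mem_iota => /= hi ->; have [] := hv i hi.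
- by move=> i; rewrite nth_mkseq //; apply: eq_bigr => j _; rewrite mxE.
have /choice [u hu] : forall i : 'I_(size xs), exists u, exists u',
    u * u' = 1 /\ p (psi (v i i)) = u * p (psi w) ^+ n i.
  by move=> i; have [_ _] := hv i (ltn_ord i).
have {hu} /choice [u' hu] := hu.
exists (\sum_(j < size xs) n j)%N, (\prod_i u i), (\prod_i u' i); split=> //.
  by rewrite -big_split big1 // => i _; case: (hu i).
(* [M] is triangular only after its entries are mapped to [O]. *)
rewrite -!det_map_mx det_trig; last first.
  apply/is_trig_mxP => i j hij; rewrite !mxE.
  by have [_ h _] := hv i (ltn_ord i); apply: h.
rewrite expr_sum -big_split; apply: eq_bigr => i _; rewrite !mxE.
by case: (hu i).
Qed.

End Lattice.

(** * The criterion for a regular cover *)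

Section SurjectiveLocal.
Variables (R T : comNzRingType) (f : {rmorphism R -> T}) (m : set R) (n : set T).
Hypotheses (hm : local_at m) (hn : local_at n) (fsurj : set_surj setT setT f).

Lemma surj_local x : m x <-> n (f x).
Proof.
have [hmi m1 mu] := hm; have [hni n1 nu] := hn; split=> h; apply: contrapT => h'.
  have [u hu] := nu _ h'; have [t _ ht] := fsurj (I : [set: T] u).
  have [v hv] : exists v, (1 - x * t) * v = 1.
    by apply: (local_unit hm); apply: (local_1B hm); apply: ideal_Mr.
  have := congr1 f hv; rewrite rmorphM rmorphB !rmorph1 rmorphM ht hu subrr mul0r.
  by move/esym/eqP; rewrite oner_eq0.
have [u hu] := mu _ h'; apply: n1; rewrite -(rmorph1 f) -hu rmorphM.
exact: ideal_Mr.
Qed.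

End SurjectiveLocal.

Lemma rmorph_ker_ideal (R T : comNzRingType) (f : {rmorphism R -> T}) :
  is_ideal (ring_ker f).
Proof.
apply: is_idealI => [|x y hx hy|a x hx]; rewrite /ring_ker /mkset.
- by rewrite rmorph0.
- by rewrite rmorphD hx hy addr0.
- by rewrite rmorphM hx mulr0.
Qed.

Lemma reg_map (R : comNzRingType) (I : set R) (h : R -> R) s : is_ideal I ->
  (forall x, I (x - h x)) -> reg I s -> reg I (map h s).
Proof.
elim: s I => //= x s IH I hI hh [hx hs]; split; first exact: nzd_congr hx.
rewrite -(adj_congr hI (hh x)); apply: IH => //; first exact: adj_ideal.
by move=> y; apply: sub_adj.
Qed.

Lemma gens_map (R : comNzRingType) (I : set R) (h : R -> R) s : is_ideal I ->
  (forall x, I (x - h x)) -> gens I (map h s) = gens I s.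
Proof.
elim: s I => //= x s IH I hI hh.
rewrite -(adj_congr hI (hh x)); apply: IH; first exact: adj_ideal.
by move=> y; apply: sub_adj.
Qed.

Section Criterion.
Variable O : comNzRingType.
Hypotheses (O_dvr : dvr O) (O_cnl : complete_noetherian_local O).
Variables (A B : augmented_ring O) (phi : {rmorphism A -> B}).
Hypotheses (phi_aug : augmented_map phi) (phi_surj : set_surj setT setT phi).
Hypothesis B_depth : has_depth B 1.
Variables (lPhi leta : nat).
Hypotheses (lPhiP : has_length (Phi A) lPhi) (letaP : has_length (Oeta B) leta).
Hypothesis le_Phi_eta : (lPhi <= leta)%N.
Variables (S : comNzRingType) (f : {rmorphism S -> A}) (z : S) (zs : seq S).
Hypotheses (S_cnl : complete_noetherian_local S) (f_surj : set_surj setT setT f).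
Hypotheses (mE : max_ideal S = gens [set 0] (z :: zs)) (hreg : reg [set 0] (z :: zs)).
Hypothesis piz : max_ideal O = adj [set 0] (aug_pi A (f z)).

Let p := aug_pi A.

Let On : noetherian O. Proof. by case: O_cnl. Qed.
Let Ol : local_ring O. Proof. by case: O_cnl. Qed.
Let Sn : noetherian S. Proof. by case: S_cnl. Qed.
Let m := max_ideal S.
Let hm : local_at m.
Proof. by case: S_cnl => ? ? _; apply: max_ideal_local. Qed.
Let mI := local_ideal hm.
Let h0 := @ideal_zero S.
Let hO := max_ideal_local On Ol.

Let piz_neq0 : p (f z) <> 0.
Proof.
move=> e; case: O_dvr => _ _ _; apply; rewrite piz /= -/p e.
apply/seteqP; split=> x; first by case=> c /=; rewrite mulr0 subr0.
by move=> ->; exists 0; rewrite mul0r subrr.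
Qed.

Let pf_surj o : exists s, p (f s) = o.
Proof.
have [a _ <-] := @aug_surj _ _ p o I; have [s _ <-] := f_surj (I : [set: A] a).
by exists s.
Qed.

Let pf_local s : m s <-> max_ideal O (p (f s)).
Proof.
have fs : set_surj setT setT (p \o f).
  by move=> o _; have [s' hs'] := pf_surj o; exists s'.
exact: (surj_local (f := p \o f) hm hO fs s).
Qed.

(** Subtracting multiples of [z] moves the other parameters into the kernel of [S -> O]. They then
    generate it: modulo [(xs)], an element outside [(xs)] is a unit times a power of [z], and powers
    of the uniformizer are not zero in [O]. *)
Let adjusted : exists xs, [/\ m = gens [set 0] (z :: xs), reg [set 0] (z :: xs) &
  forall s, p (f s) = 0 <-> gens [set 0] xs s].
Proof.
have /choice [c hc] : forall x, exists c, m x -> p (f (x - c * z)) = 0.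
  move=> x; have [hx|hx] := pselect (m x); last by exists 0.
  have := (pf_local x).1 hx; rewrite piz => -[o ho].
  have [c hc] := pf_surj o; exists c => _.
  by rewrite !rmorphB !rmorphM hc; exact: ho.
pose h x := x - c x * z; pose xs := map h zs.
have hI : is_ideal (adj [set 0] z) by apply: adj_ideal.
have hh x : adj [set 0] z (x - h x).
  by rewrite /h subKr; apply: adj_inM.
have mxs : m = gens [set 0] (z :: xs) by rewrite /= gens_map.
exists xs; split=> //; first by case: hreg => h1 h2; split=> //; apply: reg_map.
have hX := gens_ideal xs h0.
move=> s; split=> [hs|]; last first.
  have hK := rmorph_ker_ideal (p \o f).
  suff : gens [set 0] xs `<=` ring_ker (p \o f) by apply.
  apply: gens_sub => // [_ ->|_ /mapP [x hx ->]]; first exact: ideal0.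
  by apply: hc; rewrite /m mE; apply: gens_in; rewrite ?inE ?hx ?orbT.
apply: contrapT => ns.
have zm : m z by rewrite /m mE; apply: gens_in; rewrite ?mem_head.
have [k [d [hd nd]]] := krull_factor Sn hm hX zm ns.
have [d' hd'] : exists d', d * d' = 1.
  by apply: (local_unit hm); rewrite mxs /= gens_adj.
have hK := rmorph_ker_ideal (p \o f).
have : ring_ker (p \o f) (s - d * z ^+ k).
  suff : gens [set 0] xs `<=` ring_ker (p \o f) by apply.
  apply: gens_sub => // [_ ->|_ /mapP [x hx ->]]; first exact: ideal0.
  by apply: hc; rewrite /m mE; apply: gens_in; rewrite ?inE ?hx ?orbT.
rewrite /ring_ker /= rmorphB rmorphB hs sub0r => /eqP; rewrite oppr_eq0 => /eqP.
rewrite !rmorphM => e.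
have : p (f d) = 0 \/ p (f z) ^+ k = 0.
  by apply: (dvr_mul_eq0 O_dvr); rewrite -e !rmorphXn.
case=> [ed|]; last exact: (dvr_expr_neq0 O_dvr piz_neq0).
have := congr1 (p \o f) hd'; rewrite /= !rmorphM ed mul0r !rmorph1.
by move/esym/eqP; rewrite oner_eq0.
Qed.

Let g : {rmorphism S -> B} := phi \o f.
Let J := ring_ker g.
Let hJ : is_ideal J := rmorph_ker_ideal g.
Let pg s : aug_pi B (g s) = p (f s).
Proof. exact: phi_aug.2. Qed.
Let g_surj : set_surj setT setT g.
Proof.
move=> b _; have [a _ <-] := phi_surj (I : [set: B] b).
by have [s _ <-] := f_surj (I : [set: A] a); exists s.
Qed.
Let Jm : J `<=` m.
Proof.
apply: (local_sub hm) => //; rewrite /J /ring_ker /= !rmorph1 => /eqP.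
by rewrite oner_eq0.
Qed.

(** Avoidance in the coset [z + (xs)], possible because [m = (z, xs)] contains a nonzerodivisor
    modulo [J]. Elements of [(xs)] vanish in [O], so the uniformizer below is unchanged. *)
Let adapted : exists w xs, [/\ m = gens [set 0] (w :: xs), reg [set 0] (w :: xs),
  forall s, p (f s) = 0 <-> gens [set 0] xs s, p (f w) = p (f z) & nzd J w].
Proof.
have [xs [mxs hr hk]] := adjusted.
have [Bn Bl _] := aug_cnl B; have hB := max_ideal_local Bn Bl.
have hX := gens_ideal xs h0.
have xsm : [set` xs] `<=` m.
  by move=> x hx; rewrite mxs; apply: gens_in; rewrite // inE (hx : x \in xs) orbT.
have zm : m z by rewrite mxs; apply: gens_in; rewrite ?mem_head.
have [t ht hnt] : exists2 t, m t & nzd J t.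
  case: B_depth => -[s [hsz hsm [hr1 _]]] _.
  case: s hsz hsm hr1 => // b [] // _ hsm hr1.
  have [t _ hbt] := g_surj (I : [set: B] b); exists t.
    by apply/(surj_local hm hB g_surj); rewrite hbt; apply: hsm; rewrite /= mem_head.
  move=> x hx; have := hr1 0%N isT (g x); rewrite /= !ideal_genE /=; apply.
  by rewrite -hbt -rmorphM.
have [|b hb hnz] := @coset_avoidance _ Sn J (gens [set 0] xs) z t hJ hX _ hnt.
  by rewrite -gens_adj //; rewrite mxs in ht.
have hc : gens [set 0] xs (z - (z + b)).
  by rewrite opprD addrA subrr sub0r; apply: idealN.
have wm : m (z + b).
  apply: idealD => //; apply: (gens_sub mI _ xsm) hb => _ ->; exact: ideal0.
exists (z + b), xs; split=> //.
- by rewrite /= gens_adj // -(adj_congr hX hc) -gens_adj.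
- apply: (reg_consr Sn hm h0 xsm wm); apply/reg_rcons.
  have /reg_rcons [h1 h2] := reg_rconsr Sn hm h0 xsm zm hr.
  by split=> //; apply: nzd_congr h2.
- by have /hk e := hb; rewrite !rmorphD e addr0.
Qed.

Theorem criterion : bijective phi /\ complete_intersection A /\ complete_intersection B.
Proof.
have [w [xs [mxs hr hk ew hnz]]] := adapted.
have piw : max_ideal O = adj [set 0] (p (f w)) by rewrite ew.
have [fs [M [fsz fs0 fsM [n [u [u' [nl hu hdet]]]]]]] :=
  @relation_matrix O A S On Ol p f f_surj xs w hk piw lPhi lPhiP.
have hfs : gens [set 0] fs `<=` ring_ker f.
  apply: gens_sub; first exact: rmorph_ker_ideal.
    by move=> _ ->; apply: ideal0; apply: rmorph_ker_ideal.
  by move=> x /fs0.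
have fJ : ring_ker f `<=` J by move=> s hs; rewrite /J /ring_ker /= hs rmorph0.
have piJ s : J s -> p (f s) = 0 by move=> hs; rewrite -pg hs rmorph0.
have ndet : ~ adj J w (\det M).
  case=> c hc; have := piJ _ hc; rewrite !rmorphB !rmorphM hdet => /eqP.
  rewrite subr_eq0 => /eqP e.
  have hx j : (j < size xs)%N -> J (c * xs`_j).
    move=> hj; apply: hnz.
    have -> : w * (c * xs`_j) = \det M * xs`_j - (\det M - c * w) * xs`_j by ring.
    apply: idealB => //; last exact: ideal_Mr.
    by apply: fJ; apply: hfs; exact: (@det_mul_gens _ xs fs M (Ordinal hj) fsz fsM).
  have heta : submod_set (Defs.eta (aug_pi B)) (p (f c)).
    exists (g c); last exact: pg.
    move=> b hb; have [s _ hs] := g_surj (I : [set: B] b).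
    have /hk hs0 : p (f s) = 0 by rewrite -pg hs.
    rewrite -hs -rmorphM; suff : gens [set 0] xs `<=` [set s | J (c * s)] by apply.
    apply: gens_sub => [|_ ->|x /(nthP 0) [j hj <-]]; last exact: hx.
      apply: is_idealI => [|a d ha hd|a d hd]; rewrite /mkset.
      - by rewrite mulr0; apply: ideal0.
      - by rewrite mulrDr; apply: idealD.
      - by rewrite mulrCA; apply: ideal_Ml.
    by rewrite /mkset mulr0; apply: ideal0.
  have hwn := dvr_nonunit On Ol piw.
  (* For [n = 0] a unit would be a multiple of the uniformizer. Otherwise the uniformizer cancels
     once: its power of exponent one less than the valuation of [det M] lies in [eta_B], which makes
     [O / eta_B] too short. *)
  case: n nl hdet e => [|n] nl hdet e.
    by apply: (hwn (u' * p (f c))); rewrite mulrCA [_ * p (f c)]mulrC -e mulr1 mulrC.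
  have e' : p (f c) = u * p (f w) ^+ n.
    have : p (f w) * (u * p (f w) ^+ n - p (f c)) = 0.
      by rewrite mulrBr [_ * p (f c)]mulrC -e exprS; ring.
    case/(dvr_mul_eq0 O_dvr) => [ew0|/eqP]; first by case: piz_neq0; rewrite -ew.
    by rewrite subr_eq0 => /eqP.
  have hn : submod_set (Defs.eta (aug_pi B)) (p (f w) ^+ n).
    have [s0 sD] := submod_setP (Defs.eta (aug_pi B)).
    have := sD u' _ _ heta s0; rewrite addr0 e'.
    by rewrite -[u' *: _]/(u' * (u * p (f w) ^+ n)) mulrA [u' * u]mulrC hu mul1r.
  have [[ch hch] _] := letaP.
  have := quotient_chain_le On Ol piw hn hch.
  by rewrite leqNgt (leq_trans nl).
have fsJ : [set` fs] `<=` J by move=> x hx; apply: fJ; apply: fs0.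
have [JE fsr] := regular_of_det Sn hm mxs hr hJ Jm hnz fsz fsJ fsM ndet.
have inj : injective phi.
  move=> a b e; have [s _ hs] := f_surj (I : [set: A] (a - b)).
  have : J s by rewrite /J /ring_ker /= hs rmorphB e subrr.
  by rewrite JE => /hfs; rewrite /ring_ker /= hs => /eqP; rewrite subr_eq0 => /eqP.
have fsm : [set` fs] `<=` m by apply: subset_trans Jm.
have Srl : regular_local_ring S.
  case: S_cnl => ? ? _; split=> //; exists (w :: xs); split.
    exact: (reg_krull_dim Sn hm).
  by rewrite ideal_genE.
have fsq := regular_sequenceP hm fsr fsm.
split; [|split].
- have /choice [h hh] : forall b, exists a, phi a = b.
    by move=> b; have [a _ ha] := phi_surj (I : [set: B] b); exists a.
  by exists h => // a; apply: inj; rewrite hh.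
- exists S, f, fs; split=> //; rewrite ideal_genE; apply/seteqP; split=> //.
  by rewrite -JE.
- by exists S, g, fs; split=> //; rewrite ideal_genE -JE.
Qed.

End Criterion.

(** * Complete rings *)

Lemma rmorphism_of (R T : pzRingType) (f : R -> T) : f 1 = 1 ->
  (forall x y, f (x + y) = f x + f y) -> (forall x y, f (x * y) = f x * f y) ->
  exists g : {rmorphism R -> T}, g =1 f.
Proof.
move=> f1 fD fM.
have fB : zmod_morphism f.
  by move=> x y; apply: (addIr (f y)); rewrite -fD !subrK.
have fMM : monoid_morphism f by split.
pose g : {rmorphism R -> T} := HB.pack f
  (GRing.isZmodMorphism.Build R T f fB) (GRing.isMonoidMorphism.Build R T f fMM).
by exists g.
Qed.

Section CompleteNoetherian.
Variables (R : comNzRingType) (m : set R) (zs : seq R).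
Hypotheses (hm : local_at m) (mE : m = gens [set 0] zs) (hc : adic_complete m).
Implicit Types (I : set R) (s t : seq R).

Let fg I := exists s, I = gens [set 0] s.

Let h0 := @ideal_zero R.

Lemma gens0_sub I s : is_ideal I -> (forall x, x \in s -> I x) -> gens [set 0] s `<=` I.
Proof. by move=> hI; apply: gens_sub => // _ ->; apply: ideal0. Qed.

Lemma seq_bound (F : nat -> set R) s : (forall n, F n `<=` F n.+1) ->
  (forall x, x \in s -> exists n, F n x) -> exists n, forall x, x \in s -> F n x.
Proof.
move=> FS; have Fle i j : (i <= j)%N -> F i `<=` F j.
  by move/subnK <-; elim: (j - i)%N => // k IH x /IH /FS.
elim: s => [|a s IH] h; first by exists 0%N.
have [n hn] : exists n, forall x, x \in s -> F n x.
  by apply: IH => x hx; apply: h; rewrite inE hx orbT.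
have [k hk] := h a (mem_head _ _).
exists (maxn n k) => x; rewrite inE => /orP[/eqP->|hx].
  by apply: Fle hk; apply: leq_maxr.
by apply: Fle (hn _ hx); apply: leq_maxl.
Qed.

Section Step.
Variables (z : R) (t : seq R) (I : set R).
Hypotheses (hz : m z) (hI : is_ideal I) (tI : [set` t] `<=` I).
Hypothesis IH : forall J, is_ideal J -> [set` z :: t] `<=` J -> fg J.

Let Ic j := colon I (z ^+ j).

Let IcI j : is_ideal (Ic j). Proof. exact: colon_ideal. Qed.

Let IcS j : Ic j `<=` Ic j.+1.
Proof. by move=> x hx; rewrite /Ic /colon /= exprS mulrCA; apply: ideal_Ml. Qed.

Let Icle i j : (i <= j)%N -> Ic i `<=` Ic j.
Proof. by move/subnK <-; elim: (j - i)%N => // k IHk x /IHk /IcS. Qed.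

Let Ic0 x : Ic 0 x <-> I x. Proof. by rewrite /Ic /colon /= mulr1. Qed.

Let adj_fg j : fg (adj (Ic j) z).
Proof.
apply: IH; first exact: adj_ideal.
move=> x; rewrite /= inE => /orP[/eqP->|hx]; first exact: adj_in.
by apply: sub_adj; apply: (Icle (leq0n j)); apply/Ic0; apply: tI.
Qed.

Let stable : exists n, forall j, adj (Ic j) z `<=` adj (Ic n) z.
Proof.
pose F j := adj (Ic j) z.
have FS j : F j `<=` F j.+1 by apply: adjS.
have [||s hs] := IH (J := [set x | exists j, F j x]).
- by apply: bigcup_chain_ideal => // j; apply: adj_ideal.
- move=> x; rewrite /= inE => /orP[/eqP->|hx]; first by exists 0%N; apply: adj_in.
  by exists 0%N; apply: sub_adj; apply/Ic0; apply: tI.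
have [x hx|n hn] := seq_bound (s := s) FS.
  have : gens [set 0] s x by apply: gens_in.
  by rewrite -hs.
exists n => j x hx; have : gens [set 0] s x by rewrite -hs; exists j.
by apply: gens0_sub => //; apply: adj_ideal.
Qed.

Let gensets : exists G : nat -> seq R, forall j,
  (forall x, x \in G j -> Ic j x) /\ adj (Ic j) z `<=` gens (adj [set 0] z) (G j).
Proof.
suff /choice [G hG] : forall j, exists G : seq R,
    (forall x, x \in G -> Ic j x) /\ adj (Ic j) z `<=` gens (adj [set 0] z) G.
  by exists G.
move=> j; have [s hs] := adj_fg j.
have /choice [c hcs] : forall x, exists c, adj (Ic j) z x -> Ic j (x - c * z).
  move=> x; have [[c hx]|nx] := pselect (adj (Ic j) z x); first by exists c.
  by exists 0.
exists [seq x - c x * z | x <- s]; split.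
  by move=> _ /mapP [x hx ->]; apply: hcs; rewrite hs; apply: gens_in.
have hA := adj_ideal z h0.
rewrite hs; apply: gens0_sub => [|x hx]; first exact: gens_ideal.
rewrite -[x](subrK (c x * z)); apply: idealD; first exact: gens_ideal.
  by apply: gens_in => //; apply/mapP; exists x.
by apply: sub_gens; apply: adj_inM.
Qed.

(** A power series form of Hilbert's basis theorem with [z] as the variable. The ideals [I : z^j]
    act as leading coefficient ideals, and stabilize modulo [z] at some [N]. An element of [I] is
    divided by [z] repeatedly, the remainders being combinations of the [G j]. *)
Lemma fg_step : fg I.
Proof.
have [N hN] := stable; have [G hG] := gensets.
pose L := flatten [seq [seq z ^+ j * g | g <- G j] | j <- iota 0 N.+1].
have hL := gens_ideal L h0.
have LG j g : (j <= N)%N -> g \in G j -> gens [set 0] L (z ^+ j * g).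
  move=> hj hg; apply: gens_in => //; apply/flatten_mapP; exists j.
    by rewrite mem_iota.
  by apply/mapP; exists g.
have Lg j a : (j <= N)%N -> gens [set 0] (G j) a -> gens [set 0] L (z ^+ j * a).
  move=> hj; suff : gens [set 0] (G j) `<=` [set a | gens [set 0] L (z ^+ j * a)] by apply.
  apply: gens0_sub => [|g hg]; last exact: LG.
  apply: is_idealI => [|x y hx hy|b x hx]; rewrite /mkset.
  - by rewrite mulr0; apply: ideal0.
  - by rewrite mulrDr; apply: idealD.
  - by rewrite mulrCA; apply: ideal_Ml.
have step j k q : (k <= j)%N -> adj (Ic j) z `<=` adj (Ic k) z -> Ic j q ->
    exists q', Ic j.+1 q' /\ gens [set 0] (G k) (q - z * q').
  move=> kj hjk hq.
  have := (hG k).2 _ (hjk _ (sub_adj z hq)); rewrite gens_adj // => -[q' hq'].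
  exists q'; split; last by rewrite [z * q']mulrC.
  have : Ic j (q - q' * z).
    by apply: gens0_sub hq' => // g /(hG k).1; apply: Icle.
  move=> h; have : Ic j (q' * z) by apply: idealBr hq => //; rewrite -opprB opprK.
  by rewrite /Ic /colon /= exprS mulrA.
exists L; apply/seteqP; split; last first.
  apply: gens0_sub => // _ /flatten_mapP [j hj] /mapP [g hg ->].
  by have := (hG j).1 _ hg; rewrite /Ic /colon /= mulrC.
move=> q hq.
have [qN hqN hLq] : exists2 qN, Ic N qN & gens [set 0] L (q - z ^+ N * qN).
  have : forall j, (j <= N)%N -> exists2 qj, Ic j qj & gens [set 0] L (q - z ^+ j * qj).
    elim=> [|j IHj] hj.
      by exists q; [apply/Ic0|rewrite mul1r subrr; apply: ideal0].
    have [qj hqj hLj] := IHj (ltnW hj).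
    have [q' [hq' hg]] := step j j qj (leqnn j) (fun _ => id) hqj.
    exists q' => //; rewrite exprSr.
    have -> : q - z ^+ j * z * q' = (q - z ^+ j * qj) + z ^+ j * (qj - z * q') by ring.
    by apply: idealD => //; apply: Lg => //; apply: ltnW.
  by move/(_ N (leqnn N)).
(* From [N] on the same generators serve at every step, so their coefficients add up to series in
   [z], which converge by completeness. *)
suff hh : gens [set 0] (G N) qN.
  by rewrite -[q](subrK (z ^+ N * qN)); apply: idealD => //; apply: Lg.
have /choice [nx hnx] : forall x : nat * R, exists q', Ic (N + x.1) x.2 ->
    Ic (N + x.1).+1 q' /\ gens [set 0] (G N) (x.2 - z * q').
  move=> [j x] /=; have [hx|nx] := pselect (Ic (N + j) x); last by exists 0.
  by have [q' hq'] := step (N + j)%N N x (leq_addr _ _) (hN _) hx; exists q'.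
pose xx := fix xx j := if j is j'.+1 then nx (j', xx j') else qN.
have hxx j : Ic (N + j) (xx j).
  elim: j => [|j IHj]; first by rewrite addn0.
  by rewrite addnS; have [] := hnx (j, xx j) IHj.
have /choice [c hcc] : forall j, exists c : nat -> R,
    xx j - z * xx j.+1 = \sum_(i < size (G N)) c i * (G N)`_i.
  move=> j; have [_ /(gensP _ _ h0) [c /eqP]] := hnx (j, xx j) (hxx j).
  by rewrite subr_eq0 => /eqP e; exists c.
pose u i J := \sum_(j < J) c j i * z ^+ j.
have hu J : qN - \sum_(i < size (G N)) u i J * (G N)`_i = z ^+ J * xx J.
  elim: J => [|J IHJ].
    rewrite big1 ?subr0 ?mul1r // => i _; by rewrite /u big_ord0 mul0r.
  have -> : \sum_(i < size (G N)) u i J.+1 * (G N)`_i =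
    \sum_(i < size (G N)) u i J * (G N)`_i + z ^+ J * (xx J - z * xx J.+1).
    rewrite hcc big_distrr -big_split; apply: eq_bigr => i _ /=.
    by rewrite /u big_ord_recr /=; ring.
  by rewrite opprD addrA IHJ exprSr; ring.
have /choice [l hl] : forall i, exists l, forall J, ideal_exp m J (l - u i J).
  move=> i; have [_ hlim] := hc; apply: hlim => J.
  rewrite /u big_ord_recr /= [X in X - _]addrC addrK.
  by apply: ideal_Ml; [exact: ideal_exp_ideal|exact: ideal_expX].
apply/gensP => //; exists l; apply: (hc.1) => J.
have hE := @ideal_exp_ideal _ m J.
have -> : qN - \sum_(i < size (G N)) l i * (G N)`_i =
  z ^+ J * xx J - \sum_(i < size (G N)) (l i - u i J) * (G N)`_i.
  rewrite -hu -addrA -opprD -big_split; congr (_ - _); apply: eq_bigr => i _ /=.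
  by rewrite mulrBl addrC subrK.
apply: idealB => //.
  by apply: ideal_Mr => //; apply: ideal_expX.
by apply: ideal_sum => // i _; apply: ideal_Mr.
Qed.

End Step.

Theorem complete_noetherian : noetherian R.
Proof.
suff h : forall s t, zs = s ++ t -> forall I, is_ideal I -> [set` t] `<=` I -> fg I.
  move=> I hI; have [|s sE] := h zs [::] (esym (cats0 _)) I hI; first by [].
  by exists s; rewrite ideal_genE.
elim/last_ind => [|s z IH] t hst I hI htI.
  have [I1|I1] := pselect (I 1).
    exists [:: 1]; apply/seteqP; split=> x hx; last first.
      by rewrite -[x]mulr1; apply: ideal_Ml.
    by rewrite -[x]mulr1; apply: adj_inM.
  exists zs; apply/seteqP; split.
    by rewrite -mE; apply: (local_sub hm).
  by apply: gens0_sub => //; rewrite hst.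
apply: (@fg_step z t) => //.
  by rewrite mE; apply: gens_in; rewrite // hst mem_cat mem_rcons mem_head.
by apply: IH; rewrite hst cat_rcons.
Qed.

End CompleteNoetherian.

(** * Completion of a filtered ring *)

(** Separatedness is not demanded: elements lying in every step die in the completion. In residue
    characteristic [p] this is how the variables [X_a] get identified with the [g_a]. *)
Record filtration (T : comNzRingType) := Filtration {
  filt :> nat -> set T;
  filt_ideal : forall n, is_ideal (filt n);
  filt0 : filt 0 = setT;
  filtS : forall n, filt n.+1 `<=` filt n;
  filtM : forall i j x y, filt i x -> filt j y -> filt (i + j) (x * y);
  filt_proper : ~ filt 1 1 }.

Lemma filt_le (T : comNzRingType) (F : filtration T) i j : (i <= j)%N -> F j `<=` F i.
Proof. by move/subnK <-; elim: (j - i)%N => // k IH x /(@filtS _ F) /IH. Qed.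

Section Cauchy.
Variables (T : comNzRingType) (F : filtration T).

(** Only fast Cauchy sequences are kept, so that the [n]-th term already determines the class modulo
    the [n]-th step. *)
Definition cauchy_pred : {pred (nat -> T)} :=
  fun u => `[< forall n, F n (u n.+1 - u n) >].

Fact cauchy_subring : subring_closed cauchy_pred.
Proof.
have FI n := filt_ideal F n.
split.
- by apply/asboolP => n; rewrite subrr; apply: ideal0.
- move=> u v /asboolP hu /asboolP hv; apply/asboolP => n.
  have -> : (u - v) n.+1 - (u - v) n = (u n.+1 - u n) - (v n.+1 - v n).
    by rewrite -[(u - v) n.+1]/(u n.+1 - v n.+1) -[(u - v) n]/(u n - v n); ring.
  exact: idealB.
- move=> u v /asboolP hu /asboolP hv; apply/asboolP => n.
  have -> : (u * v) n.+1 - (u * v) n =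
      (u n.+1 - u n) * v n.+1 + u n * (v n.+1 - v n).
    by rewrite -[(u * v) n.+1]/(u n.+1 * v n.+1) -[(u * v) n]/(u n * v n); ring.
  by apply: idealD => //; [apply: ideal_Mr|apply: ideal_Ml].
Qed.
HB.instance Definition _ := GRing.isSubringClosed.Build (nat -> T) cauchy_pred
  cauchy_subring.

Record cauchy := Cauchy {
  cauchy_val :> nat -> T; cauchy_valP : cauchy_val \in cauchy_pred }.
HB.instance Definition _ := [isSub for cauchy_val].
HB.instance Definition _ := [Choice of cauchy by <:].
HB.instance Definition _ := [SubChoice_isSubComNzRing of cauchy by <:].

Lemma cauchyP (u : cauchy) n : F n (u n.+1 - u n).
Proof. by have /asboolP := cauchy_valP u; apply. Qed.

Lemma cauchy_le (u : cauchy) n k : (n <= k)%N -> F n (u k - u n).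
Proof.
move/subnK <-; elim: (k - n)%N => [|j IH].
  by rewrite subrr; apply: ideal0; apply: filt_ideal.
rewrite addSn -[u _.+1](subrK (u (j + n)%N)) -addrA; apply: idealD => //.
  exact: filt_ideal.
by apply: (filt_le (leq_addl j n)); apply: cauchyP.
Qed.

Definition null_pred : {pred cauchy} := fun u => `[< forall n, F n (u n) >].

Fact null_idealr : idealr_closed null_pred.
Proof.
have FI n := filt_ideal F n.
split.
- by apply/asboolP => n; apply: ideal0.
- by apply/negP => /asboolP /(_ 1%N); apply: filt_proper.
- move=> a u v /asboolP hu /asboolP hv; apply/asboolP => n.
  by apply: idealD => //; apply: ideal_Ml.
Qed.
HB.instance Definition _ := isIdealr.Build cauchy null_pred null_idealr.

Definition completion := {ideal_quot null_pred}.
HB.instance Definition _ := GRing.ComNzRing.on completion.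
HB.instance Definition _ := Quotient.on completion.

Definition compl_pi (u : cauchy) : completion := \pi_(completion) u.

Lemma compl_piE u v : compl_pi u = compl_pi v <-> forall n, F n (u n - v n).
Proof.
rewrite /compl_pi; split=> [/eqP|h].
  by rewrite -Quotient.idealrBE => /asboolP.
by apply/eqP; rewrite -Quotient.idealrBE; apply/asboolP.
Qed.

Lemma compl_piD u v : compl_pi (u + v) = compl_pi u + compl_pi v.
Proof. exact: rmorphD. Qed.

Lemma compl_piM u v : compl_pi (u * v) = compl_pi u * compl_pi v.
Proof. exact: rmorphM. Qed.

End Cauchy.

Record is_completion (T : comNzRingType) (F : filtration T) (R : comNzRingType)
    (i : {rmorphism T -> R}) (G : filtration R) : Prop := IsCompletion {
  compl_filt : forall n t, G n (i t) <-> F n t;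
  compl_dense : forall s n, exists t, G n (s - i t);
  compl_hausdorff : forall s, (forall n, G n s) -> s = 0;
  compl_lim : forall u : nat -> R, (forall n, G n (u n.+1 - u n)) ->
    exists l, forall n, G n (l - u n) }.

Section CompletionExists.
Variables (T : comNzRingType) (F : filtration T).
Let S := completion F.
Let FI n := filt_ideal F n.

Let surj (s : S) : exists u, s = compl_pi u.
Proof. by exists (repr s); rewrite /compl_pi reprK. Qed.

Fact const_cauchy (t : T) : (fun _ : nat => t) \in cauchy_pred F.
Proof. by apply/asboolP => n; rewrite subrr; apply: ideal0. Qed.

Let cst t := compl_pi (Cauchy (const_cauchy t)).

Let B n : set S := [set s | exists2 u, s = compl_pi u & F n (u n)].

Let BE n u : B n (compl_pi u) <-> F n (u n).
Proof.
split=> [[v /compl_piE /(_ n) h hv]|]; last by exists u.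
by rewrite -[u n](subrK (v n)); apply: idealD.
Qed.

Let piN u : compl_pi (- u) = - compl_pi u :> S.
Proof. exact: rmorphN. Qed.

Let pi0 : compl_pi 0 = 0 :> S.
Proof. exact: rmorph0. Qed.

Let pi1 : compl_pi 1 = 1 :> S.
Proof. exact: rmorph1. Qed.

Let BI n : is_ideal (B n).
Proof.
apply: is_idealI.
- by rewrite -pi0; apply/BE; apply: ideal0.
- move=> x y; have [u ->] := surj x; have [v ->] := surj y.
  by rewrite -compl_piD => /BE hu /BE hv; apply/BE; apply: idealD.
- move=> x y; have [u ->] := surj x; have [v ->] := surj y.
  by rewrite -compl_piM => /BE hu; apply/BE; apply: ideal_Ml.
Qed.

Lemma completion_exists : exists (R : comNzRingType) (i : {rmorphism T -> R})
  (G : filtration R), is_completion F i G.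
Proof.
have [||| i hi] := @rmorphism_of T S cst.
- by rewrite -pi1; apply/compl_piE => n; rewrite subrr; apply: ideal0.
- move=> x y; rewrite /cst -compl_piD; apply/compl_piE => n.
  by rewrite subrr; apply: ideal0.
- move=> x y; rewrite /cst -compl_piM; apply/compl_piE => n.
  by rewrite subrr; apply: ideal0.
have B0 : B 0 = setT.
  apply/seteqP; split=> // s _; have [u ->] := surj s.
  by apply/BE; rewrite filt0.
have BS n : B n.+1 `<=` B n.
  move=> s; have [u ->] := surj s; move=> /BE h; apply/BE.
  rewrite -[u n](subKr (u n.+1)); apply: idealB => //; last exact: cauchyP.
  exact: filtS.
have BM k j x y : B k x -> B j y -> B (k + j) (x * y).
  have [u ->] := surj x; have [v ->] := surj y => /BE hu /BE hv.
  rewrite -compl_piM; apply/BE; rewrite -[(u * v) _]/(u (k + j)%N * v (k + j)%N).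
  apply: filtM.
    rewrite -[u _](subrK (u k)); apply: idealD => //.
    by apply: cauchy_le; apply: leq_addr.
  rewrite -[v _](subrK (v j)); apply: idealD => //.
  by apply: cauchy_le; apply: leq_addl.
have B1 : ~ B 1 1.
  have -> : 1 = i 1 by rewrite rmorph1.
  by rewrite hi => /BE; apply: filt_proper.
exists S, i, (Filtration BI B0 BS BM B1).
have dense s n : exists t, B n (s - i t).
  have [u ->] := surj s; exists (u n); rewrite hi /cst -piN -compl_piD; apply/BE.
  by change (F n (u n - u n)); rewrite subrr; apply: ideal0.
have filtE n t : B n (i t) <-> F n t by rewrite hi; exact: BE.
split=> //.
- move=> s; have [u ->] := surj s => h; rewrite -pi0; apply/compl_piE => n.
  by rewrite subr0; apply/BE; apply: h.
- move=> s hs; have /choice [t ht] : forall n, exists t, B n (s n - i t).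
    by move=> n; apply: dense.
  have tP : t \in cauchy_pred F.
    apply/asboolP => n; apply/filtE; rewrite rmorphB.
    have -> : i (t n.+1) - i (t n) = (s n.+1 - s n) - (s n.+1 - i (t n.+1))
      + (s n - i (t n)) by ring.
    apply: idealD => //; apply: idealB => //; first exact: (hs n).
    exact (BS _ _ (ht n.+1)).
  exists (compl_pi (Cauchy tP)) => n /=.
  have -> : compl_pi (Cauchy tP) - s n =
    (compl_pi (Cauchy tP) - i (t n)) - (s n - i (t n)) by ring.
  apply: idealB => //; rewrite hi /cst -piN -compl_piD; apply/BE.
  by change (F n (t n - t n)); rewrite subrr; apply: ideal0.
Qed.

End CompletionExists.

Section Extend.
Variables (T R A : comNzRingType) (F : filtration T) (i : {rmorphism T -> R})
  (G : filtration R) (hG : is_completion F i G).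
Variables (mA : set A) (hA : adic_complete mA) (e : {rmorphism T -> A}).
Hypothesis eF : forall n t, F n t -> ideal_exp mA n (e t).

Let EI n := @ideal_exp_ideal A mA n.
Let GI n := filt_ideal G n.

Lemma extend_completion : exists g : {rmorphism R -> A},
  (forall t, g (i t) = e t) /\ (forall n s, G n s -> ideal_exp mA n (g s)).
Proof.
have /choice [g hg] : forall s, exists a, forall n t, G n (s - i t) ->
    ideal_exp mA n (a - e t).
  move=> s; have /choice [t ht] := compl_dense hG s.
  have hij n j x y : (n <= j)%N -> G n (s - i x) -> G j (s - i y) ->
      ideal_exp mA n (e y - e x).
    move=> nj hx hy; rewrite -rmorphB; apply: eF; apply/(compl_filt hG).
    have -> : i (y - x) = (s - i x) - (s - i y) by rewrite rmorphB; ring.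
    by apply: idealB => //; apply: filt_le nj _ hy.
  have [|a ha] := hA.2 (fun n => e (t n)).
    by move=> n; apply: (hij n n.+1).
  exists a => n x hx; have -> : a - e x = (a - e (t n)) + (e (t n) - e x) by ring.
  by apply: idealD => //; apply: (hij n n).
have haus a b : (forall n, ideal_exp mA n (a - b)) -> a = b.
  by move=> h; apply/eqP; rewrite -subr_eq0; apply/eqP; apply: hA.1.
have [|x y|x y|g' hg'] := @rmorphism_of R A g.
- apply: haus => n; rewrite -(rmorph1 e); apply: hg.
  by rewrite rmorph1 subrr; apply: ideal0.
- apply: haus => n; have [t ht] := compl_dense hG x n; have [t' ht'] := compl_dense hG y n.
  have -> : g (x + y) - (g x + g y) = (g (x + y) - e (t + t'))
    - (g x - e t) - (g y - e t') by rewrite rmorphD; ring.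
  have h : G n (x + y - i (t + t')).
    have -> : x + y - i (t + t') = (x - i t) + (y - i t') by rewrite rmorphD; ring.
    exact: idealD.
  apply: idealB => //; last exact: hg.
  by apply: idealB => //; apply: hg.
- apply: haus => n; have [t ht] := compl_dense hG x n; have [t' ht'] := compl_dense hG y n.
  have -> : g (x * y) - g x * g y = (g (x * y) - e (t * t'))
    - (g x - e t) * g y - e t * (g y - e t') by rewrite rmorphM; ring.
  have h : G n (x * y - i (t * t')).
    have -> : x * y - i (t * t') = (x - i t) * y + i t * (y - i t').
      by rewrite rmorphM; ring.
    by apply: idealD => //; [apply: ideal_Mr|apply: ideal_Ml].
  apply: idealB => //; last by apply: ideal_Ml => //; apply: hg.
  by apply: idealB => //; [apply: hg|apply: ideal_Mr => //; apply: hg].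
exists g'; split=> [t|n s hs]; rewrite hg'.
- apply: haus => n; apply: hg; rewrite subrr; exact: ideal0.
- by rewrite -[g s]subr0 -(rmorph0 e); apply: hg; rewrite rmorph0 subr0.
Qed.

End Extend.

(** * Presentations by regular rings *)

(* A filtered ring whose completion, when the images of [zs] generate the maximal
   ideal of [A], is regular local with parameters [zs] and maps onto [A]:
   [pres_reg] is the form in which the regularity of [zs] survives completion. *)
Record presentation (A T : comNzRingType) (F : filtration T)
    (e : {rmorphism T -> A}) (zs : seq T) : Prop := Presentation {
  pres_mem : forall z, z \in zs -> F 1 z;
  pres_gen : forall n x, F n.+1 x -> exists c : nat -> T,
    (forall i, F n (c i)) /\ F n.+2 (x - \sum_(i < size zs) c i * zs`_i);
  pres_unit : forall x, ~ F 1 x -> exists y, F 1 (x * y - 1);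
  pres_map : forall n t, F n t -> ideal_exp (max_ideal A) n (e t);
  pres_surj : forall a, exists t, max_ideal A (a - e t);
  pres_reg : forall i n x, (i < size zs)%N ->
    addI (gens [set 0] (take i zs)) (F n.+1) (zs`_i * x) ->
    addI (gens [set 0] (take i zs)) (F n) x }.

Lemma reg_of_nth (R : comNzRingType) (I : set R) s :
  (forall i, (i < size s)%N -> nzd (gens I (take i s)) s`_i) -> reg I s.
Proof.
elim: s I => //= a s IH I h; split; first exact: (h 0%N isT).
by apply: IH => i hi; apply: (h i.+1).
Qed.

Section RegularCompletion.
Variables (A T : comNzRingType) (F : filtration T) (e : {rmorphism T -> A}).
Variable (zs : seq T).
Hypotheses (A_cnl : complete_noetherian_local A) (hp : presentation F e zs).
Hypothesis mAE : max_ideal A = gens [set 0] (map e zs).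

Let mA := max_ideal A.
Let An : noetherian A. Proof. by case: A_cnl. Qed.
Let Al : local_at mA. Proof. by case: A_cnl => ? ? _; apply: max_ideal_local. Qed.
Let Ac : adic_complete mA. Proof. by case: A_cnl. Qed.
Let EI n := @ideal_exp_ideal A mA n.

Variables (S : comNzRingType) (i : {rmorphism T -> S}) (G : filtration S).
Hypothesis hG : is_completion F i G.
Let GI n := filt_ideal G n.
Let zs' := map i zs.
Let sz : size zs' = size zs. Proof. exact: size_map. Qed.
Let nth_zs' j : (j < size zs)%N -> zs'`_j = i zs`_j.
Proof. by move=> hj; rewrite (nth_map 0). Qed.
Let h0 := @ideal_zero S.

Let Gz j : (j < size zs)%N -> G 1 zs'`_j.
Proof.
move=> hj; rewrite nth_zs' //; apply/(compl_filt hG); apply: (pres_mem hp).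
exact: mem_nth.
Qed.

Let gen_step n s : G n.+1 s -> exists c : nat -> S,
  (forall j, G n (c j)) /\ G n.+2 (s - \sum_(j < size zs) c j * zs'`_j).
Proof.
move=> hs; have [t ht] := compl_dense hG s n.+2.
have hFt : F n.+1 t.
  apply/(compl_filt hG); apply: (idealBr (GI n.+1) _ hs).
  exact: (filtS ht).
have [c [hc1 hc2]] := pres_gen hp hFt.
exists (fun j => i (c j)); split=> [j|]; first exact/(compl_filt hG).
move/(compl_filt hG): hc2; rewrite rmorphB rmorph_sum => hc2.
have -> : s - \sum_(j < size zs) i (c j) * zs'`_j =
  (s - i t) + (i t - \sum_(j < size zs) i (c j * zs`_j)).
  rewrite addrA subrK; congr (_ - _); apply: eq_bigr => j _.
  by rewrite rmorphM nth_zs'.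
exact: idealD.
Qed.

Let sum_shift (u : nat -> S) n J : (forall k, G (n + k) (u k)) ->
  G n (\sum_(k < J) u k).
Proof.
move=> hu; apply: ideal_sum => // k _; apply: filt_le (hu k); exact: leq_addr.
Qed.

(** Iterating [gen_step] and summing the coefficients removes the error term, since the corrections
    climb in the filtration. It follows that [G] is the filtration by the powers of [G 1]. *)
Let gen_comb n s : G n.+1 s -> exists c : nat -> S,
  (forall j, G n (c j)) /\ s = \sum_(j < size zs) c j * zs'`_j.
Proof.
move=> hs.
have /choice [nx hnx] : forall x : nat * S, exists c : nat -> S, G (n + x.1).+1 x.2 ->
    (forall j, G (n + x.1) (c j)) /\
    G (n + x.1).+2 (x.2 - \sum_(j < size zs) c j * zs'`_j).
  move=> [k x] /=; have [hx|nx] := pselect (G (n + k).+1 x); last by exists (fun _ => 0).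
  by have [c hc] := gen_step hx; exists c.
pose xx := fix xx k := if k is k'.+1 then
  xx k' - \sum_(j < size zs) nx (k', xx k') j * zs'`_j else s.
have hxx k : G (n + k).+1 (xx k).
  elim: k => [|k IHk]; first by rewrite addn0.
  by rewrite addnS; have [] := hnx (k, xx k) IHk.
pose c k j := nx (k, xx k) j.
have hc k j : G (n + k) (c k j) by have [h _] := hnx (k, xx k) (hxx k); apply: h.
pose u j K := \sum_(k < K) c k j.
have hu j K : G n (u j K) by apply: (sum_shift (u := fun k => c k j)) => k; exact: (hc k j).
have /choice [l hl] : forall j, exists l, forall K, G K (l - u j K).
  move=> j; apply: (compl_lim hG) => K.
  rewrite /u big_ord_recr /= [X in X - _]addrC addrK.
  by apply: filt_le (hc K j); apply: leq_addl.
exists l; split=> [j|].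
  by rewrite -[l j](subrK (u j n)); apply: idealD.
have hs' K : s - \sum_(j < size zs) u j K * zs'`_j = xx K.
  elim: K => [|K IHK].
    by rewrite big1 ?subr0 // => j _; rewrite /u big_ord0 mul0r.
  have -> : xx K.+1 = xx K - \sum_(j < size zs) c K j * zs'`_j by [].
  rewrite -IHK -addrA -opprD; congr (_ - _); rewrite -big_split.
  by apply: eq_bigr => j _; rewrite /u big_ord_recr mulrDl.
apply/eqP; rewrite -subr_eq0; apply/eqP; apply: (compl_hausdorff hG) => K.
have -> : s - \sum_(j < size zs) l j * zs'`_j =
  xx K - \sum_(j < size zs) (l j - u j K) * zs'`_j.
  rewrite -hs' -addrA -opprD -big_split; congr (_ - _); apply: eq_bigr => j _ /=.
  by rewrite mulrBl addrC subrK.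
apply: idealB => //; first by apply: filt_le (hxx K); rewrite leqW // leq_addl.
by apply: ideal_sum => // j _; apply: ideal_Mr.
Qed.

Let G1E : G 1 = gens [set 0] zs'.
Proof.
apply/seteqP; split=> s.
  move=> /gen_comb [c [_ ->]]; apply: ideal_sum => [|j _]; first exact: gens_ideal.
  apply: ideal_Ml; first exact: gens_ideal.
  by apply: gens_in => //; apply: mem_nth; rewrite sz.
move: s; apply: gens0_sub => // x /(nthP 0) [j hj <-].
by apply: Gz; rewrite -sz.
Qed.

Let GE n : ideal_exp (G 1) n = G n.
Proof.
apply/seteqP; split; elim: n => [|n IH]; rewrite ?filt0 //.
  apply: ideal_mul_sub => // x y hx /IH hy; exact: (filtM hx hy).
move=> s /gen_comb [c [hc ->]]; apply: ideal_sum => [|j _]; first exact: ideal_exp_ideal.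
by rewrite mulrC; apply: ideal_expM; [apply: Gz|apply: IH].
Qed.

Let Gloc : local_at (G 1).
Proof.
split=> //; first exact: filt_proper.
move=> s hs; have [t ht] := compl_dense hG s 1.
have [|y hy] := pres_unit hp (x := t).
  by move=> /(compl_filt hG) hFt; apply: hs; apply: (idealBl (GI 1) ht).
(* [i y] inverts [s] modulo [G 1]; the geometric series of the error [x] turns it into a true
   inverse. *)
pose x := 1 - s * i y.
have hx : G 1 x.
  move/(compl_filt hG): hy; rewrite rmorphB rmorphM rmorph1 => hy.
  have -> : x = - ((s - i t) * i y + (i t * i y - 1)) by rewrite /x; ring.
  by apply: idealN => //; apply: idealD => //; apply: ideal_Mr.
have hxn n : G n (x ^+ n) by rewrite -GE; apply: ideal_expX.
pose u n := \sum_(k < n) x ^+ k.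
have [l hl] := compl_lim hG (u := u) (fun n => ltac:(
  rewrite /u big_ord_recr /= [X in X - _]addrC addrK; exact: hxn)).
exists (i y * l); apply/eqP; rewrite -subr_eq0; apply/eqP.
apply: (compl_hausdorff hG) => n.
have hun : (1 - x) * u n = 1 - x ^+ n.
  by rewrite /u -[1 - x]opprB mulNr -subrX1 opprB.
have -> : s * (i y * l) - 1 = (1 - x) * (l - u n) + ((1 - x) * u n - 1).
  by rewrite /x; ring.
rewrite hun; apply: idealD => //; first exact: ideal_Ml.
by rewrite addrC addKr; apply: idealN.
Qed.

Let Smax : max_ideal S = G 1.
Proof. exact: local_at_max. Qed.

Let Scomp : adic_complete (G 1).
Proof.
split=> [x hx|u hu].
  by apply: (compl_hausdorff hG) => n; rewrite -GE.
have [|l hl] := compl_lim hG (u := u); first by move=> n; rewrite -GE.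
by exists l => n; rewrite GE.
Qed.

Let Sn : noetherian S.
Proof. exact: (complete_noetherian Gloc G1E Scomp). Qed.

(** A relation in [S] is approximated by relations in [T] modulo each step of the filtration, where
    [pres_reg] applies with the loss of one step; Krull's intersection theorem in the noetherian
    ring [S] removes the error. *)
Let Sreg : reg [set 0] zs'.
Proof.
apply: reg_of_nth => j; rewrite sz => hj s hs.
have hgj := gens_ideal (take j zs') h0.
apply: (krull_intersection Sn Gloc hgj) => n; rewrite GE.
have [t ht] := compl_dense hG s n.+1.
have [c /eqP] := (gensP _ _ h0).1 hs; rewrite subr_eq0 => /eqP hc.
have /choice [d hd] : forall k, exists d, G n.+1 (c k - i d).
  by move=> k; apply: (compl_dense hG).
have htake k : (k < j)%N -> (take j zs')`_k = i (take j zs)`_k.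
  by move=> hk; rewrite !nth_take // nth_zs' // (ltn_trans hk).
have szt : size (take j zs') = j by rewrite size_takel // sz ltnW.
have szt' : size (take j zs) = j by rewrite size_takel // ltnW.
have [x hx hxt] : addI (gens [set 0] (take j zs)) (F n) t.
  apply: (pres_reg hp) => //.
  exists (\sum_(k < j) d k * (take j zs)`_k).
    apply: ideal_sum => [|k _]; first exact: gens_ideal (@ideal_zero T).
    apply: ideal_Ml; first exact: gens_ideal (@ideal_zero T).
    by apply: gens_in; [exact: ideal_zero|apply: mem_nth; rewrite szt'].
  apply/(compl_filt hG); rewrite rmorphB rmorphM -nth_zs' //.
  have -> : zs'`_j * i t - i (\sum_(k < j) d k * (take j zs)`_k) =
    - (zs'`_j * (s - i t)) + (zs'`_j * s - i (\sum_(k < j) d k * (take j zs)`_k)) by ring.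
  apply: idealD => //; first by apply: idealN => //; apply: ideal_Ml.
  rewrite hc szt rmorph_sum -sumrB; apply: ideal_sum => // k _.
  rewrite rmorphM -htake // -mulrBl; exact: ideal_Mr.
have hgi y : gens [set 0] (take j zs) y -> gens [set 0] (take j zs') (i y).
  move=> /(gensP _ _ (@ideal_zero T)) [b /eqP]; rewrite subr_eq0 => /eqP ->.
  rewrite rmorph_sum; apply: ideal_sum => // k _; rewrite rmorphM.
  apply: ideal_Ml => //; apply: gens_in => //.
  have hk : (k < j)%N by apply: leq_trans (ltn_ord k) _; rewrite szt'.
  by rewrite -htake //; apply: mem_nth; rewrite szt.
exists (i x); first exact: hgi.
have -> : s - i x = (s - i t) + i (t - x) by rewrite rmorphB; ring.
apply: idealD => //; first by apply: filtS.
exact/(compl_filt hG).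
Qed.

Theorem regular_completion : exists f : {rmorphism S -> A},
  [/\ complete_noetherian_local S, set_surj setT setT f,
      max_ideal S = gens [set 0] zs', reg [set 0] zs' & map f zs' = map e zs].
Proof.
have [f [hf hfG]] := extend_completion hG Ac (pres_map hp).
exists f; split=> //; last by rewrite -map_comp; apply: eq_map => z /=.
- by split=> //; rewrite ?Smax //; apply: (local_at_local Gloc).
- have step n a : ideal_exp mA n a -> exists s, G n s /\ ideal_exp mA n.+1 (a - f s).
    elim: n a => [|n IH] a.
      move=> _; have [t ht] := pres_surj hp a.
      exists (i t); rewrite filt0; split=> //; rewrite ideal_exp1 ?hf //.
      exact: local_ideal Al.
    rewrite ideal_expS ideal_mulC {2}/mA mAE => /ideal_mul_gensP [|c hc ->]; first exact: EI.
    have /choice [s hs] : forall j, exists s, G n s /\ ideal_exp mA n.+1 (c j - f s).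
      by move=> j; apply: IH.
    exists (\sum_(j < size zs) s j * zs'`_j); split.
      apply: ideal_sum => // j _; rewrite -addn1; apply: filtM; first by case: (hs j).
      exact: Gz.
    rewrite rmorph_sum size_map -sumrB; apply: ideal_sum => // j _.
    rewrite rmorphM nth_zs' // hf (nth_map 0) // -mulrBl mulrC.
    apply: ideal_expM; last by case: (hs j).
    by rewrite /mA mAE; apply: gens_in; [exact: ideal_zero|apply: map_f; apply: mem_nth].
  move=> a _.
  have /choice [nx hnx] : forall x : nat * A, exists s, ideal_exp mA x.1 x.2 ->
      G x.1 s /\ ideal_exp mA x.1.+1 (x.2 - f s).
    move=> [k x] /=; have [hx|nx] := pselect (ideal_exp mA k x); last by exists 0.
    by have [s hs] := step _ _ hx; exists s.
  pose xx := fix xx k := if k is k'.+1 then xx k' - f (nx (k', xx k')) else a.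
  have hxx k : ideal_exp mA k (xx k).
    by elim: k => [//|k IHk]; have [] := hnx (k, xx k) IHk.
  pose c k := nx (k, xx k).
  have hc k : G k (c k) by have [] := hnx (k, xx k) (hxx k).
  have [|l hl] := compl_lim hG (u := fun K => \sum_(k < K) c k).
    by move=> K; rewrite big_ord_recr /= [X in X - _]addrC addrK.
  exists l => //; apply/eqP; rewrite -subr_eq0; apply/eqP; apply: Ac.1 => K.
  have hK : f (\sum_(k < K) c k) = a - xx K.
    elim: K => [|K IHK]; first by rewrite big_ord0 rmorph0 subrr.
    by rewrite big_ord_recr rmorphD IHK /= -/(c K); ring.
  have -> : f l - a = f (l - \sum_(k < K) c k) - xx K by rewrite rmorphB hK; ring.
  by apply: idealB => //; apply: hfG.
- by rewrite Smax.
Qed.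

End RegularCompletion.

(** * Adjoining a variable to a presentation *)

Section PolyFiltration.
Variables (T : comNzRingType) (F : filtration T).

(** The variable has weight one. Truncated subtraction leaves the coefficients of degree at least
    [n] free, [F 0] being everything. *)
Definition poly_filt n : set {poly T} := [set f : {poly T} | forall i, F (n - i)%N f`_i].

Let FI n := filt_ideal F n.

Lemma poly_filtM i j (f g : {poly T}) : poly_filt i f -> poly_filt j g ->
  poly_filt (i + j) (f * g).
Proof.
move=> hf hg k; rewrite coefM; apply: ideal_sum => // a _.
apply: filt_le (filtM (hf a) (hg (k - a)%N)).
have : (a <= k)%N by rewrite -ltnS.
lia.
Qed.

Lemma poly_filt0 : poly_filt 0 = setT.
Proof. by apply/seteqP; split=> // f _ i; rewrite sub0n filt0. Qed.

Lemma poly_filt_ideal n : is_ideal (poly_filt n).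
Proof.
apply: is_idealI.
- by move=> i; rewrite coef0; apply: ideal0.
- by move=> f g hf hg i; rewrite coefD; apply: idealD.
- by move=> a f hf; apply: (@poly_filtM 0 n) => //; rewrite poly_filt0.
Qed.

Lemma poly_filtS n : poly_filt n.+1 `<=` poly_filt n.
Proof. by move=> f hf i; apply: filt_le (hf i); apply: leq_sub2r. Qed.

Lemma poly_filt_proper : ~ poly_filt 1 1.
Proof. by move=> /(_ 0%N); rewrite coef1 /=; apply: filt_proper. Qed.

Definition poly_filtration := Filtration poly_filt_ideal poly_filt0 poly_filtS
  poly_filtM poly_filt_proper.

Lemma poly_filtC n c : F n c -> poly_filt n c%:P.
Proof.
by move=> hc i; rewrite coefC; case: eqP => [->|_]; rewrite ?subn0 //; apply: ideal0.
Qed.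

Lemma poly_decomp (f : {poly T}) : f = (f`_0)%:P + drop_poly 1 f * 'X.
Proof.
rewrite -{1}(poly_take_drop 1 f) expr1; congr (_ + _).
by apply/polyP => i; rewrite coef_take_poly coefC; case: i.
Qed.

Variables (A : comNzRingType) (e : {rmorphism T -> A}) (zs : seq T).
Hypothesis hp : presentation F e zs.
Variable y : A.
Hypothesis hy : max_ideal A y.

Let mA := max_ideal A.
Let EI n := @ideal_exp_ideal A mA n.

(** With [X] in front, regularity is inherited: multiplication by [X] only shifts coefficients, and
    modulo [X] only the constant coefficient remains, to which the hypothesis on [T] applies. *)
Lemma poly_presentation : exists2 e' : {rmorphism {poly T} -> A},
  presentation poly_filtration e' ('X :: map polyC zs) &
  map e' ('X :: map polyC zs) = y :: map e zs.
Proof.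
pose e' : {rmorphism {poly T} -> A} := horner_eval y \o map_poly e.
have e'E f : e' f = \sum_(i < size f) e f`_i * y ^+ i.
  rewrite /e' /= /horner_eval (horner_coef_wide _ (size_poly _ _)).
  by apply: eq_bigr => i _; rewrite coef_map.
have e'C c : e' c%:P = e c by rewrite /e' /= /horner_eval map_polyC hornerC.
have e'X : e' 'X = y by rewrite /e' /= /horner_eval map_polyX hornerX.
exists e'; last first.
  transitivity (e' 'X :: map e' (map polyC zs)); first by [].
  by rewrite e'X -map_comp; congr cons; apply: eq_map => c; exact: e'C.
have h0 := @ideal_zero {poly T}; have h0T := @ideal_zero T.
have gensC (s : seq T) (x : T) : gens [set 0] s x -> gens [set 0] ('X :: map polyC s) x%:P.
  move=> /(gensP _ _ h0T) [c /eqP]; rewrite subr_eq0 => /eqP ->.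
  have hg := gens_ideal ('X :: map polyC s) h0.
  rewrite rmorph_sum; apply: ideal_sum => // i _; rewrite rmorphM.
  apply: ideal_Ml => //; apply: gens_in => //; rewrite inE; apply/orP; right.
  by apply: map_f; apply: mem_nth.
have gens0C (s : seq T) (f : {poly T}) : gens [set 0] ('X :: map polyC s) f -> gens [set 0] s f`_0.
  have hg := gens_ideal s h0T.
  suff : gens [set 0] ('X :: map polyC s) `<=` [set f : {poly T} | gens [set 0] s f`_0] by apply.
  apply: gens0_sub => [|g].
    apply: is_idealI => [|g h hgg hh|g h hh]; rewrite /mkset.
    - by rewrite coef0; apply: ideal0.
    - by rewrite coefD; apply: idealD.
    - by rewrite coef0M; apply: ideal_Ml.
  rewrite inE => /orP[/eqP->|/mapP [c hc ->]]; rewrite /mkset.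
    by rewrite coefX; apply: ideal0.
  by rewrite coefC; apply: gens_in.
have unit0 (f : {poly T}) : poly_filt 1 f <-> F 1 f`_0.
  split=> [/(_ 0%N)//|h [|i]] //.
  by rewrite subSS sub0n filt0.
split.
- move=> z; rewrite inE => /orP[/eqP->|/mapP [c hc ->]].
    apply/unit0; rewrite coefX; exact: ideal0.
  by apply: poly_filtC; apply: (pres_mem hp).
- move=> n f hf; have [c [hc1 hc2]] := pres_gen hp (hf 0%N).
  exists (fun i => if i is j.+1 then (c j)%:P else drop_poly 1 f); split.
    case=> [|j]; last exact: poly_filtC.
    by move=> i; rewrite coef_drop_poly addn1; exact: (hf i.+1).
  have -> : f - \sum_(i < size ('X :: map polyC zs))
      (if (i : nat) is j.+1 then (c j)%:P else drop_poly 1 f) * ('X :: map polyC zs)`_i =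
      (f`_0 - \sum_(i < size zs) c i * zs`_i)%:P.
    rewrite /= big_ord_recl /= {1}(poly_decomp f) opprD addrA addrK.
    rewrite size_map rmorphB rmorph_sum; congr (_ - _); apply: eq_bigr => i _.
    rewrite [RHS]rmorphM (nth_map 0) ?add0n //.
  exact: poly_filtC.
- move=> f hf; have [|x hx] := pres_unit hp (x := f`_0).
    by move=> h; apply: hf; apply/unit0.
  exists x%:P; apply/unit0; by rewrite coefB coef1 coefMC.
- move=> n f hf; rewrite e'E; apply: ideal_sum => // i _.
  apply: (@ideal_exp_le _ _ _ (n - i + i)%N); first by lia.
  by apply: ideal_exp_mulD; [apply: (pres_map hp)|apply: ideal_expX].
- by move=> a; have [t ht] := pres_surj hp a; exists t%:P; rewrite e'C.
- move=> [|j] n f /= hj.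
    move=> [_ ->]; rewrite subr0 => hf.
    exists 0 => //; rewrite subr0 => i.
    by have := hf i.+1; rewrite coefXM subSS.
  rewrite size_map ltnS in hj; rewrite -map_take (nth_map 0) //.
  set s := take j zs => -[g hg hgf].
  have [x hx hxf] : addI (gens [set 0] s) (F n) f`_0.
    apply: (pres_reg hp) => //; exists g`_0; first exact: gens0C.
    by have := hgf 0%N; rewrite coefB coefCM.
  exists (f - (f`_0 - x)%:P); last first.
    by rewrite subKr; apply: poly_filtC.
  rewrite {1}(poly_decomp f) rmorphB opprB addrACA [_ + x%:P]addrC addrA.
  have hG := gens_ideal ('X :: map polyC s) h0.
  have hX : gens [set 0] ('X :: map polyC s) (drop_poly 1 f * 'X).
    by apply: ideal_Ml => //; apply: gens_in; rewrite // mem_head.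
  have := idealD hG hX (gensC _ _ hx); congr (gens _ _ _); ring.
Qed.

End PolyFiltration.

(** One variable for each [y]: when [ys] generates the maximal ideal of [A], so do the images of the
    parameters, as surjectivity of the cover requires. Redundant generators are harmless, each
    having its own variable. *)
Theorem presentation_extend (A T : comNzRingType) (F : filtration T)
  (e : {rmorphism T -> A}) zs ys : presentation F e zs ->
  (forall y, y \in ys -> max_ideal A y) ->
  exists (T' : comNzRingType) (F' : filtration T') (e' : {rmorphism T' -> A}) zs',
    presentation F' e' zs' /\ map e' zs' = ys ++ map e zs.
Proof.
move=> hp; elim: ys => [|y ys IH] hys; first by exists T, F, e, zs.
have [|T' [F' [e' [zs' [hp' h']]]]] := IH.
  by move=> z hz; apply: hys; rewrite inE hz orbT.
have [|e'' h1 h2] := poly_presentation hp' (y := y).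
  by apply: hys; rewrite mem_head.
by exists {poly T'}, (poly_filtration F'), e'', ('X :: map polyC zs'); rewrite h2 h'.
Qed.

(** * Free commutative rings *)

Section FreeCommutativeRing.
Variable I : choiceType.
Let P : comNzRingType := {malg int[{cmonom I}]}.

Let X (i : I) : P := mkmalgU (ucm i) (1 : int).

Section Eval.
Local Open Scope fset_scope.
Variables (R : comNzRingType) (h : I -> R).

Let ev (k : {cmonom I}) : R := \prod_(i <- finsupp k) h i ^+ k i.

Let evE (k : {cmonom I}) (d : {fset I}) : finsupp k `<=` d ->
  ev k = \prod_(i <- d) h i ^+ k i.
Proof.
move=> le; rewrite /ev (big_fset_incl _ le) //.
by move=> i i_in_d; rewrite -cmE_neq0 negbK => /eqP ->.
Qed.

Let ev_mmorphism : mmorphism ev.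
Proof.
split=> [k l|]; last by rewrite /ev mdom1 big_seq_fset0.
rewrite (evE (fsubsetUl (finsupp k) (finsupp l))) (evE (fsubsetUr (finsupp k) (finsupp l))) /ev mdomD.
by rewrite -big_split /=; apply/eq_bigr=> /= i _; rewrite cmM exprD.
Qed.

HB.instance Definition _ := isMultiplicative.Build {cmonom I} R ev ev_mmorphism.

Lemma malg_eval : exists g : {rmorphism P -> R}, forall i, g (X i) = h i.
Proof.
exists (mmap (intmul (1 : R)) ev) => i.
rewrite /= /X mmapU /= mul1r /ev mdomU big_seq_fset1 cmUU; exact: expr1.
Qed.

End Eval.

Lemma malg_ind (Q : set P) : Q 1 -> (forall x y, Q x -> Q y -> Q (x - y)) ->
  (forall x y, Q x -> Q y -> Q (x * y)) -> (forall i, Q (X i)) -> forall x, Q x.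
Proof.
move=> Q1 QB QM QX.
have Q0 : Q 0 by rewrite -(subrr 1); apply: QB.
have QN x : Q x -> Q (- x) by move=> hx; rewrite -sub0r; apply: QB.
have QD x y : Q x -> Q y -> Q (x + y).
  by move=> hx hy; rewrite -[y]opprK; apply: QB => //; apply: QN.
have Qn x n : Q x -> Q (x *+ n).
  by move=> hx; elim: n => [|n IH]; rewrite ?mulr0n // mulrS; apply: QD.
have Qz x (c : int) : Q x -> Q (x *~ c).
  by move=> hx; case: c => n; [exact: (Qn x n hx)|exact: (QN _ (Qn x n.+1 hx))].
have Qm (k : {cmonom I}) : Q (mkmalgU k (1 : int)).
  move e: (mdeg k) => n; elim: n k e => [|n IH] k e.
    by rewrite (mdeg_eq0I e).
  have [i hi] : exists i, i \in finsupp k.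
    apply: contrapT => hn; move: e; rewrite mdegE big_seq big1 // => i hi.
    by case: hn; exists i.
  have kE : k = mul (ucm i) (divcm k (ucm i)).
    apply/eqP/cmP => j; rewrite cmM cmU divcmE cmU.
    case: eqP => [<-|_]; last by rewrite subn0.
    by rewrite subnKC // lt0n cmE_neq0.
  have -> : mkmalgU k (1 : int) = X i * mkmalgU (divcm k (ucm i)) (1 : int).
    by rewrite [in LHS]kE malgM_def fgmulUU mulr1.
  have e' : mdeg (divcm k (ucm i)) = n.
    by move: e; rewrite {1}kE mdegM mdegU add1n => /succn_inj.
  exact: QM (QX i) (IH _ e').
have Qc (k : {cmonom I}) (c : int) : Q (mkmalgU k c).
  have -> : mkmalgU k c = mkmalgU k (1 : int) *~ c.
    by rewrite -raddfMz /= intz.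
  exact: Qz (Qm k).
move=> x; have Qs (d : seq {cmonom I}) : Q (\sum_(k <- d) mkmalgU k (mcoeff k x)).
  elim: d => [|k d IH]; first by rewrite big_nil.
  rewrite big_cons; exact: (QD _ _ (Qc _ _) IH).
exact: (eq_ind_r Q (Qs _) (monalgE x)).
Qed.

Lemma malg_torsion_free (n : nat) (x : P) : (0 < n)%N -> x *+ n = 0 -> x = 0.
Proof.
move=> n0 h; apply/malgP => k; have := congr1 (mcoeff k) h.
rewrite mcoeffMn !mcoeff0 => /eqP; rewrite Num.Theory.mulrn_eq0 eqn0Ngt n0 /= => /eqP //.
Qed.

(** An abstract interface to integer polynomials in variables indexed by [I]: evaluation, induction
    on expressions, absence of torsion. *)
Theorem free_comring : exists (P : comNzRingType) (X : I -> P),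
  [/\ forall (R : comNzRingType) (h : I -> R),
        exists g : {rmorphism P -> R}, forall i, g (X i) = h i,
      forall Q : set P, Q 1 -> (forall x y, Q x -> Q y -> Q (x - y)) ->
        (forall x y, Q x -> Q y -> Q (x * y)) -> (forall i, Q (X i)) -> forall x, Q x &
      forall (n : nat) (x : P), (0 < n)%N -> x *+ n = 0 -> x = 0].
Proof.
exists P, X; split; [exact: malg_eval|exact: malg_ind|exact: malg_torsion_free].
Qed.

End FreeCommutativeRing.

(** * Residue fields *)

Section Subring.
Variable R : comNzRingType.

Record subring_set := SubringSet {
  subring_carrier :> set R;
  subring_set1 : subring_carrier 1;
  subring_setB : forall x y, subring_carrier x -> subring_carrier y ->
    subring_carrier (x - y);
  subring_setM : forall x y, subring_carrier x -> subring_carrier y ->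
    subring_carrier (x * y) }.

Variable K : subring_set.

Definition subring_pred : {pred R} := fun x => `[< subring_carrier K x >].

Fact subring_pred_closed : subring_closed subring_pred.
Proof.
split=> [|x y|x y]; first by apply/asboolP; apply: subring_set1.
  by move=> /asboolP hx /asboolP hy; apply/asboolP; apply: subring_setB.
by move=> /asboolP hx /asboolP hy; apply/asboolP; apply: subring_setM.
Qed.
HB.instance Definition _ := GRing.isSubringClosed.Build R subring_pred subring_pred_closed.

Record subring_type := SubringType {
  subring_val :> R; subring_valP : subring_val \in subring_pred }.
HB.instance Definition _ := [isSub for subring_val].
HB.instance Definition _ := [Choice of subring_type by <:].
HB.instance Definition _ := [SubChoice_isSubComNzRing of subring_type by <:].

Lemma subring_exists : exists (L : comNzRingType) (i : {rmorphism L -> R}),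
  injective i /\ forall x, subring_carrier K x <-> exists l, x = i l.
Proof.
exists subring_type, (val : {rmorphism subring_type -> R}); split; first exact: val_inj.
move=> x; split=> [hx|[l ->]].
  by exists (SubringType (asboolT hx : x \in subring_pred)).
by have /asboolP := subring_valP l.
Qed.

End Subring.

Section ResidueField.
Variables (R : comNzRingType) (m : set R).
Hypothesis hm : local_at m.
Let mI := local_ideal hm.

Let m_pred : {pred R} := fun x => `[< m x >].

Let m_idealr : idealr_closed m_pred.
Proof.
split.
- by apply/asboolP; apply: ideal0.
- by apply/negP => /asboolP; apply: prime1n; apply: local_prime.
- move=> a u v /asboolP hu /asboolP hv; apply/asboolP.
  by apply: idealD => //; apply: ideal_Ml.
Qed.
HB.instance Definition _ := isIdealr.Build R m_pred m_idealr.

Theorem residue_field : exists (k : fieldType) (r : {rmorphism R -> k}),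
  (forall x, exists a, r a = x) /\ forall a, r a = 0 <-> m a.
Proof.
pose q := {ideal_quot m_pred}.
pose pi (a : R) : q := \pi_q a.
have pi_surj (x : q) : exists a, pi a = x by exists (repr x); rewrite /pi reprK.
have piE a b : pi a = pi b <-> m (a - b).
  rewrite /pi; split=> [/eqP|h]; first by rewrite -Quotient.idealrBE => /asboolP.
  by apply/eqP; rewrite -Quotient.idealrBE; apply/asboolP.
have pi0 : pi 0 = 0 by rewrite /pi rmorph0.
have piM a b : pi (a * b) = pi a * pi b by rewrite /pi rmorphM.
have pi1 : pi 1 = 1 by rewrite /pi rmorph1.
have /choice [inv hinv] : forall x : q, exists y, (x != 0 -> y * x = 1) /\ (x = 0 -> y = 0).
  move=> x; have [->|x0] := eqVneq x 0; first by exists 0.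
  have [a ha] := pi_surj x.
  have [|b hb] := local_unit hm (c := a).
    move=> h; move/eqP: x0; apply; rewrite -ha -pi0; apply/piE; by rewrite subr0.
  exists (pi b); split=> [_|/eqP]; last by rewrite (negPf x0).
  by rewrite -ha -piM mulrC hb pi1.
have hV (x : q) : x != 0 -> inv x * x = 1 by case: (hinv x).
have h0 : inv 0 = 0 by case: (hinv 0) => _; apply.
pose k : fieldType := HB.pack q (GRing.ComNzRing_isField.Build q hV h0).
have [||| r hr] := @rmorphism_of R k pi.
- exact: pi1.
- by move=> x y; rewrite /pi rmorphD.
- by move=> x y; rewrite /pi rmorphM.
exists k, r; split=> [x|a].
  by have [a ha] := pi_surj x; exists a; rewrite hr.
rewrite hr -[0]/(0 : q) -pi0; split=> [/piE|h]; first by rewrite subr0.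
by apply/piE; rewrite subr0.
Qed.

End ResidueField.

(** * Minimal polynomials over a subfield *)

Section MinimalPolynomial.
Variables (L : comNzRingType) (k : fieldType) (i : {rmorphism L -> k}).
Hypothesis i_inj : injective i.
Hypothesis i_inv : forall l : L, l <> 0 -> exists l' : L, l' * l = 1.
Variable a : k.

Lemma monic_minimal (f : {poly L}) : f <> 0 -> (map_poly i f).[a] = 0 ->
  exists g : {poly L}, [/\ g \is monic, (size g <= size f)%N,
    (map_poly i g).[a] = 0 &
    forall h : {poly L}, (size h < size g)%N -> (map_poly i h).[a] = 0 -> h = 0].
Proof.
move=> f0 fa.
have hex : exists n, `[< exists g : {poly L}, [/\ g <> 0, size g = n & (map_poly i g).[a] = 0] >].
  by exists (size f); apply/asboolP; exists f.
case: (ex_minnP hex) => n /asboolP [g [g0 gn ga]] hmin.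
have [l' hl'] : exists l', l' * lead_coef g = 1.
  by apply: i_inv => /eqP; rewrite lead_coef_eq0 => /eqP.
have hlc : (l'%:P * g)`_n.-1 = 1 by rewrite coefCM -gn -lead_coefE.
have n0 : (0 < n)%N by rewrite -gn size_poly_gt0; apply/eqP.
have hsz : size (l'%:P * g) = n.
  apply/eqP; rewrite eqn_leq; apply/andP; split.
    by apply/leq_sizeP => j hj; rewrite coefCM nth_default ?mulr0 // gn.
  rewrite leqNgt; apply/negP => h; have : (l'%:P * g)`_n.-1 = 0.
    by apply: nth_default; rewrite -ltnS prednK.
  by rewrite hlc => /eqP; rewrite oner_eq0.
exists (l'%:P * g); rewrite hsz; split.
- by apply/monicP; rewrite lead_coefE hsz.
- by apply: hmin; apply/asboolP; exists f.
- by rewrite rmorphM hornerM ga mulr0.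
- move=> h hh ha; apply: contrapT => nh; move: hh; rewrite ltnNge => /negP; apply.
  by apply: hmin; apply/asboolP; exists h.
Qed.

Variable p : nat.
Hypothesis hp : p \in [pchar k].
Hypothesis i_frob : exists l, a ^+ p = i l.
Hypothesis na : ~ exists l, a = i l.

(* A minimal polynomial of [a] divides [(X - a) ^ p], hence is some
   [(X - a) ^ d]; if [1 < d < p], its derivative is smaller. *)
Lemma purely_inseparable (f : {poly L}) : (size f <= p)%N ->
  (map_poly i f).[a] = 0 -> f = 0.
Proof.
move=> fp fa; apply: contrapT => f0.
have [g [gm gf ga hmin]] := monic_minimal f0 fa.
have pp : prime p := pcharf_prime hp.
have [l hl] := i_frob.
pose h : {poly L} := 'X^p - l%:P.
have ha : (map_poly i h).[a] = 0.
  by rewrite rmorphB /= map_polyXn map_polyC hornerD hornerN hornerXn hornerC hl subrr.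
have hdiv : h = Pdiv.CommonRing.rdivp h g * g.
  rewrite {1}(Pdiv.RingMonic.rdivp_eq gm h) [X in _ + X]hmin ?addr0 //.
    by rewrite Pdiv.Ring.ltn_rmodp monic_neq0.
  move: ha; rewrite {1}(Pdiv.RingMonic.rdivp_eq gm h) rmorphD rmorphM hornerD hornerM ga.
  by rewrite mulr0 add0r.
have hfrob : map_poly i h = ('X - a%:P) ^+ p.
  have hpk : p \in [pchar {poly k}].
    rewrite inE pp /=; apply/eqP; rewrite -polyC_natr (pcharf0 hp) //.
  have := pFrobenius_autB_comm hpk (mulrC 'X a%:P); rewrite !pFrobenius_autE => ->.
  by rewrite rmorphB /= map_polyXn map_polyC -polyC_exp hl.
have : map_poly i g %| ('X - a%:P) ^+ p.
  by rewrite -hfrob hdiv rmorphM dvdp_mull.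
case/dvdp_exp_XsubCP => d dp.
have gim : map_poly i g \is monic by apply: monic_map.
rewrite eqp_monic ?monic_exp ?monicXsubC // => /eqP gE.
have gs : size g = d.+1.
  by rewrite -(size_map_inj_poly i_inj (rmorph0 i)) gE size_exp_XsubC.
have dltp : (d < p)%N by rewrite -gs (leq_trans gf).
case: d gE gs dltp {dp} => [|[|d]] gE gs dp.
- by move: ga; rewrite gE expr0 hornerC => /eqP; rewrite oner_eq0.
- apply: na; exists (- g`_0); rewrite rmorphN -coef_map gE expr1 coefB coefX coefC /=.
  by rewrite sub0r opprK.
have hd : g^`() = 0.
  apply: hmin; first by apply: lt_size_deriv; apply: monic_neq0.
  rewrite -deriv_map gE deriv_exp derivXsubC mul1r hornerMn exprS hornerM.
  by rewrite hornerXsubC subrr mul0r mul0rn.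
have := congr1 (fun q : {poly L} => q`_d.+1) hd.
rewrite coef_deriv coef0 -{1}[d.+2]/(d.+3.-1) -gs -lead_coefE (monicP gm) => /(congr1 i).
rewrite rmorphMn rmorph1 rmorph0 => /eqP; rewrite -(dvdn_pcharf hp) => /dvdn_leq.
by move=> /(_ isT); rewrite leqNgt dp.
Qed.

End MinimalPolynomial.

(** The order serves to select a [p]-basis greedily and to speak of the largest variable in an
    expression. *)
Lemma well_order_exists (T : choiceType) : exists lt : T -> T -> Prop,
  [/\ forall x, ~ lt x x, forall x y z, lt x y -> lt y z -> lt x z,
      forall x y, x <> y -> lt x y \/ lt y x &
      forall Q : T -> Prop, (forall x, (forall y, lt y x -> Q y) -> Q x) -> forall x, Q x].
Proof.
have [R hR] := wochoice.well_ordering_principle T.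
have hmin (D : T -> Prop) x : D x -> exists2 y, D y & forall z, D z -> R y z.
  move=> Dx; have [|y [[hy hmy] _]] := hR (fun z => `[< D z >]).
    by exists x; apply/asboolP.
  exists y; first by move/asboolP: hy.
  by move=> z hz; apply: hmy; apply/asboolP.
have tot x y : R x y || R y x.
  have [z hz hmz] := hmin (fun z => z = x \/ z = y) x (or_introl erefl).
  by case: hz => ?; subst z; rewrite hmz ?orbT //; [right|left].
have Rxx x : R x x by have := tot x x; rewrite orbb.
have anti x y : R x y -> R y x -> x = y.
  move=> hxy hyx; have [|z [_ hu]] := hR (fun z => `[< z = x \/ z = y >]).
    by exists x; apply/asboolP; left.
  rewrite -(hu x); last first.
    by split; [apply/asboolP; left|move=> w /asboolP [->|->]].
  rewrite (hu y) //; split; [by apply/asboolP; right|by move=> w /asboolP [->|->]].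
have trans x y z : R x y -> R y z -> R x z.
  move=> hxy hyz.
  have [w hw hm] := hmin (fun w => [\/ w = x, w = y | w = z]) x (Or31 _ _ erefl).
  case: hw => ?; subst w; first by apply: hm; apply: Or33.
    by rewrite (anti _ _ hxy (hm x (Or31 _ _ erefl))).
  by rewrite -(anti _ _ hyz (hm y (Or32 _ _ erefl))).
exists (fun x y => R x y /\ x <> y); split.
- by move=> x [].
- move=> x y z [h1 n1] [h2 n2]; split; first exact: trans h2.
  by move=> e; apply: n1; apply: anti => //; rewrite e.
- by move=> x y nxy; have /orP[h|h] := tot x y; [left|right]; split=> // /esym.
- move=> Q hQ x; apply: contrapT => nx.
  have [y ny hm] := hmin (fun z => ~ Q z) x nx.
  apply: ny; apply: hQ => z [hzy nzy]; apply: contrapT => nz.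
  by apply: nzy; apply: anti => //; apply: hm.
Qed.

(** * Generated subrings and congruences of powers *)

Section SubringGenerated.
Variable R : comNzRingType.
Implicit Types (K D : set R) (x y : R).

Definition is_subring K := [/\ K 1, forall x y, K x -> K y -> K (x - y) &
  forall x y, K x -> K y -> K (x * y)].

Definition subring_gen D : set R :=
  [set x | forall K, is_subring K -> D `<=` K -> K x].

Lemma subring_gen_subring D : is_subring (subring_gen D).
Proof.
split=> [K [h1 _ _] //|x y hx hy K hK hD|x y hx hy K hK hD].
  by have [_ h _] := hK; apply: h; [apply: hx|apply: hy].
by have [_ _ h] := hK; apply: h; [apply: hx|apply: hy].
Qed.

Lemma subring_gen_in D : D `<=` subring_gen D.
Proof. by move=> x hx K _; apply. Qed.

Lemma subring_gen_sub D K : is_subring K -> D `<=` K -> subring_gen D `<=` K.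
Proof. by move=> hK hD x; apply. Qed.

Lemma subring_genS D D' : D `<=` D' -> subring_gen D `<=` subring_gen D'.
Proof.
move=> h; apply: subring_gen_sub; first exact: subring_gen_subring.
by apply: subset_trans h _; apply: subring_gen_in.
Qed.

Section Theory.
Variable K : set R.
Hypothesis hK : is_subring K.

Lemma subring1 : K 1. Proof. by case: hK. Qed.
Lemma subringB x y : K x -> K y -> K (x - y). Proof. by case: hK => _ h _; apply: h. Qed.
Lemma subringM x y : K x -> K y -> K (x * y). Proof. by case: hK => _ _ h; apply: h. Qed.
Lemma subring0 : K 0. Proof. by rewrite -(subrr 1); apply: subringB; apply: subring1. Qed.
Lemma subringN x : K x -> K (- x).
Proof. by move=> hx; rewrite -sub0r; apply: subringB => //; apply: subring0. Qed.
Lemma subringD x y : K x -> K y -> K (x + y).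
Proof. by move=> hx hy; rewrite -[y]opprK; apply: subringB => //; apply: subringN. Qed.
Lemma subringX x n : K x -> K (x ^+ n).
Proof.
move=> hx; elim: n => [|n IH]; first exact: subring1.
by rewrite exprS; apply: subringM.
Qed.
Lemma subring_sum (I : Type) (r : seq I) (P : pred I) (F : I -> R) :
  (forall i, P i -> K (F i)) -> K (\sum_(i <- r | P i) F i).
Proof. by move=> h; apply: (big_ind K) => //; [exact: subring0|exact: subringD]. Qed.
End Theory.

End SubringGenerated.

Lemma add_exp_prime (R : comNzRingType) (p : nat) (x y : R) : prime p ->
  exists c, (x + y) ^+ p = x ^+ p + y ^+ p + p%:R * (x * y * c).
Proof.
case: p => [//|[//|p]] hp.
have /choice [k hk] : forall i : 'I_p.+1, exists k, ('C(p.+2, i.+1) = k * p.+2)%N.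
  by move=> i; apply/dvdnP; apply: prime_dvd_bin => //; rewrite /= ltnS ltn_ord.
exists (\sum_(i < p.+1) x ^+ (p - i) * y ^+ i * (k i)%:R).
rewrite exprDn big_ord_recl big_ord_recr /= subn0 expr0 mulr1 bin0 mulr1n.
rewrite subnn expr0 mul1r binn mulr1n -addrA [_ + y ^+ _]addrC; congr (_ + (_ + _)).
rewrite !big_distrr; apply: eq_bigr => i _ /=.
have hi : (i <= p)%N by rewrite -ltnS.
rewrite /bump /= add1n hk -mulr_natr natrM.
have -> : (p.+2 - i.+1 = (p - i).+1)%N by rewrite subSS subSn.
by rewrite !exprS; ring.
Qed.

(** In [x^p - y^p = (x - y) S], the cofactor [S] is congruent to [p y^(p-1)] modulo [q], so it lies
    in [q]. This gain of one order drives the contraction in residue characteristic [p]. *)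
Lemma expr_congr (R : comNzRingType) (p n : nat) (q : set R) (x y : R) :
  is_ideal q -> q p%:R -> ideal_exp q n.+1 (x - y) ->
  ideal_exp q n.+2 (x ^+ p - y ^+ p).
Proof.
move=> hq qp h; rewrite subrXX mulrC; apply: ideal_expM => //.
have hxy : q (x - y) by rewrite -[q]ideal_exp1 //; apply: ideal_exp_le h.
have hX k : q (x ^+ k - y ^+ k) by rewrite subrXX; apply: ideal_Mr.
have -> : \sum_(i < p) x ^+ (p.-1 - i) * y ^+ i =
    \sum_(i < p) (x ^+ (p.-1 - i) - y ^+ (p.-1 - i)) * y ^+ i + p%:R * y ^+ p.-1.
  have -> : p%:R * y ^+ p.-1 = \sum_(i < p) y ^+ p.-1.
    by rewrite sumr_const card_ord mulr_natl.
  rewrite -big_split; apply: eq_bigr => i _ /=.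
  rewrite mulrBl -exprD subnK ?subrK //.
  by case: (p) i => [[]|p'] //= i; rewrite -ltnS.
apply: idealD => //; last exact: ideal_Mr.
by apply: ideal_sum => // i _; apply: ideal_Mr.
Qed.

Lemma limit_rmorphism (P A : comNzRingType) (m : set A) (f : nat -> {rmorphism P -> A}) :
  adic_complete m -> (forall n x, ideal_exp m n (f n.+1 x - f n x)) ->
  exists g : {rmorphism P -> A}, forall n x, ideal_exp m n (g x - f n x).
Proof.
move=> hA hf; have EI n := @ideal_exp_ideal A m n.
have /choice [g hg] : forall x, exists a, forall n, ideal_exp m n (a - f n x).
  by move=> x; apply: hA.2 => n; apply: hf.
have haus a b : (forall n, ideal_exp m n (a - b)) -> a = b.
  by move=> h; apply/eqP; rewrite -subr_eq0; apply/eqP; apply: hA.1.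
have [|x y|x y|g' hg'] := @rmorphism_of P A g.
- by apply: haus => n; rewrite -(rmorph1 (f n)).
- apply: haus => n; have -> : g (x + y) - (g x + g y) = (g (x + y) - f n (x + y))
    - (g x - f n x) - (g y - f n y) by rewrite rmorphD; ring.
  by apply: idealB => //; apply: idealB.
- apply: haus => n; have -> : g (x * y) - g x * g y = (g (x * y) - f n (x * y))
    - (g x - f n x) * g y - f n x * (g y - f n y) by rewrite rmorphM; ring.
  apply: idealB => //; last by apply: ideal_Ml.
  by apply: idealB => //; apply: ideal_Mr.
by exists g' => n x; rewrite hg'.
Qed.

(** * Frobenius lifts and the order of multiples of powers of p *)

Section FrobeniusLift.
Variables (P : comNzRingType) (p : nat) (q : set P) (F : {rmorphism P -> P}).
Hypotheses (pp : prime p) (hq : prime_ideal q) (qp : q p%:R).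
Hypothesis p_reg : forall x : P, p%:R * x = 0 -> x = 0.
Hypothesis F_lift : forall x, exists d, F x - x ^+ p = p%:R * d.

Let qI := prime_isideal hq.
Let EI n := @ideal_exp_ideal P q n.

Let F_in x : q x <-> q (F x).
Proof.
have [d hd] := F_lift x; have hpd : q (p%:R * d) by apply: ideal_Mr.
split=> h.
  rewrite -[F x](subrK (x ^+ p)) hd; apply: idealD => //.
  by rewrite -(prednK (prime_gt0 pp)) exprS; apply: ideal_Mr.
apply: (primeX hq (k := p)); rewrite -[x ^+ p](subKr (F x)) hd; exact: idealB.
Qed.

Let F_exp n x : ideal_exp q n x -> ideal_exp q n (F x).
Proof.
elim: n x => [//|n IH] x.
suff : ideal_mul q (ideal_exp q n) `<=` [set x | ideal_exp q n.+1 (F x)] by apply.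
apply: ideal_mul_sub => [|u v hu hv].
  apply: is_idealI => [|u v hu hv|a u hu]; rewrite /mkset.
  - by rewrite rmorph0; exact: (ideal0 (EI n.+1)).
  - by rewrite rmorphD; exact: (idealD (EI n.+1) hu hv).
  - by rewrite rmorphM; exact: (ideal_Ml _ (EI n.+1) hu).
by rewrite /mkset rmorphM; exact: (ideal_expM ((F_in _).1 hu) (IH _ hv)).
Qed.

Let expX n x : ideal_exp q n x -> ideal_exp q n (x ^+ p).
Proof.
by move=> hx; rewrite -(prednK (prime_gt0 pp)) exprS; exact: (ideal_Mr _ (EI n) hx).
Qed.

(* The [p]-derivation [(F x - x ^ p) / p] lowers the order by at most one. *)
Lemma frobenius_lift_exp n x : ideal_exp q n.+1 x ->
  exists2 d, ideal_exp q n d & F x - x ^+ p = p%:R * d.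
Proof.
elim: n x => [|n IH] x; first by have [d hd] := F_lift x; exists d.
pose G := [set x | ideal_exp q n.+2 x /\
  exists2 d, ideal_exp q n.+1 d & F x - x ^+ p = p%:R * d].
suff h : ideal_mul q (ideal_exp q n.+1) `<=` G by case/h.
apply: ideal_mul_sub => [|u v hu hv].
  apply: is_idealI.
  - split; first exact: (ideal0 (EI n.+2)).
    exists 0; first exact: (ideal0 (EI n.+1)).
    by rewrite rmorph0 expr0n eqn0Ngt prime_gt0 // subrr mulr0.
  - move=> u v [hu [d hd eu]] [hv [d' hd' ev]]; split; first exact: (idealD (EI n.+2)).
    have [c hc] := add_exp_prime u v pp.
    exists (d + d' - u * v * c).
      apply: (idealB (EI n.+1)); first exact: (idealD (EI n.+1)).
      by rewrite -mulrA; exact: (ideal_Mr _ (EI n.+1) (ideal_exp_le (leqnSn n.+1) hu)).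
    by rewrite rmorphD hc !mulrDr mulrN -eu -ev; ring.
  - move=> a u [hu [d hd eu]]; split; first exact: (ideal_Ml _ (EI n.+2)).
    have [b hb] := F_lift a.
    exists (F a * d + b * u ^+ p).
      apply: (idealD (EI n.+1)); apply: (ideal_Ml _ (EI n.+1)) => //.
      by apply: expX; apply: (ideal_exp_le (leqnSn n.+1)).
    rewrite rmorphM exprMn mulrDr [p%:R * (F a * d)]mulrCA -eu mulrA -hb; ring.
split; first exact: ideal_expM.
have [d hd ev] := IH v hv; have [b hb] := F_lift u.
exists (b * F v + u ^+ p * d).
  apply: (idealD (EI n.+1)).
    by apply: (ideal_Ml _ (EI n.+1)); apply: F_exp.
  rewrite -(prednK (prime_gt0 pp)) exprS -mulrA; apply: ideal_expM => //.
  exact: ideal_Ml.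
by rewrite rmorphM exprMn mulrDr [p%:R * (u ^+ p * d)]mulrCA -ev mulrA -hb; ring.
Qed.

(** Apply the [p]-derivation to [p^(n+1) c]: up to a multiple of a high power of [p] it gives
    [p^n F(c)], and the order drops by at most one. By induction [F(c)] is in [q], hence so is
    [c]. *)
Lemma prime_power_order n c : ideal_exp q n.+1 (p%:R ^+ n * c) -> q c.
Proof.
elim: n c => [|n IH] c; first by rewrite ideal_exp1 // mul1r.
move=> /frobenius_lift_exp [d hd].
rewrite rmorphM rmorphXn rmorph_nat exprMn -exprM => e.
apply/F_in; apply: IH.
have p2 := prime_gt1 pp.
have hk : (n.+1 * p = (n.+1 * p).-1.+1)%N by apply: esym; apply: prednK; rewrite muln_gt0 /= prime_gt0.
have -> : p%:R ^+ n * F c = d + p%:R ^+ (n.+1 * p).-1 * c ^+ p.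
  apply/eqP; rewrite -subr_eq0; apply/eqP; apply: p_reg.
  rewrite mulrBr mulrDr -e hk !exprS; ring.
apply: (idealD (EI n.+1)) => //; apply: (ideal_Mr _ (EI n.+1)).
apply: (@ideal_exp_le _ _ _ (n.+1 * p).-1); last exact: ideal_expX.
rewrite -ltnS -hk; nia.
Qed.

End FrobeniusLift.

Section PIndependence.
Variables (A : comNzRingType) (m : set A) (p : nat).
Hypotheses (hm : local_at m) (pp : prime p) (mp : m p%:R).
Variable K : set A.
Hypotheses (hK : is_subring K) (Km : m `<=` K) (Kp : forall x, K (x ^+ p)).
Let mI := local_ideal hm.

(** The image of [K] in the residue field is a field, as it contains all [p]-th powers and
    [1/x = x^(p-1) (1/x)^p]. Because [K] contains [m], the residue of [a] is outside this image, and
    [purely_inseparable] applies. *)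
Lemma p_independent a (c : nat -> A) : ~ K a -> (forall j, K (c j)) ->
  m (\sum_(j < p) c j * a ^+ j) -> forall j, (j < p)%N -> m (c j).
Proof.
move=> na hc hsum; have [k [r [r_surj rm]]] := residue_field hm.
pose rK := [set y | exists2 x, K x & y = r x].
have rK1 : rK 1 by exists 1; rewrite ?rmorph1 //; apply: subring1.
have rKB x y : rK x -> rK y -> rK (x - y).
  by move=> [u hu ->] [v hv ->]; exists (u - v); rewrite ?rmorphB //; apply: subringB.
have rKM x y : rK x -> rK y -> rK (x * y).
  by move=> [u hu ->] [v hv ->]; exists (u * v); rewrite ?rmorphM //; apply: subringM.
have [L [i [i_inj iE]]] := subring_exists (SubringSet rK1 rKB rKM).
have {iE} iE x : rK x <-> exists l, x = i l := iE x.
have rl x : K x -> exists l, r x = i l by move=> hx; apply/iE; exists x.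
have i_inv (l : L) : l <> 0 -> exists l', l' * l = 1.
  move=> l0; have [|x hx hl] := (iE (i l)).2; first by exists l.
  have [|y hy] := local_unit hm (c := x).
    move=> /rm hr; apply: l0; apply: i_inj; by rewrite rmorph0 hl.
  have [l' hl'] : exists l', r (x ^+ p.-1 * y ^+ p) = i l'.
    by apply: rl; apply: subringM => //; apply: subringX.
  exists l'; apply: i_inj; rewrite rmorphM rmorph1 -hl' hl -rmorphM.
  rewrite mulrAC -exprSr prednK ?prime_gt0 // -exprMn hy expr1n; exact: rmorph1.
have hp : p \in [pchar k].
  by rewrite inE pp /= -(rmorph_nat r); apply/eqP; apply/rm.
have i_frob : exists l, r a ^+ p = i l by rewrite -rmorphXn; apply: rl.
have nra : ~ exists l, r a = i l.
  move=> /iE [x hx e]; apply: na; rewrite -[a](subrK x); apply: subringD => //.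
  by apply: Km; apply/rm; rewrite rmorphB e subrr.
have /choice [l hl] : forall j, exists l, r (c j) = i l by move=> j; apply: rl.
pose f := \poly_(j < p) l j.
have f0 : f = 0.
  apply: (purely_inseparable i_inj i_inv hp i_frob nra); first exact: size_poly.
  have -> : map_poly i f = \poly_(j < p) r (c j).
    apply/polyP => j; rewrite coef_map !coef_poly; case: ifP => _; last exact: rmorph0.
    by rewrite hl.
  rewrite horner_poly; transitivity (r (\sum_(j < p) c j * a ^+ j)); last exact/rm.
  rewrite rmorph_sum; apply: eq_bigr => j _.
  by rewrite rmorphM rmorphXn.
move=> j hj; apply/rm; rewrite hl.
have : f`_j = 0 by rewrite f0 coef0.
by rewrite coef_poly hj => ->; rewrite rmorph0.
Qed.

End PIndependence.

(** * Regular covers in residue characteristic p *)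

Section ResidueCharP.
Variable A : comNzRingType.
Hypothesis A_cnl : complete_noetherian_local A.
Let m := max_ideal A.
Variable p : nat.
Hypotheses (pp : prime p) (mp : m p%:R).

Let An : noetherian A. Proof. by case: A_cnl. Qed.
Let hm : local_at m. Proof. by case: A_cnl => ? ? _; apply: max_ideal_local. Qed.
Let mI := local_ideal hm.
Let Ac : adic_complete m. Proof. by case: A_cnl. Qed.

Variable lt : A -> A -> Prop.
Hypotheses (lt_trans : forall x y z, lt x y -> lt y z -> lt x z)
  (lt_total : forall x y, x <> y -> lt x y \/ lt y x)
  (lt_ind : forall Q : A -> Prop, (forall x, (forall y, lt y x -> Q y) -> Q x) -> forall x, Q x).

(** The inverse image in [A] of the subring of the residue field generated by the [p]-th powers and
    the residues of [D]. *)
Let KA (D : set A) := subring_gen (m `|` range (fun x : A => x ^+ p) `|` D).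

Let KA_sub D : is_subring (KA D). Proof. exact: subring_gen_subring. Qed.
Let KA_m D : m `<=` KA D.
Proof. by move=> x hx; apply: subring_gen_in; left; left. Qed.
Let KA_p D x : KA D (x ^+ p).
Proof. by apply: subring_gen_in; left; right; exists x. Qed.
Let KA_in D : D `<=` KA D.
Proof. by move=> x hx; apply: subring_gen_in; right. Qed.
Let KA_min D K : is_subring K -> m `<=` K -> (forall x, K (x ^+ p)) -> D `<=` K -> KA D `<=` K.
Proof.
move=> hK h1 h2 h3; apply: subring_gen_sub => // x [[/h1 //|[y _ <-]]|/h3 //]; exact: h2.
Qed.

(* The residues of the elements of [Gam] form a [p]-basis of the residue field. *)
Let Gam : set A := [set a | ~ KA [set b | lt b a] a].

Let KA_Gam a : KA Gam a.
Proof.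
elim/lt_ind: a => a IH; have [ha|ha] := pselect (Gam a); first exact: KA_in.
have {}ha : KA [set b | lt b a] a by apply: contrapT.
by apply: (KA_min (KA_sub Gam) (@KA_m _) (@KA_p _) _ ha).
Qed.

Variables (P : comNzRingType) (X : A -> P).
Hypotheses (P_eval : forall (R : comNzRingType) (h : A -> R),
    exists g : {rmorphism P -> R}, forall i, g (X i) = h i)
  (P_ind : forall Q : set P, Q 1 -> (forall x y, Q x -> Q y -> Q (x - y)) ->
    (forall x y, Q x -> Q y -> Q (x * y)) -> (forall i, Q (X i)) -> forall x, Q x)
  (P_torsion : forall (n : nat) (x : P), (0 < n)%N -> x *+ n = 0 -> x = 0).

Let P_subring (K : set P) : is_subring K -> (forall a, K (X a)) -> forall x, K x.
Proof. by move=> [h1 h2 h3] h4; apply: P_ind. Qed.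

Variable e0 : {rmorphism P -> A}.
Hypothesis e0X : forall a, e0 (X a) = a.

Let q : set P := [set f | m (e0 f)].

Let hq : prime_ideal q.
Proof.
have [_ m1 mM] := local_prime hm; split=> [||x y]; rewrite /q /=.
- apply: is_idealI => [|x y hx hy|a x hx]; rewrite /mkset.
  + by rewrite rmorph0; apply: ideal0.
  + by rewrite rmorphD; apply: idealD.
  + by rewrite rmorphM; apply: ideal_Ml.
- by rewrite rmorph1.
- by rewrite rmorphM; apply: mM.
Qed.

Let qI := prime_isideal hq.
Let qp : q p%:R. Proof. by rewrite /q /= rmorph_nat. Qed.
Let EI n := @ideal_exp_ideal P q n.
Let p_reg (x : P) : p%:R * x = 0 -> x = 0.
Proof. by rewrite mulr_natl; apply: P_torsion; apply: prime_gt0. Qed.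

Let frob_lift : exists F : {rmorphism P -> P}, forall x, exists d, F x - x ^+ p = p%:R * d.
Proof.
have [F hF] := P_eval (fun a => X a ^+ p); exists F.
have neg (y : P) : exists d, (- y) ^+ p = - y ^+ p + p%:R * d.
  have [c hc] := add_exp_prime y (- y) pp.
  exists (- (y * - y * c)); rewrite subrr expr0n eqn0Ngt prime_gt0 //= in hc.
  have -> : (- y) ^+ p = (y ^+ p + (- y) ^+ p + p%:R * (y * - y * c)) - y ^+ p
    - p%:R * (y * - y * c) by ring.
  by rewrite -hc; ring.
apply: P_ind.
- by exists 0; rewrite rmorph1 expr1n subrr mulr0.
- move=> x y [d hd] [b hb].
  have [c hc] := add_exp_prime x (- y) pp; have [n hn] := neg y.
  exists (d - b - n - x * - y * c); rewrite hc hn rmorphB !mulrBr -hd -hb; ring.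
- move=> x y [d hd] [b hb]; exists (d * F y + x ^+ p * b).
  rewrite rmorphM exprMn mulrDr [p%:R * (x ^+ p * b)]mulrCA -hb mulrA -hd; ring.
- by move=> a; exists 0; rewrite hF subrr mulr0.
Qed.

Let order_lemma n c : ideal_exp q n.+1 (p%:R ^+ n * c) -> q c.
Proof.
have [F hF] := frob_lift; exact: (prime_power_order pp hq qp p_reg hF).
Qed.

(** The counterpart of [KA] in [P], with the multiples of [p] in place of the maximal ideal: on
    these elements, two substitutions fixing the variables of [D] agree to one order more than on
    [P]. *)
Let KP (D : set A) := subring_gen
  (range (fun x : P => x ^+ p) `|` range (fun x : P => p%:R * x) `|` X @` D).

Let KP_sub D : is_subring (KP D). Proof. exact: subring_gen_subring. Qed.
Let KP_p D x : KP D (x ^+ p).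
Proof. by apply: subring_gen_in; left; left; exists x. Qed.
Let KP_pM D x : KP D (p%:R * x).
Proof. by apply: subring_gen_in; left; right; exists x. Qed.
Let KP_in D a : D a -> KP D (X a).
Proof. by move=> h; apply: subring_gen_in; right; exists a. Qed.
Let KP_min D K : is_subring K -> (forall x, K (x ^+ p)) -> (forall x, K (p%:R * x)) ->
  (forall a, D a -> K (X a)) -> KP D `<=` K.
Proof.
move=> hK h1 h2 h3; apply: subring_gen_sub => // x [[[y _ <-]|[y _ <-]]|[a ha <-]].
- exact: h1.
- exact: h2.
- exact: h3.
Qed.

Let e0_KP D x : KP D x -> KA D (e0 x).
Proof.
suff : KP D `<=` [set x | KA D (e0 x)] by apply.
apply: KP_min => [|y|y|a ha]; rewrite /mkset.
- split=> [|y z hy hz|y z hy hz]; rewrite /mkset.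
  + by rewrite rmorph1; exact: (subring1 (KA_sub D)).
  + by rewrite rmorphB; exact: (subringB (KA_sub D) hy hz).
  + by rewrite rmorphM; exact: (subringM (KA_sub D) hy hz).
- by rewrite rmorphXn.
- by rewrite rmorphM rmorph_nat; apply: KA_m; apply: ideal_Mr.
- by rewrite e0X; apply: KA_in.
Qed.

Let KA_KP D a : KA D a -> exists2 g, KP D g & m (a - e0 g).
Proof.
pose K := [set a | exists2 g, KP D g & m (a - e0 g)].
suff h : KA D `<=` K by apply: h.
apply: KA_min.
- split.
  + by exists 1; [exact: (subring1 (KP_sub D))|rewrite rmorph1 subrr; exact: (ideal0 mI)].
  + move=> x y [g hg h1] [g' hg' h2]; exists (g - g'); first exact: (subringB (KP_sub D) hg hg').
    have -> : x - y - e0 (g - g') = (x - e0 g) - (y - e0 g') by rewrite rmorphB; ring.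
    exact: (idealB mI h1 h2).
  + move=> x y [g hg h1] [g' hg' h2]; exists (g * g'); first exact: (subringM (KP_sub D) hg hg').
    have -> : x * y - e0 (g * g') = (x - e0 g) * y + e0 g * (y - e0 g').
      by rewrite rmorphM; ring.
    by exact: (idealD mI (ideal_Mr _ mI h1) (ideal_Ml _ mI h2)).
- by move=> x hx; exists 0; [exact: (subring0 (KP_sub D))|rewrite rmorph0 subr0].
- by move=> x; exists (X x ^+ p) => //; rewrite rmorphXn e0X subrr; exact: (ideal0 mI).
- by move=> x hx; exists (X x); [exact: KP_in|rewrite e0X subrr; exact: (ideal0 mI)].
Qed.

(** Expressions sorted by their largest basis variable: polynomials in [X g] with coefficients built
    on smaller variables. *)
Let Kle (g : A) : set P := [set x | exists2 f : {poly P},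
  forall i, KP [set b | Gam b /\ lt b g] f`_i & x = f.[X g]].

Let Kle_sub g : is_subring (Kle g).
Proof.
have hK := KP_sub [set b | Gam b /\ lt b g].
split.
- exists 1; last by rewrite hornerC.
  by move=> i; rewrite coef1; case: (i == 0%N); [exact: (subring1 hK)|exact: (subring0 hK)].
- move=> _ _ [f hf ->] [h hh ->]; exists (f - h); last by rewrite hornerD hornerN.
  by move=> i; rewrite coefB; exact: (subringB hK (hf i) (hh i)).
- move=> _ _ [f hf ->] [h hh ->]; exists (f * h); last by rewrite hornerM.
  by move=> i; rewrite coefM; apply: (subring_sum hK) => j _; exact: (subringM hK).
Qed.

Let Kle_C g x : KP [set b | Gam b /\ lt b g] x -> Kle g x.
Proof.
move=> hx; exists x%:P; last by rewrite hornerC.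
by move=> i; rewrite coefC; case: (i == 0%N) => //; exact: (subring0 (KP_sub _)).
Qed.

Let Kle_X g : Kle g (X g).
Proof.
exists 'X; last by rewrite hornerX.
have hK := KP_sub [set b | Gam b /\ lt b g].
by move=> i; rewrite coefX; case: (i == 1%N); [exact: (subring1 hK)|exact: (subring0 hK)].
Qed.

(** [X g ^ p] is a [p]-th power, so its powers are absorbed into the coefficients and exponents
    below [p] suffice. *)
Let Kle_reduce g x : Kle g x -> exists c : nat -> P,
  (forall j, KP [set b | Gam b /\ lt b g] (c j)) /\ x = \sum_(j < p) c j * X g ^+ j.
Proof.
have hK := KP_sub [set b | Gam b /\ lt b g].
move=> [f hf ->]; exists (fun j => \sum_(i < size f | (i %% p)%N == j) f`_i * (X g ^+ p) ^+ (i %/ p)).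
split=> [j|]; first by apply: (subring_sum hK) => i _; apply: (subringM hK) => //; exact: (subringX hK).
pose h (i : 'I_(size f)) : 'I_p := Ordinal (ltn_pmod i (prime_gt0 pp)).
rewrite horner_coef (partition_big h predT) //=; apply: eq_bigr => j _.
rewrite big_distrl; apply: eq_bigr => i /eqP <- /=.
by rewrite -exprM -mulrA -exprD mulnC -divn_eq.
Qed.

(** Expressions [u^p + p v] are closed under the ring operations by the binomial theorem; any other
    expression has a largest basis variable, the order being total. *)
Let KP_split D w0 : D `<=` Gam -> KP D w0 ->
  (exists u v, w0 = u ^+ p + p%:R * v) \/ exists2 g, D g & Kle g w0.
Proof.
move=> DG.
pose K := [set x | (exists u v, x = u ^+ p + p%:R * v) \/ exists2 g, D g & Kle g x].
suff h : KP D `<=` K by apply: h.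
have p0 := prime_gt0 pp.
have base_Kle g y : (exists u v, y = u ^+ p + p%:R * v) -> Kle g y.
  by move=> [u [v ->]]; apply: Kle_C; exact: (subringD (KP_sub _)).
have Kle_le g h y : D g -> Kle g y -> lt g h -> Kle h y.
  move=> Dg [f hf ->] gh; apply: Kle_C; have hK := KP_sub [set b | Gam b /\ lt b h].
  rewrite horner_coef; apply: (subring_sum hK) => i _; apply: (subringM hK).
    have := hf i; apply: subring_genS => z [hz|[b [hb1 hb2] <-]]; [by left|right].
    by exists b => //; split=> //; apply: lt_trans gh.
  by apply: (subringX hK); apply: KP_in; split=> //; apply: DG.
have binary (op : P -> P -> P) : (forall g x y, Kle g x -> Kle g y -> Kle g (op x y)) ->
    (forall u v u' v', exists w z, op (u ^+ p + p%:R * v) (u' ^+ p + p%:R * v') = w ^+ p + p%:R * z) ->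
    forall x1 x2, K x1 -> K x2 -> K (op x1 x2).
  move=> h1 h2 x1 x2 K1; case: K1 => [hy|[g1 hg hy]]; case=> [hz|[g2 hh hz]].
  - by left; move: hy hz => [u [v ->]] [u' [v' ->]]; apply: h2.
  - by right; exists g2 => //; apply: h1 => //; apply: base_Kle.
  - by right; exists g1 => //; apply: h1 => //; apply: base_Kle.
  - right; have [e|ne] := pselect (g1 = g2); last have [l12|l21] := lt_total ne.
    + by exists g1 => //; apply: h1 => //; rewrite ?e.
    + by exists g2 => //; apply: h1 => //; apply: Kle_le l12.
    + by exists g1 => //; apply: h1 => //; apply: Kle_le l21.
apply: KP_min.
- split.
  + by left; exists 1, 0; rewrite expr1n mulr0 addr0.
  + apply: binary => [g y z|u v u' v']; first exact: (subringB (Kle_sub g)).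
    have [c hc] := add_exp_prime (u - u') u' pp.
    exists (u - u'), (v - v' + (u - u') * u' * c); rewrite subrK in hc; rewrite hc; ring.
  + apply: binary => [g y z|u v u' v']; first exact: (subringM (Kle_sub g)).
    exists (u * u'), (v * (u' ^+ p + p%:R * v') + u ^+ p * v'); rewrite exprMn; ring.
- by move=> y; left; exists y, 0; rewrite mulr0 addr0.
- by move=> y; left; exists 0, y; rewrite expr0n eqn0Ngt p0 add0r.
- by move=> a ha; right; exists a.
Qed.

Let J2 : set P := adj (ideal_exp q 2) p%:R.
Let J2I : is_ideal J2. Proof. exact: adj_ideal. Qed.

Let base_J2 x : q x -> (exists u v, x = u ^+ p + p%:R * v) -> J2 x.
Proof.
move=> hx [u [v xE]]; exists v; rewrite [v * _]mulrC xE addrK.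
have hu : q u.
  apply: (primeX hq (k := p)); have -> : u ^+ p = x - p%:R * v by rewrite xE; ring.
  by apply: idealB => //; apply: ideal_Mr.
by apply: (@ideal_exp_le _ _ _ p); [exact: prime_gt1|exact: ideal_expX].
Qed.

(** Induction on the largest variable. In [x = sum_j c_j X_g^j] with [j < p], [p]-independence puts
    every [c_j] in [q], and the [c_j] involve smaller variables only. At the bottom, if [u^p + p v]
    is in [q], so is [u], and [u^p] is in [q^2]. *)
Let Kle_J2 g x : Gam g -> Kle g x -> q x -> J2 x.
Proof.
elim/lt_ind: g x => g IH x hg /Kle_reduce [c [hc ->]] hx.
have hcm j : (j < p)%N -> m (e0 (c j)).
  have hD : [set b | Gam b /\ lt b g] `<=` [set b | lt b g] by move=> b [].
  have ec i : KA [set b | lt b g] (e0 (c i)).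
    by have := e0_KP (hc i); apply: subring_genS => z [hz|/hD hz]; [left|right].
  apply: (p_independent hm pp mp (KA_sub [set b | lt b g]) (@KA_m _) (@KA_p _) hg ec).
  have : m (e0 (\sum_(j < p) c j * X g ^+ j)) := hx.
  rewrite rmorph_sum; congr (m _); apply: eq_bigr => i _.
  by rewrite rmorphM rmorphXn e0X.
apply: ideal_sum => [|j _]; first exact: J2I.
apply: (ideal_Mr _ J2I).
have hj := hcm j (ltn_ord j).
have [|h|[g' [hg' hlt] hK]] := KP_split _ (hc j); first by move=> b [].
  exact: base_J2.
exact: (IH g').
Qed.

Let KP_J2 x : KP Gam x -> q x -> J2 x.
Proof.
move=> hK hx; have [//|h|[g hg h]] := KP_split _ hK; first exact: base_J2.
exact: Kle_J2 hg h hx.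
Qed.

(** Basis variables stay fixed; any other [a] is congruent modulo [m] to the image of an element of
    [KP Gam], because [Gam] and the [p]-th powers generate the residue field. *)
Let gg_exists : exists g : A -> P, forall a,
  [/\ KP Gam (g a), m (a - e0 (g a)) & Gam a -> g a = X a].
Proof.
suff /choice [g hg] : forall a, exists g, [/\ KP Gam g, m (a - e0 g) & Gam a -> g = X a].
  by exists g.
move=> a; have [ha|ha] := pselect (Gam a).
  by exists (X a); split=> //; [exact: KP_in|rewrite e0X subrr; exact: ideal0].
by have [g h1 h2] := KA_KP (KA_Gam a); exists g; split.
Qed.

(** * A Cohen ring as a limit of substitutions *)

Section Contraction.
Variable g : A -> P.
Hypothesis hg : forall a, [/\ KP Gam (g a), m (a - e0 (g a)) & Gam a -> g a = X a].
Variable Th : {rmorphism P -> P}.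
Hypothesis ThX : forall a, Th (X a) = g a.

Let Thn := fix Thn n : {rmorphism P -> P} := if n is n'.+1 then Thn n' \o Th else idfun.

Let ThnS n x : Thn n.+1 x = Thn n (Th x). Proof. by []. Qed.

Let ThnS' n x : Thn n.+1 x = Th (Thn n x).
Proof. by elim: n x => // n IH x; rewrite ThnS IH. Qed.

Let congr_subring (f h : {rmorphism P -> P}) (I : set P) : is_ideal I ->
  is_subring [set x | I (f x - h x)].
Proof.
move=> hI; split=> [|x y hx hy|x y hx hy]; rewrite /mkset.
- by rewrite !rmorph1 subrr; apply: ideal0.
- have -> : f (x - y) - h (x - y) = (f x - h x) - (f y - h y) by rewrite !rmorphB; ring.
  exact: idealB.
- have -> : f (x * y) - h (x * y) = (f x - h x) * f y + h x * (f y - h y).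
    by rewrite !rmorphM; ring.
  by apply: idealD => //; [apply: ideal_Mr|apply: ideal_Ml].
Qed.

Let Thn_Gam n a : Gam a -> Thn n (X a) = X a.
Proof.
move=> ha; elim: n => // n IH; rewrite ThnS ThX.
by have [_ _ ->] := hg a.
Qed.

(** [Th] maps [P] into [KP Gam], where a congruence between two iterates gains one order: on [p]-th
    powers by [expr_congr], on multiples of [p] because [p] is in [q], while basis variables are
    fixed. *)
Let contract n x : ideal_exp q n.+1 (Thn n.+1 x - Thn n x).
Proof.
elim: n x => [|n IH].
  apply: P_subring; first exact: congr_subring.
  move=> a; rewrite /mkset ideal_exp1 //; change (m (e0 (Th (X a) - X a))).
  rewrite ThX rmorphB e0X -opprB.
  by apply: idealN => //; have [] := hg a.
apply: P_subring; first exact: congr_subring.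
move=> a; rewrite /mkset (ThnS n.+1 (X a)) (ThnS n (X a)) ThX.
have [hga _ _] := hg a.
suff hs : KP Gam `<=` [set y | ideal_exp q n.+2 (Thn n.+1 y - Thn n y)] by exact: (hs _ hga).
apply: KP_min => [|y|y|b hb]; rewrite /mkset.
- exact: congr_subring.
- by rewrite !rmorphXn; apply: expr_congr.
- by rewrite !rmorphM !rmorph_nat -mulrBr; apply: ideal_expM.
- by rewrite !Thn_Gam // subrr; exact: (ideal0 (EI n.+2)).
Qed.

Let contract_le n k x : (n <= k)%N -> ideal_exp q n.+1 (Thn k x - Thn n x).
Proof.
move/subnK <-; elim: (k - n)%N => [|j IH].
  by rewrite subrr; apply: (ideal0 (EI n.+1)).
rewrite addSn -[Thn _.+1 x](subrK (Thn (j + n)%N x)) -addrA.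
apply: (idealD (EI n.+1)) => //.
by apply: (@ideal_exp_le _ _ _ (j + n).+1); [rewrite ltnS leq_addl|exact: contract].
Qed.

Let Thn_q n x : q (Thn n x) <-> q x.
Proof.
have h : q (Thn n x - x) by rewrite -[q]ideal_exp1 //; apply: (@contract_le 0 n).
by split=> hx; [exact: (idealBr qI h)|exact: (idealBl qI h)].
Qed.

(* Modulo [b n], the ring [P] is [W / p ^ n] for a Cohen ring [W] of the residue
   field: [Thn] converges to a retraction killing the [X a - g a], and [b n] is
   the inverse image of [q ^ n] under the limit. *)
Let b n : set P := [set x | ideal_exp q n (Thn n x)].

Let b_stable n k x : (n <= k)%N -> b n x <-> ideal_exp q n (Thn k x).
Proof.
move=> nk; have h : ideal_exp q n (Thn k x - Thn n x).
  by apply: (@ideal_exp_le _ _ _ n.+1) => //; apply: contract_le.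
by split=> hx; [exact: (idealBl (EI n) h)|exact: (idealBr (EI n) h)].
Qed.

Let b_ideal n : is_ideal (b n).
Proof.
apply: is_idealI => [|x y hx hy|a x hx]; rewrite /b /mkset.
- by rewrite rmorph0; apply: ideal0.
- by rewrite rmorphD; apply: idealD.
- by rewrite rmorphM; apply: ideal_Ml.
Qed.

Let b0 : b 0 = setT. Proof. by apply/seteqP; split. Qed.

Let bS n : b n.+1 `<=` b n.
Proof.
move=> x hx; apply/(b_stable x (leqnSn n)); exact: (ideal_exp_le (leqnSn n) hx).
Qed.

Let bM i j x y : b i x -> b j y -> b (i + j) (x * y).
Proof.
move=> /(b_stable x (leq_addr j i)) hx /(b_stable y (leq_addl i j)) hy.
by rewrite /b /mkset rmorphM; apply: ideal_exp_mulD.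
Qed.

Let b1E x : b 1 x <-> q x.
Proof. by rewrite /b /mkset ideal_exp1 //; apply: Thn_q. Qed.

Let b_proper : ~ b 1 1.
Proof. by move=> /b1E; apply: prime1n hq. Qed.

Let bF := Filtration b_ideal b0 bS bM b_proper.

Let b_p : b 1 p%:R. Proof. by apply/b1E. Qed.

Let b_pX n x : b n (p%:R ^+ n * x).
Proof.
have -> : n = (n + 0)%N by rewrite addn0.
rewrite {2}addn0; apply: bM; last by rewrite b0.
by rewrite /b /mkset rmorphXn rmorph_nat; apply: ideal_expX.
Qed.

(** [Th] sends [q] into [q] and into [KP Gam], hence into [q^2 + (p)]; taking products, it sends
    [q^n] into [(p^n) + q^(n+1)]. This is why [p] is the only parameter. *)
Let Th_exp n x : ideal_exp q n x -> exists u, ideal_exp q n.+1 (Th x - p%:R ^+ n * u).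
Proof.
elim: n x => [|n IH] x.
  by move=> _; exists (Th x); rewrite mul1r subrr; apply: (ideal0 (EI 1)).
pose G := [set x | exists u, ideal_exp q n.+2 (Th x - p%:R ^+ n.+1 * u)].
suff h : ideal_mul q (ideal_exp q n) `<=` G by apply: h.
apply: ideal_mul_sub => [|y z hy hz].
  apply: is_idealI.
  - exists 0; rewrite rmorph0 mulr0 subr0; exact: (ideal0 (EI n.+2)).
  - move=> y z [u hu] [v hv]; exists (u + v).
    have -> : Th (y + z) - p%:R ^+ n.+1 * (u + v) =
      (Th y - p%:R ^+ n.+1 * u) + (Th z - p%:R ^+ n.+1 * v) by rewrite rmorphD; ring.
    exact: (idealD (EI n.+2)).
  - move=> a y [u hu]; exists (Th a * u).
    have -> : Th (a * y) - p%:R ^+ n.+1 * (Th a * u) = Th a * (Th y - p%:R ^+ n.+1 * u).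
      by rewrite rmorphM; ring.
    exact: (ideal_Ml _ (EI n.+2)).
have [u hu] := IH z hz.
have [v hv] : J2 (Th y).
  apply: KP_J2; last exact: ((Thn_q 1 y).2 hy).
  apply: (P_subring (K := [set y | KP Gam (Th y)])) => [|a].
    have hK := KP_sub Gam; split=> [|y1 y2 h1 h2|y1 y2 h1 h2]; rewrite /mkset.
    - by rewrite rmorph1; exact: (subring1 hK).
    - by rewrite rmorphB; exact: (subringB hK h1 h2).
    - by rewrite rmorphM; exact: (subringM hK h1 h2).
  by rewrite /mkset ThX; case: (hg a).
exists (v * u).
have -> : Th (y * z) - p%:R ^+ n.+1 * (v * u) =
  (Th y - v * p%:R) * Th z + p%:R * v * (Th z - p%:R ^+ n * u).
  by rewrite rmorphM exprS; ring.
have hTz : ideal_exp q n (Th z).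
  rewrite -[Th z](subrK (p%:R ^+ n * u)); apply: (idealD (EI n)).
    exact: (ideal_exp_le (leqnSn n) hu).
  by apply: ideal_Mr => //; apply: ideal_expX.
apply: (idealD (EI n.+2)); first exact: (ideal_exp_mulD hv hTz).
by apply: ideal_expM => //; apply: ideal_Mr.
Qed.

Let b_gen n x : b n x -> exists u, b n.+1 (x - p%:R ^+ n * u).
Proof.
move=> /Th_exp [u hu]; exists u.
rewrite /b /mkset rmorphB ThnS' rmorphM rmorphXn rmorph_nat.
have -> : Th (Thn n x) - p%:R ^+ n * Thn n.+1 u =
  (Th (Thn n x) - p%:R ^+ n * u) - p%:R ^+ n * (Thn n.+1 u - u) by ring.
apply: (idealB (EI n.+1)) => //; rewrite mulrC; apply: ideal_expM.
  by rewrite -[q]ideal_exp1 //; apply: (@contract_le 0 n.+1).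
exact: ideal_expX.
Qed.

(** Climb one step at a time: if [x = p^j u] modulo [b j.+1], then [p^(j+1) u] lies in [b j.+2], so
    [u] is in [q] by [order_lemma] and [x] is in [b j.+1]. *)
Let b_reg n x : b n.+1 (p%:R * x) -> b n x.
Proof.
move=> hx; suff h j : (j <= n)%N -> b j x by exact: h.
elim: j => [|j IH] hj; first by rewrite b0.
have [u hu] := b_gen (IH (ltnW hj)).
rewrite -[x](subrK (p%:R ^+ j * u)); apply: (idealD (b_ideal j.+1) hu).
have hpu : b j.+2 (p%:R ^+ j.+1 * u).
  have -> : p%:R ^+ j.+1 * u = p%:R * x - p%:R * (x - p%:R ^+ j * u).
    by rewrite exprS; ring.
  apply: (idealB (b_ideal j.+2)); last exact: (bM b_p hu).
  exact: (filt_le (F := bF) (i := j.+2) (j := n.+1) hj hx).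
move: hpu; rewrite {1}/b /mkset rmorphM rmorphXn rmorph_nat => /order_lemma /Thn_q hu'.
by rewrite mulrC -add1n; apply: bM; [apply/b1E|rewrite -[_ ^+ j]mulr1; apply: b_pX].
Qed.

(** [e0] itself need not respect the filtration: [X a - g a] lies in every [b n], while its image
    under [e0] is only known to be in [m]. The limit of the maps [e0 \o Thn n] does respect it. *)
Lemma char_p_presentation : exists e : {rmorphism P -> A}, presentation bF e [:: p%:R].
Proof.
have e0_exp n x : ideal_exp q n x -> ideal_exp m n (e0 x).
  elim: n x => // n IH x.
  suff : ideal_mul q (ideal_exp q n) `<=` [set x | ideal_exp m n.+1 (e0 x)] by apply.
  have hE := @ideal_exp_ideal A m n.+1.
  apply: ideal_mul_sub => [|y z hy hz].
    apply: is_idealI => [|y z hy hz|a y hy]; rewrite /mkset.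
    - by rewrite rmorph0; exact: (ideal0 hE).
    - by rewrite rmorphD; exact: (idealD hE hy hz).
    - by rewrite rmorphM; exact: (ideal_Ml _ hE hy).
  by rewrite /mkset rmorphM; exact: (ideal_mul_in (hy : m (e0 y)) (IH z hz)).
have [e he] : exists e : {rmorphism P -> A}, forall n x, ideal_exp m n (e x - e0 (Thn n x)).
  apply: (@limit_rmorphism _ _ m (fun n => e0 \o Thn n)) => // n x /=.
  rewrite -rmorphB; apply: e0_exp; apply: (@ideal_exp_le _ _ _ n.+1) => //.
  exact: contract.
exists e; split.
- by move=> z; rewrite inE => /eqP ->.
- move=> n x /b_gen [u hu]; exists (fun _ => p%:R ^+ n * u); split=> [i|]; first exact: b_pX.
  rewrite /= big_ord1 /=; move: hu; congr (b _ _); rewrite exprS; ring.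
- move=> x hx; have [|y hy] := local_unit hm (c := e0 x).
    by move=> h; apply: hx; apply/b1E.
  exists (X y); apply/b1E; rewrite /q /= rmorphB rmorphM e0X hy rmorph1 subrr.
  exact: ideal0.
- move=> n x hx; rewrite -[e x](subrK (e0 (Thn n x))).
  apply: (idealD (@ideal_exp_ideal A m n)) => //; exact: e0_exp.
- move=> a; exists (X a).
  have h1 : m (e (X a) - e0 (Thn 1 (X a))).
    by have := he 1%N (X a); rewrite ideal_exp1.
  have h2 : m (e0 (Thn 1 (X a)) - e0 (X a)).
    have := @contract 0 (X a); rewrite ideal_exp1 // => h.
    by have : m (e0 (Thn 1 (X a) - Thn 0 (X a))) := h; rewrite rmorphB.
  have -> : a - e (X a) = - ((e (X a) - e0 (Thn 1 (X a))) + (e0 (Thn 1 (X a)) - e0 (X a))).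
    by rewrite e0X; ring.
  by apply: idealN => //; apply: idealD.
- move=> [|//] n x _ /= [_ -> ]; rewrite subr0 => /b_reg hx.
  by exists 0 => //; rewrite subr0.
Qed.

End Contraction.

Lemma char_p_presentation_exists : exists (T : comNzRingType) (F : filtration T)
  (e : {rmorphism T -> A}) (zs : seq T), presentation F e zs.
Proof.
have [g hg] := gg_exists; have [Th hTh] := P_eval g.
have [e he] := char_p_presentation hg hTh.
by exists P; eexists; exists e; eexists; exact: he.
Qed.

End ResidueCharP.

Theorem presentation_char_p (A : comNzRingType) (p : nat) :
  complete_noetherian_local A -> prime p -> max_ideal A p%:R ->
  exists (T : comNzRingType) (F : filtration T)
    (e : {rmorphism T -> A}) (zs : seq T), presentation F e zs.
Proof.
move=> hA hp mp; have [lt [_ h2 h3 h4]] := well_order_exists A.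
have [P [X [P1 P2 P3]]] := free_comring A.
have [e0 he0] := P1 A id.
exact: (char_p_presentation_exists hA hp mp h2 h3 h4 P1 P2 P3 he0).
Qed.

(** * Regular covers in residue characteristic zero *)

Lemma horner_addE (R : comNzRingType) (f : {poly R}) (x h : R) :
  exists c, f.[x + h] = f.[x] + f^`().[x] * h + h ^+ 2 * c.
Proof.
elim/poly_ind: f => [|f a [c hc]]; first by exists 0; rewrite derivC !hornerE.
exists (f^`().[x] + c * (x + h)); rewrite derivMXaddC !hornerE hc; ring.
Qed.

Lemma horner_subE (R : comNzRingType) (f : {poly R}) (x y : R) :
  exists c, f.[x] - f.[y] = (x - y) * c.
Proof.
have [c hc] := horner_addE f y (x - y); exists (f^`().[y] + (x - y) * c).
rewrite addrC subrK in hc; rewrite hc; ring.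
Qed.

(** Newton's iteration with the inverse [w] of the derivative at [a] kept fixed: each step still
    gains one order, and only one inverse is needed. *)
Lemma hensel (A : comNzRingType) (G : {poly A}) (a : A) :
  complete_noetherian_local A -> max_ideal A G.[a] -> ~ max_ideal A G^`().[a] ->
  exists2 b, max_ideal A (a - b) & G.[b] = 0.
Proof.
set m := max_ideal A; case=> An Al [A_sep A_lim] Ga dGa; have hm := max_ideal_local An Al.
have mI := local_ideal hm; have EI n := @ideal_exp_ideal A m n.
have expm n x : ideal_exp m n.+1 x -> m x.
  by move/(ideal_exp_le (isT : (1 <= n.+1)%N)); rewrite ideal_exp1.
have [w hw] := local_unit hm dGa.
pose u := fix u n := if n is n'.+1 then u n' - w * G.[u n'] else a.
have hu n : m (u n - a) /\ ideal_exp m n.+1 G.[u n].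
  elim: n => [|n [IH1 IH2]]; first by rewrite ideal_exp1 // subrr; split=> //; apply: ideal0.
  split.
    rewrite /= addrAC; exact: (idealB mI IH1 (ideal_Ml _ mI (expm _ _ IH2))).
  rewrite [u n.+1]/=; have [c ->] := horner_addE G (u n) (- (w * G.[u n])).
  have [d hd] := horner_subE G^`() (u n) a.
  have -> : G.[u n] + G^`().[u n] * - (w * G.[u n]) + (- (w * G.[u n])) ^+ 2 * c =
      - ((u n - a) * G.[u n] * (w * d)) + G.[u n] * G.[u n] * (w ^+ 2 * c).
    have -> : G^`().[u n] = G^`().[a] + (u n - a) * d by rewrite -hd; ring.
    transitivity (G.[u n] * (1 - G^`().[a] * w) - (u n - a) * G.[u n] * (w * d)
      + G.[u n] * G.[u n] * (w ^+ 2 * c)); first by ring.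
    by rewrite hw; ring.
  apply: (idealD (EI n.+2)); last first.
    apply: (ideal_Mr _ (EI n.+2)); exact: (ideal_mul_in (expm _ _ IH2) IH2).
  apply: (idealN (EI n.+2)); apply: (ideal_Mr _ (EI n.+2)).
  exact: (ideal_mul_in IH1 IH2).
have [n|b hb] := A_lim u.
  rewrite /= addrAC subrr add0r; apply: (idealN (EI n)); apply: (ideal_Ml _ (EI n)).
  by apply: (@ideal_exp_le _ _ _ n.+1) => //; case: (hu n).
exists b.
  have -> : a - b = - ((b - u 1%N) + (u 1%N - a)) by ring.
  apply: (idealN mI); apply: (idealD mI); last by case: (hu 1%N).
  by have := hb 1%N; rewrite ideal_exp1.
apply: A_sep => n; have [c hc] := horner_subE G b (u n).
rewrite -[G.[b]](subrK G.[u n]) hc; apply: (idealD (EI n)).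
  exact: (ideal_Mr _ (EI n)).
by apply: (@ideal_exp_le _ _ _ n.+1) => //; case: (hu n).
Qed.

Section ResidueCharZero.
Variable A : comNzRingType.
Hypothesis A_cnl : complete_noetherian_local A.
Let m := max_ideal A.
Hypothesis mnat : forall n, (0 < n)%N -> ~ m n%:R.

Let hm : local_at m. Proof. by case: A_cnl => ? ? _; apply: max_ideal_local. Qed.
Let mI := local_ideal hm.

(** Subrings that inject into the residue field; a maximal one will be a coefficient field. *)
Let good (K : set A) := is_subring K /\ forall x, K x -> m x -> x = 0.

Let int_good : good (range (fun z : int => z%:~R)).
Proof.
split; first split.
- by exists 1.
- by move=> _ _ [x _ <-] [y _ <-]; exists (x - y) => //; rewrite intrB.
- by move=> _ _ [x _ <-] [y _ <-]; exists (x * y) => //; rewrite intrM.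
have nat0 n : m n%:R -> n%:R = 0 :> A by case: n => // n /mnat; case.
move=> _ [[n|n] _ <-]; first exact: nat0.
rewrite NegzE mulrNz => /(idealN mI); rewrite opprK => /nat0 h.
by rewrite -pmulrn h oppr0.
Qed.

Let good_maximal : exists2 K, good K & forall K', good K' -> K `<=` K' -> K' = K.
Proof.
have [|K [hK Kmax]] := @Zorn_bigcup A [set K | K = set0 \/ good K].
  move=> F hF Ftot; have [h|/existsNP [K0 /not_implyP [FK0 K0n]]] :=
    pselect (forall K, F K -> K = set0).
    by left; apply/seteqP; split=> // x [K /h ->].
  have FG K x : F K -> K x -> good K by move=> /hF [->|//].
  right; split; last by move=> x [K FK Kx]; have [_] := FG _ _ FK Kx; apply.
  have pair x y : (\bigcup_(X in F) X) x -> (\bigcup_(X in F) X) y ->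
      exists K, [/\ F K, good K, K x & K y].
    move=> [X FX Xx] [Y FY Yy]; have [h|h] := Ftot _ _ FX FY.
      by exists Y; split=> //; [exact: FG Yy|exact: h].
    by exists X; split=> //; [exact: FG Xx|exact: h].
  split.
  - exists K0 => //; have [//|[[]] //] := hF _ FK0.
  - by move=> x y /pair h /h [K [FK [hK _] Kx Ky]]; exists K => //; apply: subringB.
  - by move=> x y /pair h /h [K [FK [hK _] Kx Ky]]; exists K => //; apply: subringM.
have K_good : good K.
  case: hK => // K0; case: (Kmax _ _ (or_intror int_good)); rewrite K0; split=> //.
  by move=> /(_ 1); apply; exists 1.
exists K => // K' hK' KK'; apply: contrapT => ne.
apply: (Kmax K'); last by right.
by split=> // h; apply: ne; apply/seteqP.
Qed.

(** By maximality, [a] is in [K] once no nonzero value at [a] of a polynomial over [K] lies in [m].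
    This applies to inverses of elements of [K], to elements whose residue is transcendental over
    [K], and to the Hensel lift of an algebraic residue, whose minimal polynomial is separable. *)
Lemma coefficient_field : exists (L : comNzRingType) (i : {rmorphism L -> A}),
  (forall l : L, l <> 0 -> exists l', l * l' = 1) /\ forall a, exists l, m (a - i l).
Proof.
have [K [K_sub Km] Kmax] := good_maximal; have [K1 KB KM] := K_sub.
have [L [i [i_inj iK]]] := subring_exists (SubringSet K1 KB KM).
have {iK} iK x : K x <-> exists l, x = i l := iK x.
have Ki l : K (i l) by apply/iK; exists l.
have im l : m (i l) -> l = 0 by move=> /(Km _ (Ki l)) h; apply: i_inj; rewrite h rmorph0.
have adjoin a : (forall f : {poly L}, m (map_poly i f).[a] -> (map_poly i f).[a] = 0) -> K a.
  move=> h; rewrite -(Kmax [set x | exists f : {poly L}, x = (map_poly i f).[a]]).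
  - by exists 'X; rewrite map_polyX hornerX.
  - split; last by move=> _ [f ->]; apply: h.
    split.
    + by exists 1; rewrite rmorph1 hornerC.
    + by move=> _ _ [f ->] [g ->]; exists (f - g); rewrite rmorphB hornerD hornerN.
    + by move=> _ _ [f ->] [g ->]; exists (f * g); rewrite rmorphM hornerM.
  - by move=> x /iK [l ->]; exists l%:P; rewrite map_polyC hornerC.
have i_inv (l : L) : l <> 0 -> exists l', l * l' = 1.
  move=> l0; have [|y hy] := local_unit hm (c := i l); first by move/im.
  suff /iK [l' hl'] : K y.
    by exists l'; apply: i_inj; rewrite rmorphM -hl' hy rmorph1.
  (* Multiplying [f(1/l)] by a power of [l] brings it back into the image of [L], which meets [m]
     only in zero. *)
  apply: adjoin => f hf; set n := size f.
  have hfn : (i l) ^+ n * (map_poly i f).[y] = i (\sum_(j < n) f`_j * l ^+ (n - j)).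
    rewrite (horner_coef_wide _ (size_poly _ _)) mulr_sumr rmorph_sum; apply: eq_bigr => j _.
    have -> : i l ^+ n = i l ^+ (n - j) * i l ^+ j by rewrite -exprD subnK // ltnW.
    rewrite coef_map rmorphM rmorphXn /=.
    transitivity (i f`_j * i l ^+ (n - j) * (i l * y) ^+ j); first by rewrite exprMn; ring.
    by rewrite hy expr1n mulr1.
  have hlyn : (i l * y) ^+ n = 1 by rewrite hy expr1n.
  rewrite -[LHS]mul1r -hlyn exprMn mulrAC hfn (im (\sum_(j < n) _)) ?rmorph0 ?mul0r //.
  by rewrite -hfn; apply: (ideal_Ml _ mI).
exists L, i; split=> // a.
have [k [r [r_surj rm]]] := residue_field hm.
pose ri : {rmorphism L -> k} := r \o i.
have ri_inv (l : L) : l <> 0 -> exists l', l' * l = 1.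
  by move=> /i_inv [l' h]; exists l'; rewrite mulrC.
have r_horner (f : {poly L}) b : r (map_poly i f).[b] = (map_poly ri f).[r b].
  by rewrite -horner_map /= -map_poly_comp.
have [h|/existsNP [f /not_implyP [fa f0]]] :=
    pselect (forall f : {poly L}, (map_poly ri f).[r a] = 0 -> f = 0).
  suff /iK [l ->] : K a by exists l; rewrite subrr; apply: (ideal0 mI).
  by apply: adjoin => f /rm; rewrite r_horner => /h ->; rewrite rmorph0 horner0.
have [g [gm _ ga gmin]] := monic_minimal ri_inv f0 fa.
have [|dga|b hab hb] := @hensel A (map_poly i g) a A_cnl.
- by apply/rm; rewrite r_horner.
- have g1 : (1 < size g)%N.
    rewrite ltnNge; apply/negP => /size1_polyC gC; move: gm ga; rewrite gC monicE lead_coefC.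
    move=> /eqP ->; rewrite map_polyC hornerC => h.
    have : ri 1 = 1 by exact: rmorph1.
    by rewrite [ri 1]h => /esym/eqP; rewrite oner_eq0.
  (* A derivative vanishing at the residue of [a] is zero by minimality of [g]; but its top
     coefficient is the degree of [g], a positive integer, which is not in [m]. *)
  have dg0 : g^`() = 0.
    apply: gmin; first by apply: lt_size_deriv; apply: monic_neq0.
    by rewrite -r_horner -deriv_map; apply/rm.
  have h : ((size g).-1)%:R = 0 :> L.
    have := congr1 (fun h : {poly L} => h`_(size g).-2) dg0; rewrite coef_deriv coef0.
    have -> : (size g).-2.+1 = (size g).-1 by rewrite prednK // -ltnS prednK // ltnW.
    by rewrite -lead_coefE (monicP gm).
  apply: (@mnat (size g).-1); first by rewrite -ltnS prednK // ltnW.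
  by have := congr1 i h; rewrite rmorph_nat rmorph0 => ->; apply: (ideal0 mI).
- suff /iK [l hl] : K b by exists l; rewrite -hl.
  apply: adjoin => h /rm; rewrite {1}(Pdiv.RingMonic.rdivp_eq gm h) => hf.
  rewrite (Pdiv.RingMonic.rdivp_eq gm h) [X in _ + X]gmin.
  + by rewrite addr0 rmorphM hornerM hb mulr0.
  + by rewrite Pdiv.Ring.ltn_rmodp monic_neq0.
  + move: hf; rewrite rmorphD rmorphM hornerD hornerM hb mulr0 add0r r_horner.
    by have /rm := hab; rewrite rmorphB => /eqP; rewrite subr_eq0 => /eqP <-.
Qed.

End ResidueCharZero.

Lemma presentation_char_0 (A : comNzRingType) :
  complete_noetherian_local A -> (forall n, (0 < n)%N -> ~ max_ideal A n%:R) ->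
  exists (T : comNzRingType) (F : filtration T)
    (e : {rmorphism T -> A}) (zs : seq T), presentation F e zs.
Proof.
move=> hA mnat; have [L [i [i_inv i_surj]]] := coefficient_field hA mnat.
(* A field is regular with no parameters, filtered by the powers of its zero ideal. *)
pose F n : set L := if n is 0 then setT else [set 0].
have FI n : is_ideal (F n).
  by case: n => [|n]; [apply: is_idealI|exact: (@ideal_zero L)].
have FS n : F n.+1 `<=` F n by case: n => [|n] x.
have FM j k x y : F j x -> F k y -> F (j + k)%N (x * y).
  case: j k => [|j] [|k] //=; rewrite ?addn0.
  - by move=> _ ->; rewrite mulr0.
  - by move=> -> _; rewrite mul0r.
  - by move=> -> _; rewrite mul0r.
have F1 : ~ F 1%N 1 by move/eqP; rewrite oner_eq0.
exists L, (Filtration FI erefl FS FM F1), i, [::]; split=> //=.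
- move=> n x ->; exists (fun=> 0); split=> [j|]; first exact: (ideal0 (FI n)).
  by rewrite big_ord0 subr0.
- by move=> x x0; have [y hy] := i_inv x x0; exists y; rewrite hy subrr.
- move=> [|n] t //= ->; rewrite rmorph0; exact: (ideal0 (@ideal_exp_ideal A _ n.+1)).
Qed.

(** * Existence of regular covers and conclusion *)

Theorem presentation_exists (A : comNzRingType) : complete_noetherian_local A ->
  exists (T : comNzRingType) (F : filtration T)
    (e : {rmorphism T -> A}) (zs : seq T), presentation F e zs.
Proof.
move=> hA; have [[p [hp mp]]|h] := pselect (exists p, prime p /\ max_ideal A p%:R).
  exact: presentation_char_p mp.
apply: presentation_char_0 => //.
have hm : local_at (max_ideal A) by case: hA => ? ? _; apply: max_ideal_local.
have [_ m1 mM] := local_prime hm.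
elim/ltn_ind=> n IH n0; have [n1|n1] := leqP n 1%N.
  by have -> : n = 1%N by apply/eqP; rewrite eqn_leq n1.
rewrite -(divnK (pdiv_dvd n)) natrM => /mM[|hp]; last first.
  by apply: h; exists (pdiv n); rewrite pdiv_prime.
apply: IH; first exact: ltn_Pdiv (prime_gt1 (pdiv_prime n1)) n0.
by rewrite divn_gt0 ?pdiv_gt0 //; apply: dvdn_leq n0 (pdiv_dvd n).
Qed.

(** [y] is listed before the generators of the maximal ideal, so that the first parameter maps to
    it; in the application [y] lifts a uniformizer of [O]. *)
Theorem regular_cover (A : comNzRingType) (y : A) :
  complete_noetherian_local A -> max_ideal A y ->
  exists (S : comNzRingType) (f : {rmorphism S -> A}) (z : S) (zs : seq S),
    [/\ complete_noetherian_local S, set_surj setT setT f,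
        max_ideal S = gens [set 0] (z :: zs), reg [set 0] (z :: zs) & f z = y].
Proof.
move=> hA my; have [An Al _] := hA; have hm := max_ideal_local An Al.
have mI := local_ideal hm.
have [T0 [F0 [e0 [zs0 hp0]]]] := presentation_exists hA.
have [s hs] := An _ mI.
have hys x : x \in y :: s -> max_ideal A x.
  by rewrite inE => /orP[/eqP -> //|hx]; rewrite hs ideal_genE; apply: gens_in => //; exact: ideal_zero.
have [T [F [e [zs [hp ezs]]]]] := presentation_extend hp0 hys.
have mAE : max_ideal A = gens [set 0] (map e zs).
  apply/seteqP; split.
    rewrite {1}hs ideal_genE; apply: gens0_sub; first exact: gens_ideal (@ideal_zero A).
    move=> x hx; apply: gens_in; first exact: ideal_zero.
    by rewrite ezs !inE mem_cat hx orbT.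
  apply: gens0_sub => // x /mapP [t ht ->].
  by have := pres_map hp (pres_mem hp ht); rewrite ideal_exp1.
have [S [i [G hG]]] := completion_exists F.
have [f [S_cnl f_surj mS hr hf]] := regular_completion hA hp mAE hG.
case: zs ezs {hp mAE} hr mS hf => // z zs [ez _] hr mS [hfz _].
by exists S, f, (i z), (map i zs); split=> //; rewrite hfz.
Qed.

Theorem propositionA6 (O : comNzRingType)
    (O_dvr : dvr O) (O_cnl : complete_noetherian_local O)
    (A B : augmented_ring O) (phi : {rmorphism A -> B})
    (phi_aug : augmented_map phi) (phi_surj : set_surj setT setT phi)
    (B_depth : has_depth B 1)
    (lPhi leta : nat) (lPhiP : has_length (Phi A) lPhi)
    (letaP : has_length (Oeta B) leta) (le_Phi_eta : (lPhi <= leta)%N) :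
  bijective phi /\ complete_intersection A /\ complete_intersection B.
Proof.
have [On Ol _] := O_cnl; have [w _ mO] := dvr_uniformizer O_dvr On Ol.
have [An Al _] := aug_cnl A.
have [y _ yw] := @aug_surj _ _ (aug_pi A) w I.
have my : max_ideal A y.
  apply/(surj_local (max_ideal_local An Al) (max_ideal_local On Ol) (@aug_surj _ _ (aug_pi A))).
  by rewrite yw mO; apply: adj_in; exact: ideal_zero.
have [S [f [z [zs [S_cnl f_surj mS hr fz]]]]] := regular_cover (aug_cnl A) my.
have mOz : max_ideal O = adj [set 0] (aug_pi A (f z)) by rewrite fz yw.
exact: (criterion O_dvr O_cnl phi_aug phi_surj B_depth lPhiP letaP le_Phi_eta
  S_cnl f_surj mS hr mOz).
Qed.
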